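(* Let $m\in\mathbb{N}$ and let $Q\in L^1_{\mathrm{loc}}(\mathbb{R})^{m\times m}$ be a complex $m\times m$ matrix-valued function satisfying $Q(x)=Q(x)^\top$ for a.e. $x\in\mathbb{R}$. Then the minimally defined Dirac-type operator $D_{\min}(Q)$ associated with the differential expression $$M(Q)=i\begin{pmatrix} \frac{d}{dx}I_m & -Q\\ -Q^* & -\frac{d}{dx}I_m\end{pmatrix}$$ is essentially $\mathcal{J}$-self-adjoint in $L^2(\mathbb{R})^{2m}$, that is, $$\overline{D_{\min}(Q)}=\mathcal{J}D_{\min}(Q)^*\mathcal{J}.$$ Moreover, $$\overline{D_{\min}(Q)}=D_{\max}(Q),$$ and hence $D_{\max}(Q)$ is $\mathcal{J}$-self-adjoint.
   Context: Notation: $A^\top$ is the transpose and $A^*$ the adjoint (conjugate transpose) of a matrix $A$; $I_m$ is the identity matrix in $\mathbb{C}^m$; $L^1_{\mathrm{loc}}(\mathbb{R})^{m\times m}$ is the space of $m\times m$ matrices with entries in $L^1_{\mathrm{loc}}(\mathbb{R})$; $AC_{\mathrm{loc}}(\mathbb{R})$ is the set of locally absolutely continuous complex-valued functions on $\mathbb{R}$. The Hilbert space is $L^2(\mathbb{R})^{2m}=L^2(\mathbb{R})^m\oplus L^2(\mathbb{R})^m$. The antilinear conjugation $\mathcal{J}$ in $L^2(\mathbb{R})^{2m}$ is $\mathcal{J}=\sigma_1\mathcal{C}$, where $$\sigma_1=\begin{pmatrix}0&I_m\\ I_m&0\end{pmatrix},\qquad \mathcal{C}(a_1,\ldots,a_m,b_1,\ldots,b_m)^\top=(\overline{a_1},\ldots,\overline{a_m},\overline{b_1},\ldots,\overline{b_m})^\top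 .$$ Maximal operator: $D_{\max}(Q)F=M(Q)F$ for $F\in\mathrm{dom}(D_{\max}(Q))=\{G\in L^2(\mathbb{R})^{2m} \mid G\in AC_{\mathrm{loc}}(\mathbb{R})^{2m},\ M(Q)G\in L^2(\mathbb{R})^{2m}\}$. Minimal operator: $D_{\min}(Q)F=M(Q)F$ for $F\in\mathrm{dom}(D_{\min}(Q))=\{G\in\mathrm{dom}(D_{\max}(Q)) \mid \mathrm{supp}(G)\text{ is compact}\}$. A densely defined linear operator $S$ in $L^2(\mathbb{R})^{2m}$ is called $\mathcal{J}$-self-adjoint if $S=\mathcal{J}S^*\mathcal{J}$ (equality of operators including domains, with $\mathrm{dom}(\mathcal{J}S^*\mathcal{J})=\mathcal{J}\,\mathrm{dom}(S^* )$). A densely defined, closable operator $T$ is called essentially $\mathcal{J}$-self-adjoint if its closure $\overline{T}$ is $\mathcal{J}$-self-adjoint, that is, if $\overline{T}=\mathcal{J}T^*\mathcal{J}$. *)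

(* Defs.v *)
From HB Require Import structures.
From mathcomp Require Import all_boot all_order all_algebra.
From mathcomp Require Import all_classical all_reals all_analysis.
From mathcomp Require Import complex.

Set Implicit Arguments.
Unset Strict Implicit.
Unset Printing Implicit Defensive.
Import Order.TTheory GRing.Theory Num.Theory.
Import numFieldNormedType.Exports.

Local Open Scope classical_set_scope.
Local Open Scope ring_scope.
Local Open Scope complex_scope.
Local Open Scope sesquilinear_scope.

(* Elements of L^2(R)^n are represented by Borel functions R -> C^n, identified
   when they agree almost everywhere.  An operator in L^2(R)^n is given by its
   graph, a set of pairs of such functions which is saturated for a.e. equality
   (see [linear_operator]), so that two operators coincide, domains included,
   exactly when their graphs are equal as sets. *)

Definition vfun (R : realType) (n : nat) := R -> 'cV[R[i]]_n.

Definition graph (R : realType) (n : nat) := set (vfun R n * vfun R n).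

Section L2.
Context {R : realType}.
Implicit Type n : nat.

Local Notation mu := (@lebesgue_measure R).

Definition ReF (f : R -> R[i]) : R -> R := fun x => complex.Re (f x).
Definition ImF (f : R -> R[i]) : R -> R := fun x => complex.Im (f x).

Definition cintegral (f : R -> R[i]) : R[i] :=
  (\int[mu]_x ReF f x)%R +i* (\int[mu]_x ImF f x)%R.

Definition L2C (f : R -> R[i]) : Prop :=
  ReF f \in Lfun mu 2%:E /\ ImF f \in Lfun mu 2%:E.

Definition L2 n (F : vfun R n) : Prop := forall j, L2C (fun x => F x j 0).

Definition L1locC (f : R -> R[i]) : Prop :=
  locally_integrable setT (ReF f) /\ locally_integrable setT (ImF f).

(* linear in the second argument, antilinear in the first one *)
Definition inner n (F G : vfun R n) : R[i] :=
  cintegral (fun x => ((F x)^t* *m G x) 0 0).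

Definition L2norm n (F : vfun R n) : R :=
  Num.sqrt (complex.Re (inner F F)).

End L2.

Section AbsoluteContinuity.
Context {R : realType}.

Definition abs_continuous_on (a b : R) (f : R -> R[i]) : Prop :=
  forall e : R, 0 < e -> exists2 d : R, 0 < d &
    forall (k : nat) (s t : 'I_k -> R),
      (forall i, a <= s i /\ s i <= t i /\ t i <= b) ->
      trivIset setT (fun i => `]s i, t i[%classic) ->
      \sum_(i < k) (t i - s i) < d ->
      \sum_(i < k) `|f (t i) - f (s i)| < e%:C.

Definition AC_loc (f : R -> R[i]) : Prop :=
  forall a b : R, a <= b -> abs_continuous_on a b f.

Definition AC_locV (n : nat) (F : vfun R n) : Prop :=
  forall j, AC_loc (fun x => F x j 0).

Definition cderive (f : R -> R[i]) (x : R) : R[i] :=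
  derive1 (ReF f) x +i* derive1 (ImF f) x.

Definition vderive (n : nat) (F : vfun R n) : vfun R n :=
  fun x => \col_j cderive (fun y => F y j 0) x.

End AbsoluteContinuity.

Section Operators.
Context {R : realType} {n : nat}.
Implicit Types (S T : graph R n) (F G H K : vfun R n).

Local Notation mu := (@lebesgue_measure R).

Definition dom T : set (vfun R n) := [set F | exists G, T (F, G)].

Definition single_valued T : Prop :=
  forall F G K, T (F, G) -> T (F, K) -> G = K %[ae mu].

Definition linear_operator T : Prop :=
  [/\ forall F G, T (F, G) -> L2 F /\ L2 G,
      forall F F' G G', T (F, G) -> L2 F' -> L2 G' ->
        F = F' %[ae mu] -> G = G' %[ae mu] -> T (F', G'),
      T (0, 0),
      forall (c : R[i]) F F' G G', T (F, G) -> T (F', G') ->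
        T (fun x => c *: F x + F' x, fun x => c *: G x + G' x) &
      single_valued T].

Definition densely_defined T : Prop :=
  forall F, L2 F -> forall e : R, 0 < e ->
    exists2 F', dom T F' & L2norm (fun x => F x - F' x) < e.

Definition op_closure T : graph R n := [set FG |
  [/\ L2 FG.1, L2 FG.2 & forall e : R, 0 < e ->
    exists FG' : vfun R n * vfun R n,
      [/\ T FG', L2norm (fun x => FG.1 x - FG'.1 x) < e &
          L2norm (fun x => FG.2 x - FG'.2 x) < e]]].

Definition closable T : Prop := single_valued (op_closure T).

Definition adjoint T : graph R n := [set GH |
  [/\ L2 GH.1, L2 GH.2 & forall F K, T (F, K) ->
    inner GH.1 K = inner GH.2 F]].

(* J S J as a composition of graphs, for an involution J of L^2 *)
Definition op_conj (J : vfun R n -> vfun R n) S : graph R n := [set FG |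
  exists2 K, S (J FG.1, K) & FG.2 = J K].

End Operators.

Section Jconjugation.
Context {R : realType} {m : nat}.

Definition sigma1 : 'M[R[i]]_(m + m) := block_mx 0 1%:M 1%:M 0.

Definition Jconj (F : vfun R (m + m)) : vfun R (m + m) :=
  fun x => sigma1 *m map_mx Num.conj (F x).

Definition J_selfadjoint (S : graph R (m + m)) : Prop :=
  [/\ linear_operator S, densely_defined S & S = op_conj Jconj (adjoint S)].

Definition essentially_J_selfadjoint (T : graph R (m + m)) : Prop :=
  [/\ linear_operator T, densely_defined T, closable T &
      J_selfadjoint (op_closure T)].

End Jconjugation.

Section Dirac.
Context {R : realType} {m : nat}.
Variable Q : R -> 'M[R[i]]_m.

Local Notation mu := (@lebesgue_measure R).

Definition MQ (F : vfun R (m + m)) : vfun R (m + m) := fun x =>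
  'i *: (block_mx 1%:M 0 0 (- 1%:M) *m vderive F x
         + block_mx 0 (- Q x) (- (Q x)^t*) 0 *m F x).

(* In both graphs U is the (unique) locally absolutely continuous
   representative of the class of F: the derivative and the support are those
   of U. *)
Definition Dmax : graph R (m + m) := [set FG |
  [/\ L2 FG.1, L2 FG.2 & exists U,
    [/\ AC_locV U, FG.1 = U %[ae mu] & FG.2 = MQ U %[ae mu]]]].

Definition Dmin : graph R (m + m) := [set FG |
  [/\ L2 FG.1, L2 FG.2 & exists U,
    [/\ AC_locV U, FG.1 = U %[ae mu], FG.2 = MQ U %[ae mu] &
        compact (closure [set x | U x != 0])]]].

End Dirac.

(* Main.v *)
(* The Dirac system M(Q) F = 0 reads F' = A F with A skew-Hermitian, so it has a
   unitary fundamental matrix Phi.  Variation of constants F = Phi c gives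
   M(Q) F = i sigma3 Phi c', with Phi and i sigma3 Phi unitary: up to unitary
   multiplication operators on both sides, D_max(Q) and D_min(Q) are the maximal
   and minimal operators of d/dx.  For d/dx, cut-offs show that the maximal
   operator is the closure of the minimal one, and the du Bois-Reymond lemma that
   their common adjoint is minus the maximal operator.  The symmetry of Q enters
   only through J: it makes Phi^T (sigma1 sigma3) Phi constant, whence J turns the
   adjoint of D_min(Q) into D_max(Q). *)

Require Import Defs.
From HB Require Import structures.
From mathcomp Require Import all_boot all_order all_algebra.
From mathcomp Require Import all_classical all_reals all_analysis.
From mathcomp Require Import complex finmap measurable_realfun.
From mathcomp Require Import ring lra.

Set Implicit Arguments.
Unset Strict Implicit.
Unset Printing Implicit Defensive.
Import Order.TTheory GRing.Theory Num.Theory.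
Import numFieldNormedType.Exports.

Local Open Scope classical_set_scope.
Local Open Scope ring_scope.
Local Open Scope complex_scope.
Local Open Scope sesquilinear_scope.

(** * Absolutely continuous functions are primitives *)

Section AbsolutelyContinuousPairs.
Context {R : realType}.
Implicit Types (a b : R) (f g : R -> R) (p q : R * R) (s : seq (R * R)).

(** Since [Q] is only locally integrable, [Q F] need not be square integrable even for smooth [F] of
    compact support: the domain of [Dmin Q] contains no evident class of test functions. Conjugation
    by unitary fields removes [Q] altogether, so that density, adjoint and closure are settled once,
    for constant coefficients. The same roughness shapes the analysis underneath. Solutions are
    differentiable only almost everywhere, so the calculus is carried by pairs [(f, g)] with [g]
    locally integrable and the increments of [f] equal to the integrals of [g] ([primitive]); by
    Radon-Nikodym every function that is absolutely continuous in the epsilon-delta sense is such an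
    [f]. The fundamental matrix is a Dyson series, whose factorial bounds are taken in the primitive
    of a norm of the coefficient instead of the length of the interval. Closedness of the maximal
    operator of d/dx is not proved by a limit of representatives: it comes from this operator being
    minus an adjoint. *)

Definition pair_in a b p := [&& a <= p.1, p.1 <= p.2 & p.2 <= b].
Definition pair_disj p q := (p.2 <= q.1) || (q.2 <= p.1).
Definition pairs_length s : R := \sum_(p <- s) (p.2 - p.1).
Definition pairs_variation f s : R := \sum_(p <- s) `|f p.2 - f p.1|.

(** Finite families of intervals are lists of pairs here, where [abs_continuous_on] indexes them by
    ordinals: lists can be concatenated and refined by induction. *)
Definition abs_cont a b f := forall e : R, 0 < e -> exists2 d : R, 0 < d &
  forall s, all (pair_in a b) s -> pairwise pair_disj s ->
    pairs_length s < d -> pairs_variation f s < e.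

Lemma partition_pair_in a b (s : seq R) : itv_partition a b s ->
  all (pair_in a b) (zip (a :: s) s).
Proof.
elim: s a => [//|x s ih] a abs /=.
have xbs := itv_partition_cons abs.
case: abs => /= /andP[ax _] _.
have xb := itv_partition_le xbs.
rewrite /pair_in /= lexx (ltW ax) xb /=.
apply: sub_all (ih _ xbs) => p /and3P[h1 h2 h3].
by rewrite /pair_in (le_trans (ltW ax) h1) h2 h3.
Qed.

Lemma partition_pair_disj a b (s : seq R) : itv_partition a b s ->
  pairwise pair_disj (zip (a :: s) s).
Proof.
elim: s a => [//|x s ih] a abs /=.
have xbs := itv_partition_cons abs.
rewrite (ih _ xbs) andbT.
apply: sub_all (partition_pair_in xbs) => p /and3P[h1 h2 h3].
by rewrite /pair_disj /= h1.
Qed.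

Lemma partition_pairs_length a b (s : seq R) : itv_partition a b s ->
  pairs_length (zip (a :: s) s) = b - a.
Proof.
rewrite /pairs_length; elim: s a => [|x s ih] a abs /=.
  by rewrite (itv_partition_nil abs) big_nil subrr.
by rewrite big_cons (ih _ (itv_partition_cons abs)) /= addrC subrKA.
Qed.

Lemma partition_variation a b f (s : seq R) : itv_partition a b s ->
  variation a b f s = pairs_variation f (zip (a :: s) s).
Proof.
move=> abs; rewrite (variation_zip _ abs) /pairs_variation.
elim: s a abs => [|x s ih] a abs /=; first by rewrite !big_nil.
by rewrite !big_cons (ih _ (itv_partition_cons abs)).
Qed.

Lemma pairs_length_cat s1 s2 :
  pairs_length (s1 ++ s2) = pairs_length s1 + pairs_length s2.
Proof. by rewrite /pairs_length big_cat. Qed.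

Lemma pairs_variation_cat f s1 s2 :
  pairs_variation f (s1 ++ s2) = pairs_variation f s1 + pairs_variation f s2.
Proof. by rewrite /pairs_variation big_cat. Qed.

Lemma abs_cont_TV a b f : a <= b -> abs_cont a b f ->
  exists2 d : R, 0 < d & forall x y, a <= x -> x <= y -> y <= b -> y - x < d ->
    (total_variation x y f <= 1)%E.
Proof.
move=> ab acf; have [d d0 h] := acf 1 ltr01; exists d => // x y ax xy yb xyd.
apply: ge_ereal_sup => _ [_ [s xys <-] <-].
rewrite lee_fin (partition_variation _ xys); apply/ltW/h.
- apply: sub_all (partition_pair_in xys) => p /and3P[h1 h2 h3].
  by rewrite /pair_in (le_trans ax h1) h2 (le_trans h3 yb).
- exact: partition_pair_disj xys.
- by rewrite (partition_pairs_length xys).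
Qed.

(** Induction on the number of steps of length [d / 2] that lead from [a] to [x]: each step is
    shorter than [d] and adds at most 1 to the variation. *)
Lemma abs_cont_BV a b f : a <= b -> abs_cont a b f -> bounded_variation a b f.
Proof.
move=> ab acf; apply/bounded_variationP => //.
rewrite ge0_fin_numE; last exact: total_variation_ge0.
have [d d0 h] := abs_cont_TV ab acf.
suff H k x : a <= x -> x <= b -> x - a <= k%:R * (d / 2) ->
    (total_variation a x f < +oo)%E.
  have := truncnS_gt ((b - a) / (d / 2)).
  by rewrite ltr_pdivrMr ?divr_gt0// => /ltW; exact: H.
elim: k x => [|k ih] x ax xb.
  rewrite mul0r subr_le0 => xa; have -> : x = a by apply/eqP; rewrite eq_le xa.
  by rewrite total_variationxx.
rewrite -natr1 mulrDl mul1r => xk.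
pose y := Num.max a (x - d / 2).
have ay : a <= y by rewrite le_max lexx.
have yx : y <= x by rewrite ge_max ax /= lerBlDr lerDl divr_ge0// ltW.
rewrite (total_variationD f ay yx) lte_add_pinfty//.
  apply: ih => //; first exact: le_trans xb.
  rewrite lerBlDr ge_max; apply/andP; split; first by rewrite lerDr mulr_ge0// divr_ge0// ltW.
  by move: xk; rewrite -lerBrDr lerBlDr; lra.
apply: le_lt_trans (ltry 1); apply: h => //.
have : x - d / 2 <= y by rewrite le_max lexx orbT.
by move: d0; lra.
Qed.

(** The pairs of the family are replaced one at a time by partitions of themselves. This keeps the
    total length, and the variation of [f] over the refinements comes arbitrarily close to the
    increments of the total variation. *)
Lemma abs_cont_total_variation a b f : a <= b -> abs_cont a b f ->
  abs_cont a b (fun x => fine (total_variation a x f)).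
Proof.
move=> ab acf e e0; have [d d0 h] := acf (e / 2) (divr_gt0 e0 (ltr0Sn _ 1)).
have BVf := abs_cont_BV ab acf.
have TVfin x y : a <= x -> x <= y -> y <= b -> total_variation x y f \is a fin_num.
  move=> ax xy yb; apply/bounded_variationP => //.
  by apply: (bounded_variationl xy yb); apply: (bounded_variationr ax _ BVf); exact: le_trans yb.
exists d => // s sab sdisj slen.
(* [s1] holds the pairs already refined, measured with [f], and [s2] those still to refine, measured
   with the total variation. Suprema preserve only weak inequalities, hence the target [e / 2] in
   place of [e]. *)
suff H : forall s2 s1, all (pair_in a b) (s1 ++ s2) ->
    pairwise pair_disj (s1 ++ s2) -> pairs_length (s1 ++ s2) < d ->
    pairs_variation f s1 +
    pairs_variation (fun x => fine (total_variation a x f)) s2 <= e / 2.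
  apply: le_lt_trans (_ : e / 2 < e); last by rewrite ltr_pdivrMr// ltr_pMr// ltr1n.
  have := H s [::] sab sdisj slen; rewrite {1}/pairs_variation big_nil add0r; exact.
elim=> [|[x y] s2 ih] s1.
  rewrite cats0 => h1 h2 h3; rewrite [X in _ + X]/pairs_variation big_nil addr0.
  exact/ltW/h.
rewrite -cat1s => h1 h2 h3; rewrite pairs_variation_cat addrCA -lerBrDr.
have /and3P[/= ax xy yb] : pair_in a b (x, y).
  by apply: (allP h1); rewrite !mem_cat inE eqxx orbT.
have -> : pairs_variation (fun x => fine (total_variation a x f)) [:: (x, y)] =
    fine (total_variation x y f).
  rewrite /pairs_variation big_seq1 /= (total_variationD f ax xy) fineD ?TVfin//; last exact: le_trans yb.
  rewrite [X in X - _]addrC addrK ger0_norm// fine_ge0//; exact: total_variation_ge0.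
rewrite -lee_fin fineK ?TVfin//; apply: ge_ereal_sup => _ [_ [t xyt <-] <-].
rewrite lee_fin (partition_variation _ xyt) lerBrDr addrCA addrA -pairs_variation_cat.
have tin := partition_pair_in xyt.
move: h1; rewrite !all_cat => /and3P[h11 h12 h13].
apply: ih.
- rewrite !all_cat h11 h13 andbT /=; apply: sub_all tin => p /and3P[q1 q2 q3].
  by rewrite /pair_in (le_trans ax q1) q2 (le_trans q3 yb).
- move: h2; rewrite !pairwise_cat !allrel_catr !allrel_catl.
  move=> /and5P[/andP[r1 ->] -> r2 _ ->]; rewrite (partition_pair_disj xyt) !andbT andTb.
  apply/andP; split.
    apply/allrelP => p q pt qs; have /and3P[q1 q2 q3] := allP tin _ pt.
    move/allrelP : r2 => /(_ (x, y) q); rewrite !inE eqxx => /(_ isT qs) /orP[] /= u.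
      by apply/orP; left; exact: le_trans u.
    by apply/orP; right; exact: le_trans q1.
  apply/allrelP => q p qs pt; have /and3P[q1 q2 q3] := allP tin _ pt.
  move/allrelP : r1 => /(_ q (x, y)); rewrite !inE eqxx => /(_ qs isT) /orP[] /= u.
    by apply/orP; left; exact: le_trans q1.
  by apply/orP; right; exact: le_trans u.
- move: h3; rewrite !pairs_length_cat (partition_pairs_length xyt) {2}/pairs_length big_seq1 /=.
  by rewrite addrA.
Qed.

End AbsolutelyContinuousPairs.

(** * Lebesgue-Stieltjes measures of absolutely continuous functions *)

Section StieltjesDomination.
Context {R : realType}.
Local Notation mu := (@lebesgue_measure R).
Local Open Scope ereal_scope.

Lemma stieltjes_ocitv (g : cumulative R R) (a b : R) : (a <= b)%R ->
  lebesgue_stieltjes_measure g `]a, b]%classic = (g b - g a)%:E.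
Proof.
move=> ab; rewrite /lebesgue_stieltjes_measure/measure_extension/= measurable_mu_extE//=.
  by rewrite wlength_itv_bnd.
exact: is_ocitv.
Qed.

(** The [I i] may overlap. Their union lies in the ring generated by the half-open intervals, so it
    is a finite disjoint union of such intervals, and these form the family to which the hypothesis
    on [g] applies. *)
Lemma stieltjes_finite_union (a b e d : R) (g : cumulative R R) :
  (forall s : seq (R * R), all (pair_in a b) s -> pairwise pair_disj s ->
    (pairs_length s < d)%R -> (pairs_variation g s < e)%R) ->
  forall (n : nat) (I : nat -> set R),
  (forall i, ocitv (I i)) -> (forall i, I i `<=` `]a, b]) ->
  \sum_(0 <= i < n) mu (I i) < d%:E ->
  lebesgue_stieltjes_measure g (\big[setU/set0]_(i < n) I i) <= e%:E.
Proof.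
move=> h n I Io Iab Id.
pose U : set (SetRing.type (ocitv_type R)) := \big[setU/set0]_(i < n) I i.
have mU : measurable U.
  by apply: bigsetU_measurable => i _; apply: SetRing.measurable_subring; exact: Io.
have [B [finB B0 tB mB UB]] := SetRing.ring_finite_set mU.
pose P (X : set R) (p : R * R) := B X -> (p.1 < p.2)%R /\ X = `]p.1, p.2]%classic.
have /choice[c cP] : forall X : set R, exists p, P X p.
  move=> X; have [XB|XB] := pselect (B X); last by exists (0, 0)%R.
  have [X0|[p p12 Xp]] : X = set0 \/ exists2 x, (x.1 < x.2)%R & X = `]x.1, x.2]%classic.
    by apply/ocitvP; apply: mB; exact: mem_set.
    by have [x] := B0 _ XB; rewrite X0.
  by exists p.
have mBR X : B X -> measurable (X : set R).
  by move=> XB; apply: sub_sigma_algebra; apply: mB; exact: mem_set.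
(* One formula for both measures: [G] will be the identity for [mu] and [g] for the Stieltjes
   measure. *)
have sumE (m : {measure set (measurableTypeR R) -> \bar R}) (G : R -> R) :
    (forall x y : R, (x <= y)%R -> m `]x, y]%classic = (G y - G x)%:E) ->
    m U = (\sum_(X <- fset_set B) (G (c X).2 - G (c X).1))%:E.
  move=> mG; rewrite UB -[X in _ = X]sumEFin.
  have -> : \bigcup_(X in B) X = \bigcup_(X in B) (X : set R) by [].
  rewrite (@measure_fin_bigcup _ _ _ m (set R) B id)//.
  rewrite fsbig_finite//= !big_seq; apply: eq_bigr => X.
  rewrite in_fset_set// => /set_mem XB; have [p12 {1}->] := cP X XB.
  by rewrite mG// ltW.
pose s := [seq c X | X <- fset_set B].
have sU : pairs_length s = fine (mu U).
  rewrite (sumE mu idfun) /pairs_length ?big_map// => x y.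
  exact: (@stieltjes_ocitv idfun).
have lU : mu U <= \sum_(0 <= i < n) mu (I i).
  rewrite big_mkord; apply: (Boole_inequality mu) => i _.
  by apply: sub_sigma_algebra; exact: Io.
have XP X z : B X -> X z <-> ((c X).1 < z <= (c X).2)%R.
  move=> XB; have [_] := cP X XB; move: (c X) => q ->.
  by rewrite /= in_itv.
have Xc X : B X -> [/\ (a <= (c X).1)%R, ((c X).1 < (c X).2)%R & ((c X).2 <= b)%R].
  move=> XB; have [c12 _] := cP X XB.
  have XU : X `<=` `]a, b].
    apply: subset_trans (_ : U `<=` _); first by rewrite UB => x Xx; exists X.
    by rewrite /U => x; rewrite -bigcup_mkord => -[i _ /Iab].
  split => //.
    rewrite leNgt; apply/negP => ca.
    have /(XP _ _ XB)/XU : ((c X).1 < Num.min a (c X).2 <= (c X).2)%R.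
      by rewrite lt_min ca c12 ge_min lexx orbT.
    by rewrite /= in_itv /= lt_min ltxx.
  have /(XP _ _ XB)/XU : ((c X).1 < (c X).2 <= (c X).2)%R by rewrite c12 lexx.
  by rewrite /= in_itv /= => /andP[].
rewrite (sumE (lebesgue_stieltjes_measure g) g); last exact: stieltjes_ocitv.
rewrite lee_fin; apply: (@le_trans _ _ (pairs_variation g s)).
  by rewrite /pairs_variation big_map; apply: ler_sum => X _; exact: ler_norm.
apply/ltW/h.
- apply/allP => _ /mapP[X + ->]; rewrite in_fset_set// => /set_mem /Xc[h1 h2 h3].
  by rewrite /pair_in h1 h3 ltW.
- rewrite pairwise_map; have := fset_uniq (fset_set B); rewrite uniq_pairwise.
  apply: (@sub_in_pairwise _ (mem (fset_set B))); last exact/allP.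
  move=> X Y; rewrite !in_fset_set// => /set_mem XB /set_mem YB /= XY.
  have [_ X12 _] := Xc _ XB; have [_ Y12 _] := Xc _ YB.
  rewrite /pair_disj !leNgt -negb_and; apply/negP => /andP[h1 h2].
  move/eqP : XY; apply; apply: tB => //.
  (* Two overlapping intervals that are closed on the right share the smaller of their right
     ends. *)
  exists (Num.min (c X).2 (c Y).2).
  split; apply/XP => //; rewrite lt_min ge_min lexx ?orbT andbT; apply/andP; split => //.
- rewrite sU -lte_fin fineK ?(le_lt_trans lU)//.
  by rewrite ge0_fin_numE ?measure_ge0// (le_lt_trans lU)// (lt_trans Id)// ltry.
Qed.

(** A null set has covers by half-open intervals of total length below [d]. The finite unions of the
    cover, truncated to []a, b]], have [g]-measure at most [e], and continuity from below extends
    this to the whole cover. *)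
Lemma stieltjes_null (a b : R) (g : cumulative R R) (A : set (measurableTypeR R)) :
  abs_cont a b g -> measurable A -> mu A = 0 ->
  lebesgue_stieltjes_measure g (A `&` `]a, b]%classic) = 0.
Proof.
move=> acg mA A0; apply/eqP; rewrite eq_le measure_ge0 andbT.
apply/lee_addgt0Pr => e e0; rewrite add0e.
have [d d0 h] := acg e e0.
have : mu A < d%:E by rewrite A0 lte_fin.
move=> /ereal_inf_lt[_ [F [Fm AF] <-] Fd].
pose I i : set R := F i `&` `]a, b].
have Io i : ocitv (I i) by apply: ocitvI; [exact: Fm|exact: is_ocitv].
have Iab i : I i `<=` `]a, b] by exact: subIsetr.
have mF i : measurable (F i : set (measurableTypeR R)) by apply: sub_sigma_algebra; exact: Fm.
have mI i : measurable (I i : set (measurableTypeR R)) by apply: sub_sigma_algebra; exact: Io.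
have muI n : \sum_(0 <= i < n) mu (I i) < d%:E.
  apply: le_lt_trans Fd.
  apply: (@le_trans _ _ (\sum_(0 <= i < n) wlength idfun (F i))).
    apply: lee_sum => i _; rewrite -[leRHS]measurable_mu_extE//=.
    by apply: (@le_mu_ext _ _ _ (wlength idfun)); exact: subIsetl.
  apply: nneseries_lim_ge => i _ _; exact: wlength_ge0.
pose nu := lebesgue_stieltjes_measure g.
have cvgU : nu (\big[setU/set0]_(i < n) I i) @[n --> \oo] --> nu (\bigcup_n (\big[setU/set0]_(i < n) I i)).
  apply: nondecreasing_cvg_mu.
  - by move=> n; exact: bigsetU_measurable.
  - by apply: bigcupT_measurable => n; exact: bigsetU_measurable.
  - move=> k n kn; apply/subsetPset => x; rewrite -!bigcup_mkord => -[i /= ik Ii].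
    by exists i => //=; exact: leq_trans kn.
apply: (@le_trans _ _ (nu (\bigcup_n (\big[setU/set0]_(i < n) I i)))).
  have mab : measurable (`]a, b]%classic : set (measurableTypeR R)).
    by apply: sub_sigma_algebra; exact: is_ocitv.
  apply: le_measure.
  - by apply: mem_set; exact: measurableI.
  - by apply: mem_set; apply: bigcupT_measurable => n; exact: bigsetU_measurable.
  - move=> x [Ax xab]; have [k _ Fx] := AF _ Ax; exists k.+1 => //.
    by rewrite -bigcup_mkord; exists k => //=.
rewrite -(cvg_lim _ cvgU)//; apply: lime_le; first by apply/cvg_ex; eexists; exact: cvgU.
apply: nearW => n; apply: (stieltjes_finite_union h) => //.
Qed.

(** [h] is the Radon-Nikodym derivative of the Stieltjes measure of [g], which is cut down to []a,
    b]] to make it finite. *)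
Lemma monotone_abs_cont_integral (a b : R) (g : R -> R) : (a < b)%R ->
  {homo g : x y / (x <= y)%R} -> continuous g -> abs_cont a b g ->
  exists h : R -> R, mu.-integrable setT (EFin \o h) /\
    forall x, (a <= x <= b)%R -> (g x - g a = \int[mu]_(t in `[a, x]) h t)%R.
Proof.
move=> ab ndg cg acg.
pose G : cumulative R R := HB.pack g (isCumulative.Build R _ R g ndg (right_continuousW cg)).
pose D : set (measurableTypeR R) := `]a, b]%classic.
have mD : measurable D by apply: sub_sigma_algebra; exact: is_ocitv.
have Doo : lebesgue_stieltjes_measure G D < +oo by rewrite stieltjes_ocitv ?ltry// ltW.
pose nu := mfrestr mD Doo.
have numu : nu `<< mu.
  apply/null_content_dominatesP => A mA A0; exact: (@stieltjes_null a b G).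
have [h [h0 hfin hint hE]] := @radon_nikodym_sigma_finite _ _ R (@lebesgue_measure R) nu numu.
exists (fine \o h).
have hh : (EFin \o (fine \o h)) = h by apply/funext => x /=; rewrite fineK.
rewrite hh; split => // x /andP[ax xb].
rewrite -[RHS](_ : (\int[mu]_(t in `]a, x]) (fine \o h) t)%R = _); last first.
  apply: Rintegral_itv_obnd_cbnd; rewrite hh; exact: integrableS hint.
rewrite /Rintegral -[X in integral _ _ X]/(EFin \o (fine \o h)) hh.
have mx : measurable (`]a, x]%classic : set (measurableTypeR R)) by apply: sub_sigma_algebra; exact: is_ocitv.
rewrite -hE//.
transitivity (fine (lebesgue_stieltjes_measure G (`]a, x]%classic `&` D))); last by [].
rewrite (_ : _ `&` D = `]a, x]%classic) ?stieltjes_ocitv//.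
by apply/setIidPl => y /=; rewrite /D /= !in_itv /= => /andP[-> yx]; exact: le_trans xb.
Qed.

End StieltjesDomination.

(** * Indefinite integrals of locally integrable functions *)

Section Primitives.
Context {R : realType}.
Local Notation mu := (@lebesgue_measure R).
Implicit Types (f g : R -> R) (a b : R).

Lemma locally_integrable_itv g a b : locally_integrable setT g ->
  mu.-integrable `[a, b] (EFin \o g).
Proof.
move=> [mg _ h]; apply/integrableP; split.
  by apply/measurable_EFinP; exact: measurable_funTS.
by apply: h => //; exact: segment_compact.
Qed.

Lemma itv_locally_integrable g : measurable_fun setT g ->
  (forall n : nat, mu.-integrable `[- n%:R, n%:R] (EFin \o g)) ->
  locally_integrable setT g.
Proof.
move=> mg h; split => //; first exact: openT.
move=> K _ cK; have [M [_ KM]] := compact_bounded cK.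
pose n := (Num.truncn (`|M| + 1)).+1.
have Mn : `|M| + 1 <= n%:R by exact/ltW/truncnS_gt.
have KN : K `<=` `[- n%:R, n%:R].
  move=> x Kx /=; rewrite in_itv /= -ler_norml; apply: le_trans Mn.
  by apply: KM => //; rewrite (le_lt_trans (ler_norm M))// ltrDl.
have /integrableP[_] := h n; apply: le_lt_trans.
apply: ge0_subset_integral => //=.
  exact: compact_measurable.
by apply/measurable_EFinP; apply: measurableT_comp => //; exact: measurable_funTS.
Qed.

(** The derivative is carried along as explicit data, determined only up to a null set, and
    increments avoid the choice of a base point. *)
Definition primitive f g := locally_integrable setT g /\
  forall x y : R, x <= y -> f y - f x = (\int[mu]_(t in `[x, y]) g t)%R.

Lemma Rintegral_itv_oo g a b : locally_integrable setT g ->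
  (\int[mu]_(t in `[a, b]) g t = \int[mu]_(t in `]a, b[) g t)%R.
Proof.
move=> [mg _ _]; rewrite /Rintegral (@integral_itv_bndoo _ a b (EFin \o g) true false)//.
by apply/measurable_EFinP; exact: measurable_funTS.
Qed.

(** Absolute continuity of the integral of [|g|] over [[a, b]], applied to the union of the
    intervals of the family. These are taken open because consecutive ones may touch. *)
Lemma primitive_abs_cont f g a b : primitive f g -> abs_cont a b f.
Proof.
move=> [lg fg] e e0.
have ig : mu.-integrable setT (EFin \o (g \_ `[a, b])).
  have := locally_integrable_itv a b lg; rewrite integrable_mkcond//.
  by rewrite restrict_EFin.
have [d [d0 dP]] := integral_normr_continuous ig e0.
exists d => // s sab sdisj slen.
suff [A [mA muA As Ale]] : exists A : set R, [/\ measurable A, mu A = (pairs_length s)%:E,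
    A `<=` [set z | has (fun p => p.1 < z < p.2) s] &
    pairs_variation f s <= (\int[mu]_(x in A) `|(g \_ `[a, b]) x|)%R].
  by apply: le_lt_trans Ale _; apply: dP => //; move: slen; rewrite -lte_fin -muA.
elim: s sab sdisj {slen} => [_ _|p s ih /= /andP[/and3P[p1 p2 p3] sab] /andP[ps sdisj]].
  exists set0; split => //; first by rewrite measure0 /pairs_length big_nil.
  by rewrite /pairs_variation big_nil Rintegral_set0.
have [A [mA muA As Ale]] := ih sab sdisj.
have disj : `]p.1, p.2[%classic `&` A = set0.
  apply/seteqP; split => // z [] /= + /As/hasP[q qs /andP[q1 q2]].
  rewrite in_itv /= => /andP[z1 z2]; have /orP[h|h] := allP ps _ qs.
    by have := lt_le_trans z2 h; rewrite ltNge (ltW q1).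
  by have := lt_le_trans q2 h; rewrite ltNge (ltW z1).
exists (`]p.1, p.2[%classic `|` A); split.
- exact: measurableU.
- have -> : mu (`]p.1, p.2[%classic `|` A) = (mu `]p.1, p.2[%classic + mu A)%E.
    exact: measureU.
  rewrite muA lebesgue_measure_itv/= lte_fin /pairs_length big_cons EFinD.
  congr +%E; case: ltP => // p21; congr EFin; apply/esym.
  by apply/eqP; rewrite subr_eq0 eq_le p2 p21.
- move=> z [/=|/As /= ->]; last by rewrite orbT.
  by rewrite in_itv /= => ->.
- have ig' : mu.-integrable setT (EFin \o (fun x => `|(g \_ `[a, b]) x|)) by exact: integrable_norm.
  rewrite Rintegral_setU//; last 2 first.
    by apply: integrableS ig' => //; exact: measurableU.
    exact/disj_set2P.
  rewrite /pairs_variation big_cons lerD//.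
  rewrite fg// Rintegral_itv_oo//.
  have -> : (\int[mu]_(t in `]p.1, p.2[) g t = \int[mu]_(t in `]p.1, p.2[) (g \_ `[a, b]) t)%R.
    apply: eq_Rintegral => z /set_mem /=; rewrite in_itv /= => /andP[z1 z2].
    rewrite patchE mem_set//= in_itv /= (le_trans p1 (ltW z1))/=.
    exact: le_trans (ltW z2) p3.
  apply: le_normr_Rintegral => //.
  by apply: integrableS ig.
Qed.

Lemma abs_cont_continuous f : (forall a b, a <= b -> abs_cont a b f) -> continuous f.
Proof.
move=> h x; apply/cvgrPdist_lt => e e0.
have x11 : x - 1 <= x + 1 by lra.
have [d d0 dP] := h (x - 1) (x + 1) x11 e e0.
near=> y.
have xy : `|x - y| < Num.min d 1.
  near: y; apply: (@cvgr_dist_lt _ _ _ _ _ id) => //.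
  by rewrite lt_min d0 ltr01.
move: xy; rewrite lt_min => /andP[xyd xy1].
have /andP[xy2 xy3] : x - 1 < y < x + 1 by rewrite -ltr_distlC.
have [yx|yx] := leP y x.
  have := dP [:: (y, x)]; rewrite /= /pairs_variation /pairs_length !big_seq1 /=; apply => //.
    by rewrite /pair_in /= yx (ltW xy2) lerDl ler01.
  by move: xyd; rewrite ger0_norm// subr_ge0.
have := dP [:: (x, y)]; rewrite /= /pairs_variation /pairs_length !big_seq1 /= distrC; apply => //.
  by rewrite /pair_in /= (ltW yx) (ltW xy3) gerBl ler01.
by move: xyd; rewrite distrC ger0_norm// subr_ge0 ltW.
Unshelve. all: by end_near. Qed.

Lemma primitive_continuous f g : primitive f g -> continuous f.
Proof. by move=> fg; apply: abs_cont_continuous => a b _; exact: primitive_abs_cont fg. Qed.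

Lemma ae_imp (P Q : R -> Prop) : (forall x, P x -> Q x) ->
  {ae mu, forall x, P x} -> {ae mu, forall x, Q x}.
Proof.
move=> PQ; apply: filterS; first exact: (ae_filter_ringOfSetsType mu).
exact: PQ.
Qed.

Lemma ae_imp2 (P1 P2 Q : R -> Prop) : (forall x, P1 x -> P2 x -> Q x) ->
  {ae mu, forall x, P1 x} -> {ae mu, forall x, P2 x} -> {ae mu, forall x, Q x}.
Proof.
move=> PQ; apply: filterS2; first exact: (ae_filter_ringOfSetsType mu).
exact: PQ.
Qed.

Lemma ae_foralln (P : nat -> R -> Prop) :
  (forall n, {ae mu, forall x, P n x}) -> {ae mu, forall x, forall n, P n x}.
Proof.
move=> h; have : mu.-negligible (\bigcup_n ~` [set x | P n x]).
  by apply: negligible_bigcup => n; exact: h.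
by apply: negligibleS => x /= /existsNP[n Pnx]; exists n.
Qed.

(** Lebesgue differentiation in the form of [FTC1] works from a fixed left end; it is used from each
    [- n%:R], and the countably many exceptional sets are discarded together. *)
Lemma primitive_derive f g : primitive f g ->
  {ae mu, forall x, is_derive (x : R) (1 : R) f (g x)}.
Proof.
move=> [lg fg].
have : {ae mu, forall x, forall n : nat, - n%:R < x -> is_derive (x : R) (1 : R) f (g x)}.
  apply: ae_foralln => n.
  have hi y : mu.-integrable `[- n%:R, y] (EFin \o g) by exact: locally_integrable_itv.
  have := @FTC1 R g (BLeft (- n%:R)) hi lg.
  move=> /=; apply: ae_imp => x xF nx.
  have nx' : ((- n%:R)%:E < x%:E)%E by rewrite lte_fin.
  have [dF F'] := xF nx'.
  rewrite -[g x]add0r -[f]/(fun y => f y).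
  have : is_derive (x : R) (1 : R) (cst (f (- n%:R)) + (fun y => \int[mu]_(t in `[- n%:R, y]) g t)%R) (0 + g x).
    by apply: is_deriveD; rewrite -F' derive1E; exact: derivableP.
  apply: near_eq_is_derive; near=> y.
  rewrite -[LHS]/(f (- n%:R) + \int[mu]_(t in `[- n%:R, y]) g t)%R -fg ?subrKC//.
  by apply/ltW; near: y; exact: lt_nbhsr.
apply: ae_imp => x /(_ (Num.truncn `|x|).+1); apply.
by rewrite ltrNl; apply: le_lt_trans (truncnS_gt `|x|); rewrite -normrN ler_norm.
Unshelve. all: by end_near. Qed.

End Primitives.

(** * Densities of absolutely continuous functions *)

Section AbsContPrimitive.
Context {R : realType}.
Local Notation mu := (@lebesgue_measure R).
Implicit Types (f g : R -> R) (a b : R).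

Lemma ae_eq_Rintegrable (D : set R) f g : measurable D -> measurable_fun D f ->
  {ae mu, forall x, D x -> f x = g x} -> mu.-integrable D (EFin \o g) ->
  mu.-integrable D (EFin \o f).
Proof.
move=> mD mf fg /integrableP[mg gi]; apply/integrableP; split; first exact/measurable_EFinP.
apply: le_lt_trans gi; rewrite le_eqVlt; apply/orP; left; apply/eqP.
apply: ae_eq_integral => //; try exact: measurableT_comp.
  by apply: measurableT_comp => //; exact/measurable_EFinP.
by apply: ae_imp fg => x fgx Dx /=; rewrite fgx.
Qed.

Lemma ae_eq_Rintegral (D : set R) f g : measurable D -> measurable_fun D f ->
  measurable_fun D g -> {ae mu, forall x, D x -> f x = g x} ->
  (\int[mu]_(x in D) f x = \int[mu]_(x in D) g x)%R.
Proof.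
move=> mD mf mg fg; congr fine; apply: ae_eq_integral => //; try exact/measurable_EFinP.
by apply: ae_imp fg => x fgx Dx /=; rewrite fgx.
Qed.

Lemma eq_abs_cont a b f g : {in `[a, b], f =1 g} -> abs_cont a b f -> abs_cont a b g.
Proof.
move=> fg acf e e0; have [d d0 dP] := acf e e0; exists d => // s sab sd sl.
have := dP s sab sd sl; rewrite /pairs_variation big_seq [X in _ -> X < _]big_seq.
congr (_ < _); apply: eq_bigr => p /(allP sab)/and3P[p1 p2 p3].
by rewrite !fg// in_itv /= ?p1 ?p3 ?(le_trans p2 p3) ?(le_trans p1 p2).
Qed.

Lemma abs_contB a b f g : abs_cont a b f -> abs_cont a b g ->
  abs_cont a b (fun x => f x - g x).
Proof.
move=> acf acg e e0.
have [d d0 dP] := acf (e / 2) (divr_gt0 e0 (ltr0Sn _ 1)).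
have [d' d'0 d'P] := acg (e / 2) (divr_gt0 e0 (ltr0Sn _ 1)).
exists (Num.min d d'); first by rewrite lt_min d0.
move=> s sab sd; rewrite lt_min => /andP[sl sl'].
rewrite [e]splitr; apply: le_lt_trans (ltrD (dP s sab sd sl) (d'P s sab sd sl')).
rewrite /pairs_variation -big_split /=; apply: ler_sum => p _.
have -> : f p.2 - g p.2 - (f p.1 - g p.1) = (f p.2 - f p.1) - (g p.2 - g p.1) by ring.
exact: ler_normB.
Qed.

(** For [a <= b], [Num.max a (Num.min x b)] is the nearest-point projection onto [[a, b]].
    Composition with it extends functions from the segment to the line, where Stieltjes measures are
    defined; the same formula shapes the cut-offs below. *)
Lemma clamp_le a b x y : x <= y -> Num.max a (Num.min x b) <= Num.max a (Num.min y b).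
Proof. by move=> xy; rewrite le_max2// le_min2. Qed.

Lemma clamp_lip a b x y : x <= y ->
  Num.max a (Num.min y b) - Num.max a (Num.min x b) <= y - x.
Proof.
move=> xy; have yx : 0 <= y - x by rewrite subr_ge0.
rewrite lerBlDr ge_max; apply/andP; split.
  by rewrite ler_wpDl// le_max lexx.
apply: (@le_trans _ _ (y - x + Num.min x b)); last by rewrite lerD2l le_max lexx orbT.
case: (leP x b) => xb; first by rewrite subrK ge_min lexx.
by rewrite ge_min lerDr yx orbT.
Qed.

Lemma continuous_clamp a b : continuous (fun x : R => Num.max a (Num.min x b)).
Proof.
move=> x; apply/cvgrPdist_lt => e e0; near=> y.
apply: (@le_lt_trans _ _ `|x - y|).
  have [xy|/ltW xy] := leP x y.
    by rewrite distrC ger0_norm ?subr_ge0 ?clamp_le// distrC ger0_norm ?subr_ge0// clamp_lip.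
  by rewrite ger0_norm ?subr_ge0 ?clamp_le// ger0_norm ?subr_ge0// clamp_lip.
by near: y; apply: (@cvgr_dist_lt _ _ _ _ _ id).
Unshelve. all: by end_near. Qed.

Lemma clamp_itv a b x : a <= b -> Num.max a (Num.min x b) \in `[a, b].
Proof. by move=> ab; rewrite in_itv /= le_max lexx ge_max ab ge_min lexx orbT. Qed.

Lemma clamp_id a b x : x \in `[a, b] -> Num.max a (Num.min x b) = x.
Proof. by rewrite in_itv /= => /andP[ax xb]; rewrite (min_l xb) (max_r ax). Qed.

Lemma continuous_comp_clamp a b f : a <= b -> {within `[a, b], continuous f} ->
  continuous (fun x => f (Num.max a (Num.min x b))).
Proof.
move=> ab cf x; pose c x := Num.max a (Num.min x b).
have /subspace_continuousP/(_ (c x) (clamp_itv x ab)) := cf.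
apply: cvg_comp => P /= wP.
have cP : nbhs x (c @^-1` [set z | `[a, b]%classic z -> P z]).
  by apply: continuous_clamp; exact: wP.
by apply: filterS cP => y /(_ (clamp_itv y ab)).
Qed.

(** Jordan decomposition: on [[a, b]], [f] is the variation function [V] minus [W], both
    nondecreasing and absolutely continuous, hence both integrals. Clamping keeps them monotone on
    the whole line. *)
Lemma abs_cont_integral a b f : a < b -> abs_cont a b f -> continuous f ->
  exists h : R -> R, mu.-integrable setT (EFin \o h) /\
    forall x, a <= x <= b -> (f x - f a = \int[mu]_(t in `[a, x]) h t)%R.
Proof.
move=> ab acf cf; have leab := ltW ab.
have BVf := abs_cont_BV leab acf.
pose cl x := Num.max a (Num.min x b).
pose T x := fine (total_variation a x f).
pose V x := T (cl x); pose W x := V x - f (cl x).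
have clP x : x \in `[a, b] -> cl x = x by exact: clamp_id.
have TVD x y : a <= x -> x <= y -> y <= b -> T y - T x = fine (total_variation x y f).
  move=> ax xy yb.
  have F1 : total_variation a x f \is a fin_num.
    apply/bounded_variationP => //; apply: (bounded_variationl ax _ BVf); exact: le_trans yb.
  have F2 : total_variation x y f \is a fin_num.
    apply/bounded_variationP => //; apply: (bounded_variationl xy yb).
    by apply: (bounded_variationr ax _ BVf); exact: le_trans yb.
  by rewrite /T (total_variationD f ax xy) fineD// [X in X - _]addrC addrK.
have TVge x y : a <= x -> x <= y -> y <= b -> `|f y - f x| <= T y - T x.
  move=> ax xy yb; rewrite TVD// -lee_fin fineK; first exact: total_variation_ge.
  apply/bounded_variationP => //; apply: (bounded_variationl xy yb).
  by apply: (bounded_variationr ax _ BVf); exact: le_trans yb.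
have cT : {within `[a, b], continuous T}.
  by apply: total_variation_continuous => //; exact: continuous_subspaceT.
have clE x : (a <= cl x) * (cl x <= b) by have := clamp_itv x leab; rewrite in_itv /= => /andP[].
have ndV : {homo V : x y / x <= y}.
  move=> x y xy; rewrite -subr_ge0; apply: le_trans (TVge _ _ _ _ _); rewrite ?clE//.
  exact: clamp_le.
have ndW : {homo W : x y / x <= y}.
  move=> x y xy; have := TVge (cl x) (cl y) (clE x).1 (clamp_le a b xy) (clE y).2.
  by move=> /(le_trans (ler_norm _)); rewrite /W /V; lra.
have cV : continuous V by exact: continuous_comp_clamp.
have cW : continuous W.
  move=> x; apply: cvgB; first exact: cV.
  by apply: continuous_comp; [exact: continuous_clamp|exact: cf].
have acV : abs_cont a b V.
  apply: eq_abs_cont (abs_cont_total_variation leab acf) => x xab.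
  by rewrite /V clP.
have acW : abs_cont a b W.
  apply: abs_contB => //; apply: eq_abs_cont acf => x xab; by rewrite clP.
have [h1 [ih1 h1E]] := monotone_abs_cont_integral ab ndV cV acV.
have [h2 [ih2 h2E]] := monotone_abs_cont_integral ab ndW cW acW.
exists (fun x => h1 x - h2 x); split.
  rewrite -[X in integrable _ _ X]/((EFin \o h1) \- (EFin \o h2))%E; exact: integrableB.
move=> x xab; rewrite RintegralB//; try exact: integrableS ih1; try exact: integrableS ih2.
rewrite -h1E// -h2E// /W !clP//; first by lra.
by rewrite in_itv /= lexx.
Qed.

(* the upper right derivative along the steps 1/(n+1): Borel for every continuous f *)
Definition rderiv f (x : R) : R :=
  fine (limn_esup (fun n => (n.+1%:R * (f (x + n.+1%:R^-1) - f x))%:E)).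

Lemma measurable_rderiv f : continuous f -> measurable_fun setT (rderiv f).
Proof.
move=> cf; apply: measurableT_comp => //.
apply: measurable_fun_limn_esup => n; apply/measurable_EFinP.
have mf := continuous_measurable_fun cf.
apply: measurable_funM => //; apply: measurable_funB => //.
apply: measurableT_comp => //.
by apply: measurable_funD.
Qed.

Lemma is_derive_cvg_quotient f (x d : R) : is_derive (x : R) (1 : R) f d ->
  (n.+1%:R * (f (x + n.+1%:R^-1) - f x)) @[n --> \oo] --> d.
Proof.
move=> [dfx dE]; rewrite -dE.
have : (h^-1 *: (f (h *: (1 : R) + x) - f x)) @[h --> 0^'] --> 'D_1 f x by exact: dfx.
move=> /cvgr_dnbhsP /(_ (fun n => n.+1%:R^-1)).
have h : (forall n : nat, n.+1%:R^-1 != 0 :> R) /\ (n.+1%:R^-1 : R) @[n --> \oo] --> 0.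
  by split; [move=> n; rewrite invr_eq0|exact: cvg_harmonic].
move=> /(_ h); set v := fun n => _; set w := fun n => _.
by rewrite (_ : v = w)//; apply/funext => n; rewrite /v /w invrK [_%:A]mulr1 [_ + x]addrC.
Qed.

Lemma rderiv_derive f (x d : R) : is_derive (x : R) (1 : R) f d -> rderiv f x = d.
Proof.
move=> /is_derive_cvg_quotient hc; rewrite /rderiv.
have hE : (n.+1%:R * (f (x + n.+1%:R^-1) - f x))%:E @[n --> \oo] --> d%:E.
  exact: cvg_comp hc _.
by rewrite is_cvg_limn_esupE; [rewrite (cvg_lim _ hE)|apply/cvg_ex; exists d%:E].
Qed.

Lemma rderiv_near_cst f (x c : R) : (\forall y \near x, f y = c) -> rderiv f x = 0.
Proof.
move=> h; apply: rderiv_derive.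
have : is_derive (x : R) (1 : R) (cst c) (0 : R) by exact: is_derive_cst.
by apply: near_eq_is_derive; apply: filterS h => y ->.
Qed.

(** All the quotients lie in [[-K, K]], so the upper limit is finite and [fine] does not return its
    default. The bound thus holds at every point, also where [f] has no derivative. *)
Lemma rderiv_lipschitz f K (x : R) : (forall y, `|f y - f x| <= K * `|y - x|) ->
  `|rderiv f x| <= K.
Proof.
move=> fK; rewrite /rderiv; set u := fun n => _.
have uK n : ((- K)%:E <= u n <= K%:E)%E.
  rewrite !lee_fin -ler_norml normrM ger0_norm// mulrC -ler_pdivlMr//.
  by have := fK (n.+1%:R^-1 + x); rewrite addrK normfV normr_nat [_ + x]addrC.
have h1 : (limn_esup u <= K%:E)%E.
  rewrite limn_esup_lim; apply: lime_le; first exact: is_cvg_esups.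
  apply: nearW => n; apply: ge_ereal_sup => _ [k _ <-].
  by have /andP[] := uK k.
have h2 : ((- K)%:E <= limn_esup u)%E.
  rewrite limn_esup_lim; apply: lime_ge; first exact: is_cvg_esups.
  apply: nearW => n; apply: (@le_trans _ _ (u n)); first by have /andP[] := uK n.
  by apply: ereal_sup_ubound; exists n => /=.
have hf : limn_esup u \is a fin_num.
  by rewrite fin_numElt (lt_le_trans (ltNyr _) h2) (le_lt_trans h1 (ltry _)).
by rewrite ler_norml -!lee_fin fineK// h1 h2.
Qed.

(** The density given by [abs_cont_integral] depends on the segment. [rderiv f] is one Borel
    function on the line that agrees almost everywhere with each of these densities. *)
Lemma abs_cont_primitive f : (forall a b, a <= b -> abs_cont a b f) ->
  primitive f (rderiv f).
Proof.
move=> acf; have cf := abs_cont_continuous acf; have mf := measurable_rderiv cf.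
have key a b : a < b -> mu.-integrable `[a, b] (EFin \o rderiv f) /\
    (f b - f a = \int[mu]_(t in `[a, b]) rderiv f t)%R.
  move=> ab; have [h [ih hE]] := abs_cont_integral ab (acf a b (ltW ab)) cf.
  have lh : locally_integrable setT h by exact: open_integrable_locally openT ih.
  have hi y : mu.-integrable `[a, y] (EFin \o h) by exact: locally_integrable_itv.
  have /= FT := @FTC1 R h (BLeft a) hi lh.
  have rh : {ae mu, forall x, `[a, b]%classic x -> rderiv f x = h x}.
    (* The integral representation holds on [[a, b]] only; it can be differentiated at interior
       points, and the two ends form a null set. *)
    have : {ae mu, forall x, x != a /\ x != b}.
      exists [set a; b]; split.
      - exact: measurableU.
      - exact/countable_lebesgue_measure0/finite_set_countable.
      - by move=> x /= /not_andP[] /negP; rewrite negbK => /eqP ->; [left|right].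
    move=> hab; apply: (ae_imp2 _ hab FT) => x [xa xb] hx; rewrite /= in_itv /= => /andP[ax bx].
    have {ax xa} ax : a < x by rewrite lt_neqAle eq_sym xa.
    have {bx xb} bx : x < b by rewrite lt_neqAle xb.
    have /hx[dF F'] : (a%:E < x%:E)%E by rewrite lte_fin.
    apply: rderiv_derive.
    have : is_derive (x : R) (1 : R) (cst (f a) + (fun y => \int[mu]_(t in `[a, y]) h t)%R) (0 + h x).
      by apply: is_deriveD; rewrite -F' derive1E; exact: derivableP.
    rewrite add0r; apply: near_eq_is_derive; near=> y.
    rewrite -[LHS]/(f a + \int[mu]_(t in `[a, y]) h t)%R -hE ?subrKC//.
    by apply/andP; split; apply/ltW; near: y; [exact: lt_nbhsr|exact: lt_nbhsl].
  have mE : measurable_fun `[a, b] (rderiv f) by exact: measurable_funTS.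
  have mh : measurable_fun `[a, b] h by case: lh => mh _ _; exact: measurable_funTS.
  split; first by apply: ae_eq_Rintegrable rh _.
  by rewrite hE ?lexx ?ltW//; apply/esym; apply: ae_eq_Rintegral.
split.
  apply: itv_locally_integrable => // n.
  have : - n.+1%:R < n.+1%:R :> R by rewrite gtrN.
  move=> /key[+ _]; apply: integrableS => //.
  by apply: subset_itv; rewrite bnd_simp ?lerN2 ler_nat.
move=> x y; rewrite le_eqVlt => /predU1P[<-|/key[]//].
by rewrite subrr set_itv1 Rintegral_set1.
Unshelve. all: by end_near. Qed.

End AbsContPrimitive.

(** * Calculus of primitives *)

Section PrimitiveAlgebra.
Context {R : realType}.
Local Notation mu := (@lebesgue_measure R).
Implicit Types (f g : R -> R) (a b : R).

Lemma locally_integrable_ae g g' : measurable_fun setT g' ->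
  {ae mu, forall x, g x = g' x} -> locally_integrable setT g -> locally_integrable setT g'.
Proof.
move=> mg' gg' lg; apply: itv_locally_integrable => // n.
apply: (@ae_eq_Rintegrable _ _ _ g) => //; first exact: measurable_funTS.
  by apply: ae_imp gg' => x ->.
exact: locally_integrable_itv.
Qed.

Lemma primitive_ae f g g' : measurable_fun setT g' ->
  {ae mu, forall x, g x = g' x} -> primitive f g -> primitive f g'.
Proof.
move=> mg' gg' [lg fg]; split; first exact: locally_integrable_ae gg' lg.
move=> x y xy; rewrite fg//; apply: ae_eq_Rintegral => //.
- by case: lg => mg _ _; exact: measurable_funTS.
- exact: measurable_funTS.
- by apply: ae_imp gg' => z ->.
Qed.

Lemma primitive_ext f f' g : f =1 f' -> primitive f g -> primitive f' g.
Proof. by move=> ff' [lg fg]; split => // x y xy; rewrite -!ff' fg. Qed.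

Lemma continuous_bounded_segment f a b : continuous f ->
  exists2 M : R, 0 < M & forall x, a <= x <= b -> `|f x| <= M.
Proof.
move=> cf; have [ab|ba] := leP a b; last first.
  by exists 1 => // x /andP[ax xb]; have := le_trans ax xb; rewrite leNgt ba.
have cnf : {within `[a, b], continuous (fun x => `|f x|)}.
  by apply: continuous_subspaceT => x; apply: continuous_comp; [exact: cf|exact: norm_continuous].
have [c _ cP] := EVT_max ab cnf.
exists (`|f c| + 1); first by rewrite ltr_wpDl.
by move=> x xab; rewrite (le_trans (cP x _)) ?lerDl.
Qed.

Lemma abs_contM f g a b : continuous f -> continuous g -> abs_cont a b f ->
  abs_cont a b g -> abs_cont a b (fun x => f x * g x).
Proof.
move=> cf cg acf acg e e0.
have [M M0 fM] := continuous_bounded_segment a b cf.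
have [N N0 gN] := continuous_bounded_segment a b cg.
have eN : 0 < e / 2 / N by rewrite !divr_gt0.
have eM : 0 < e / 2 / M by rewrite !divr_gt0.
have [d d0 dP] := acf _ eN; have [d' d'0 d'P] := acg _ eM.
exists (Num.min d d'); first by rewrite lt_min d0.
move=> s sab sd; rewrite lt_min => /andP[sl sl'].
have h1 := dP s sab sd sl; have h2 := d'P s sab sd sl'.
rewrite ltr_pdivlMr// mulrC in h1; rewrite ltr_pdivlMr// mulrC in h2.
rewrite [e]splitr; apply: le_lt_trans (ltrD h1 h2).
rewrite /pairs_variation !mulr_sumr -big_split /= big_seq [leRHS]big_seq.
apply: ler_sum => p /(allP sab)/and3P[p1 p2 p3].
have -> : f p.2 * g p.2 - f p.1 * g p.1 =
   g p.2 * (f p.2 - f p.1) + f p.1 * (g p.2 - g p.1) by ring.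
apply: le_trans (ler_normD _ _) _; rewrite !normrM.
apply: lerD; apply: ler_wpM2r => //; [apply: gN|apply: fM].
  by rewrite (le_trans p1 p2).
by rewrite p1 (le_trans p2).
Qed.

Lemma measurable_continuous f : continuous f -> measurable_fun setT f.
Proof. exact: continuous_measurable_fun. Qed.

Lemma locally_integrableM_continuous f g : continuous f -> locally_integrable setT g ->
  locally_integrable setT (fun x => f x * g x).
Proof.
move=> cf lg; have [mg _ _] := lg.
apply: itv_locally_integrable.
  by apply: measurable_funM => //; exact: measurable_continuous.
move=> n; have [M M0 fM] := continuous_bounded_segment (- n%:R) n%:R cf.
have ig := locally_integrable_itv (- n%:R) n%:R lg.
apply: (@le_integrable _ _ _ mu _ _ _ (fun x => (M%:E * (EFin \o g) x)%E)) => //.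
- apply/measurable_EFinP/measurable_funTS.
  by apply: measurable_funM => //; exact: measurable_continuous.
- move=> x /=; rewrite in_itv /= => xn; rewrite lee_fin !normrM.
  by rewrite (ger0_norm (ltW M0)) ler_wpM2r// fM.
- exact: integrableZl.
Qed.

(** Integration by parts without Fubini: the product is absolutely continuous, hence a primitive of
    its [rderiv], and the product rule identifies that function almost everywhere. *)
Lemma primitiveM f f' g g' : primitive f f' -> primitive g g' ->
  primitive (fun x => f x * g x) (fun x => f' x * g x + f x * g' x).
Proof.
move=> ff' gg'; have cf := primitive_continuous ff'; have cg := primitive_continuous gg'.
have : primitive (fun x => f x * g x) (rderiv (fun x => f x * g x)).
  apply: abs_cont_primitive => a b _.
  by apply: abs_contM => //; [exact: primitive_abs_cont ff'|exact: primitive_abs_cont gg'].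
have [[mf' _ _] _] := ff'; have [[mg' _ _] _] := gg'.
apply: primitive_ae.
  by apply: measurable_funD; apply: measurable_funM => //; exact: measurable_continuous.
apply: (ae_imp2 _ (primitive_derive ff') (primitive_derive gg')) => x df dg.
apply: rderiv_derive; have := is_deriveM df dg.
have -> : f x *: g' x + g x *: f' x = f' x * g x + f x * g' x.
  by rewrite /GRing.scale /= addrC [g x * _]mulrC.
by [].
Qed.

Lemma locally_integrableZ c g : locally_integrable setT g ->
  locally_integrable setT (fun x => c * g x).
Proof. by apply: (@locally_integrableM_continuous (cst c)); exact: cst_continuous. Qed.

Lemma primitiveD f f' g g' : primitive f f' -> primitive g g' ->
  primitive (fun x => f x + g x) (fun x => f' x + g' x).
Proof.
move=> [lf ff'] [lg gg']; split; first exact: locally_integrableD.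
move=> x y xy; rewrite RintegralD//; try exact: locally_integrable_itv.
by rewrite -ff'// -gg'//; ring.
Qed.

Lemma primitiveZ c f f' : primitive f f' ->
  primitive (fun x => c * f x) (fun x => c * f' x).
Proof.
move=> [lf ff']; split; first exact: locally_integrableZ.
move=> x y xy; rewrite RintegralZl//; last exact: locally_integrable_itv.
by rewrite -ff'// mulrBr.
Qed.

Lemma primitiveN f f' : primitive f f' ->
  primitive (fun x => - f x) (fun x => - f' x).
Proof.
move=> /(primitiveZ (-1)) [lf ff'].
have E : (fun x => -1 * f' x) = (fun x => - f' x) by apply/funext => x; rewrite mulN1r.
rewrite -E; split => // x y xy; rewrite -ff'//; ring.
Qed.

Lemma primitiveB f f' g g' : primitive f f' -> primitive g g' ->
  primitive (fun x => f x - g x) (fun x => f' x - g' x).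
Proof. by move=> pf /primitiveN pg; exact: primitiveD. Qed.

Lemma primitive_cst (c : R) : primitive (fun=> c) (fun=> 0).
Proof.
split; last by move=> x y xy; rewrite subrr Rintegral_cst// mul0r.
have : locally_integrable setT (\1_set0 : R -> R) by apply: locally_integrable_indic => //; exact: openT.
by rewrite indic0.
Qed.

Lemma primitive_sum (I : Type) (r : seq I) (f f' : I -> R -> R) :
  (forall i, primitive (f i) (f' i)) ->
  primitive (fun x => \sum_(i <- r) f i x) (fun x => \sum_(i <- r) f' i x).
Proof.
move=> h; elim: r => [|i r ih].
  have := primitive_cst 0; congr primitive; apply/funext => x; by rewrite big_nil.
have := primitiveD (h i) ih; congr primitive; apply/funext => x; by rewrite big_cons.
Qed.

Lemma Rintegral_itvD g a b c : locally_integrable setT g -> a <= b -> b <= c ->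
  (\int[mu]_(t in `[a, c]) g t =
   \int[mu]_(t in `[a, b]) g t + \int[mu]_(t in `[b, c]) g t)%R.
Proof.
move=> lg ab bc; have ig := locally_integrable_itv a c lg.
have := @Rintegral_itvB R g (BLeft a) (BRight c) b ig.
rewrite !bnd_simp => /(_ ab bc) h.
rewrite -[LHS](subrK (\int[mu]_(t in `[a, b]) g t)%R) h addrC; congr (_ + _).
by apply: Rintegral_itv_obnd_cbnd; apply: integrableS (locally_integrable_itv b c lg) => //; exact: subset_itv_oc_cc.
Qed.

(** At every [x] one of the two intervals is empty or a point, so this is the oriented integral from
    0 to [x]. *)
Definition signed_primitive g (x : R) : R :=
  (\int[mu]_(t in `[0%R, x]) g t - \int[mu]_(t in `[x, 0%R]) g t)%R.

Lemma Rintegral_itv_degenerate g a b : b <= a -> (\int[mu]_(t in `[a, b]) g t = 0)%R.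
Proof.
rewrite le_eqVlt => /predU1P[->|ba]; first by rewrite set_itv1 Rintegral_set1.
by rewrite set_itv_ge ?Rintegral_set0// bnd_simp -ltNge.
Qed.

Lemma signed_primitiveP g : locally_integrable setT g -> primitive (signed_primitive g) g.
Proof.
move=> lg; split => // x y xy; rewrite /signed_primitive.
have [x0|x0] := leP 0 x.
  have y0 := le_trans x0 xy.
  by rewrite (Rintegral_itvD lg x0 xy) !(Rintegral_itv_degenerate _ x0) !(Rintegral_itv_degenerate _ y0); ring.
have [y0|y0] := leP y 0.
  by rewrite (Rintegral_itvD lg xy y0) !(Rintegral_itv_degenerate _ (ltW x0)) !(Rintegral_itv_degenerate _ y0); ring.
rewrite (Rintegral_itvD lg (ltW x0) (ltW y0)) !(Rintegral_itv_degenerate _ (ltW x0)) !(Rintegral_itv_degenerate _ (ltW y0)); ring.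
Qed.

Lemma signed_primitive0 g : signed_primitive g 0 = 0.
Proof. by rewrite /signed_primitive subrr. Qed.

End PrimitiveAlgebra.

(** * Linear differential systems with locally integrable coefficients *)

Section IteratedIntegralBound.
Context {R : realType}.
Local Notation mu := (@lebesgue_measure R).
Implicit Types (f g u v : R -> R) (a b x y : R).

Lemma dominated_cvg_Rintegral (D : set R) (fn : nat -> R -> R) f g : measurable D ->
  (forall n, measurable_fun D (fn n)) -> measurable_fun D f ->
  {ae mu, forall x, D x -> fn n x @[n --> \oo] --> f x} ->
  mu.-integrable D (EFin \o g) ->
  (forall n x, D x -> `|fn n x| <= g x) ->
  (\int[mu]_(x in D) fn n x)%R @[n --> \oo] --> (\int[mu]_(x in D) f x)%R.
Proof.
move=> mD mfn mf fnf ig fng.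
have [//|||||] := @dominated_convergence _ _ R mu D mD (fun n x => (fn n x)%:E) (EFin \o f) (EFin \o g).
- by move=> n; apply/measurable_EFinP; exact: mfn.
- by apply/measurable_EFinP; exact: mf.
- by apply: ae_imp fnf => x h Dx; apply: cvg_EFin; [exact: nearW|exact: h].
- by [].
- by apply: aeW => x n Dx; rewrite lee_fin fng.
- move=> i_f _ h; rewrite /Rintegral.
  have F : (\int[mu]_(x in D) (f x)%:E)%E \is a fin_num by exact: integrable_fin_num.
  by apply: fine_cvg; rewrite fineK.
Qed.

Lemma primitiveX f f' k : primitive f f' ->
  primitive (fun x => f x ^+ k.+1) (fun x => k.+1%:R * (f' x * f x ^+ k)).
Proof.
move=> pf; elim: k => [|k ih].
  by under eq_fun do rewrite expr1; under [X in primitive _ X]eq_fun do rewrite mul1r expr0 mulr1.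
have := primitiveM pf ih.
have -> : (fun x => f' x * f x ^+ k.+1 + f x * (k.+1%:R * (f' x * f x ^+ k))) =
    (fun x => k.+2%:R * (f' x * f x ^+ k.+1)).
  by apply/funext => x; rewrite !exprS -[k.+2%:R]natr1; ring.
by apply: primitive_ext => x; rewrite [RHS]exprS.
Qed.

(** With [V] the primitive of [v] vanishing at 0, [v * V ^+ k / k!] is the derivative of
    [V ^+ k.+1 / k.+1!]: integrating the bound raises the exponent by one. This is the inductive
    step of the factorial estimate. *)
Lemma signed_primitive_bound_exp u v k : locally_integrable setT u ->
  locally_integrable setT v -> (forall t, 0 <= v t) ->
  (forall t, `|u t| <= v t * (`|signed_primitive v t| ^+ k / k`!%:R)) ->
  forall x, `|signed_primitive u x| <= `|signed_primitive v x| ^+ k.+1 / k.+1`!%:R.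
Proof.
move=> lu lv v0 uv x.
have pv := signed_primitiveP lv; have pu := signed_primitiveP lu.
set V := signed_primitive v in uv pv *.
have [lV pVk] := primitiveZ (k.+1`!%:R^-1) (primitiveX k pv).
(* To the left of 0 the function [V] is nonpositive, so powers of [- V] replace those of [V]
   there. *)
have [lV' pVk'] := primitiveZ (k.+1`!%:R^-1) (primitiveX k (primitiveN pv)).
have mon y z : y <= z -> V y <= V z.
  by move=> yz; rewrite -subr_ge0 pv.2// Rintegral_ge0.
have V0 : V 0 = 0 by exact: signed_primitive0.
have fk : k.+1`!%:R^-1 * k.+1%:R = k`!%:R^-1 :> R.
  by rewrite factS natrM invfM mulrC mulrA divff// mul1r.
have [x0|/ltW x0] := leP 0 x.
  rewrite -[signed_primitive u x]subr0 -(signed_primitive0 u) pu.2//.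
  have iu := locally_integrable_itv 0 x lu.
  apply: le_trans (le_normr_Rintegral _ iu) _ => //.
  have Vx : 0 <= V x by rewrite -V0 mon.
  apply: (@le_trans _ _ (k.+1`!%:R^-1 * V x ^+ k.+1 - k.+1`!%:R^-1 * V 0 ^+ k.+1)); last first.
    by rewrite V0 expr0n /= mulr0 subr0 ger0_norm// mulrC.
  rewrite pVk//; apply: le_Rintegral => //; last first.
  - move=> t /=; rewrite in_itv /= => /andP[t0 _]; apply: le_trans (uv t) _.
    have Vt : 0 <= V t by rewrite -V0 mon.
    by rewrite mulrA fk ger0_norm// [_ / _]mulrC mulrCA.
  - exact: locally_integrable_itv.
  - exact: integrable_norm.
rewrite -normrN -[- _]add0r -(signed_primitive0 u) pu.2//.
have iu := locally_integrable_itv x 0 lu.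
apply: le_trans (le_normr_Rintegral _ iu) _ => //.
have Vx : V x <= 0 by rewrite -V0 mon.
rewrite -[leRHS]opprK -[- (- _)]sub0r.
have -> : - (`|V x| ^+ k.+1 / k.+1`!%:R) =
   k.+1`!%:R^-1 * (- V 0) ^+ k.+1 - k.+1`!%:R^-1 * (- V x) ^+ k.+1.
  by rewrite V0 oppr0 expr0n /= mulr0 sub0r ler0_norm// mulrC.
rewrite pVk'// sub0r.
rewrite -[leLHS]opprK lerN2 -mulN1r -RintegralZl//; last exact: integrable_norm.
apply: le_Rintegral => //.
- exact: locally_integrable_itv.
- have iN : mu.-integrable `[x, 0] (EFin \o (fun t => `|u t|)) by exact: integrable_norm.
  exact: (integrableZl _ (-1) iN).
- move=> t /=; rewrite in_itv /= => /andP[_ t0]; rewrite mulN1r lerNr.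
  apply: le_trans (uv t) _.
  have Vt : V t <= 0 by rewrite -V0 mon.
  by rewrite mulrA fk ler0_norm// mulNr mulrN opprK [_ / _]mulrC mulrCA.
Qed.

End IteratedIntegralBound.

(** * The Dyson series of a linear system *)

Section Picard.
Context {R : realType} {N : nat}.
Local Notation mu := (@lebesgue_measure R).
Context (A : R -> 'M[R]_N).
Context (lA : forall i j, locally_integrable setT (fun x => A x i j)).

(** Bounds every row sum of [|A x|], so that multiplication by [A x] enlarges a bound on the entries
    by a factor of at most [a x]. Its primitive [alpha] plays the role of time in the factorial
    estimates. *)
Let a (x : R) : R := \sum_i \sum_j `|A x i j|.
Let alpha := signed_primitive a.

(* the increments of the Picard iteration, i.e. the terms of the Dyson series *)
Fixpoint picard k : R -> 'M[R]_N :=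
  if k is k'.+1 then
    fun x => \matrix_(i, j) signed_primitive (fun t => \sum_l A t i l * picard k' t l j) x
  else fun=> 1%:M.

Lemma cvgn_sum (I : Type) (r : seq I) (u : I -> nat -> R) (l : I -> R) :
  (forall i, u i n @[n --> \oo] --> l i) ->
  \sum_(i <- r) u i n @[n --> \oo] --> \sum_(i <- r) l i.
Proof.
move=> h; elim: r => [|i r ih].
  by under eq_fun do rewrite big_nil; rewrite big_nil; exact: cvg_cst.
by under eq_fun do rewrite big_cons; rewrite big_cons; apply: cvgD.
Qed.

Lemma locally_integrable_norm (g : R -> R) : locally_integrable setT g ->
  locally_integrable setT (fun x => `|g x|).
Proof.
move=> lg; have [mg _ _] := lg.
apply: itv_locally_integrable; first exact: measurableT_comp.
by move=> n; apply: integrable_norm => //; exact: locally_integrable_itv.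
Qed.

Lemma locally_integrable_sum (I : Type) (r : seq I) (f : I -> R -> R) :
  (forall i, locally_integrable setT (f i)) ->
  locally_integrable setT (fun x => \sum_(i <- r) f i x).
Proof.
move=> h; have [] // := @primitive_sum R I r (fun i => signed_primitive (f i)) f.
by move=> i; exact: signed_primitiveP.
Qed.

Let la : locally_integrable setT a.
Proof.
by apply: locally_integrable_sum => i; apply: locally_integrable_sum => j;
  exact: locally_integrable_norm.
Qed.

Let a_ge0 x : 0 <= a x.
Proof. by rewrite /a sumr_ge0// => i _; rewrite sumr_ge0. Qed.

Let row_le_a x i (v : 'I_N -> R) (M : R) : 0 <= M -> (forall l, `|v l| <= M) ->
  `|\sum_l A x i l * v l| <= a x * M.
Proof.
move=> M0 vM; apply: le_trans (ler_norm_sum _ _ _) _.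
apply: (@le_trans _ _ (\sum_l `|A x i l| * M)).
  by apply: ler_sum => l _; rewrite normrM ler_wpM2l.
rewrite -mulr_suml ler_wpM2r// /a [leRHS](bigD1 i)//= lerDl sumr_ge0// => k _.
by rewrite sumr_ge0.
Qed.

Let Arow k i j := fun t => \sum_l A t i l * picard k t l j.

Let picard_integrable k : (forall i j, continuous (fun x => picard k x i j)) ->
  forall i j, locally_integrable setT (Arow k i j).
Proof.
move=> ck i j; apply: locally_integrable_sum => l.
have := locally_integrableM_continuous (ck l j) (lA i l).
by under [X in locally_integrable _ X -> _]eq_fun do rewrite mulrC.
Qed.

Let picard_continuous k i j : continuous (fun x => picard k x i j).
Proof.
elim: k i j => [|k ih] i j; first by move=> x; exact: cst_continuous.
under eq_fun do rewrite mxE.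
exact: primitive_continuous (signed_primitiveP (picard_integrable ih i j)).
Qed.

Let picard_primitive k i j : primitive (fun x => picard k.+1 x i j) (Arow k i j).
Proof.
have := signed_primitiveP (picard_integrable (@picard_continuous k) i j).
by apply: primitive_ext => x; rewrite mxE.
Qed.

Let picard_bound k i j x : `|picard k x i j| <= `|alpha x| ^+ k / k`!%:R.
Proof.
elim: k i j x => [|k ih] i j x.
  by rewrite expr0 fact0 divr1 mxE; case: eqP => _; rewrite ?normr1 ?normr0.
rewrite [picard k.+1]/= mxE; apply: signed_primitive_bound_exp => //.
  exact: (picard_integrable (@picard_continuous k) i j).
by move=> t; apply: row_le_a => //; rewrite divr_ge0// exprn_ge0.
Qed.

Let S i j n x : R := \sum_(0 <= k < n) picard k x i j.

Let S_bound i j n x (M : R) : `|alpha x| <= M -> `|S i j n x| <= expR M.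
Proof.
move=> aM; have M0 : 0 <= M by exact: le_trans aM.
apply: le_trans (ler_norm_sum _ _ _) _.
apply: (@le_trans _ _ (series (exp_coeff M) n)).
  apply: ler_sum => k _; apply: le_trans (picard_bound k i j x) _.
  by rewrite /exp_coeff /= ler_wpM2r// lerXn2r.
apply: nondecreasing_cvgn_le; last exact: is_cvg_series_exp_coeff.
by apply: nondecreasing_series => k _ _; exact: exp_coeff_ge0.
Qed.

Let S_cvg i j x : cvgn (fun n => S i j n x).
Proof.
apply: (@normed_cvg R R (fun k => picard k x i j)).
apply: (@series_le_cvg _ _ (exp_coeff `|alpha x|)).
- by move=> n /=.
- by move=> n; exact: exp_coeff_ge0.
- by move=> n; exact: picard_bound.
- exact: is_cvg_series_exp_coeff.
Qed.

Definition picard_limit x : 'M[R]_N := \matrix_(i, j) limn (fun n => S i j n x).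

Let S_continuous i j n : continuous (S i j n).
Proof.
move=> x; rewrite /S; elim: n => [|n ih].
  by under eq_fun do rewrite big_geq//; exact: cst_continuous.
under eq_fun do rewrite big_nat_recr//=.
by apply: cvgD; [exact: ih|exact: picard_continuous].
Qed.

Let limit_cvg i j x : S i j n x @[n --> \oo] --> picard_limit x i j.
Proof. by rewrite mxE; exact: S_cvg. Qed.

Let limit_measurable i j : measurable_fun setT (fun x => picard_limit x i j).
Proof.
apply: (@measurable_fun_cvg _ _ _ _ (S i j)).
  by move=> n; apply: measurable_continuous; exact: S_continuous.
by move=> x _; exact: limit_cvg.
Qed.

Let limit_bound i j x (M : R) : `|alpha x| <= M -> `|picard_limit x i j| <= expR M.
Proof.
move=> aM; have h : `|S i j n x| @[n --> \oo] --> `|picard_limit x i j|.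
  by apply: cvg_norm; exact: limit_cvg.
rewrite -(cvg_lim _ h)//; apply: limr_le; first by apply/cvg_ex; eexists; exact: h.
by apply: nearW => n; exact: S_bound.
Qed.

Let alpha_continuous : continuous alpha.
Proof. exact: primitive_continuous (signed_primitiveP la). Qed.

(** [picard_limit] inherits the integral equation from the partial sums, which satisfy it up to a
    shift of the index. On a segment where [|alpha| <= M] they are all bounded by [expR M], so
    [a x * expR M] dominates the integrands. *)
Lemma linear_ode_exists : exists Y : R -> 'M[R]_N, Y 0 = 1%:M /\
  forall i j, primitive (fun x => Y x i j) (fun x => \sum_l A x i l * Y x l j).
Proof.
exists picard_limit; split.
  apply/matrixP => i j; apply: (cvg_unique _ (limit_cvg (i:=i) (j:=j) (x:=0))) => //.
  apply: cvg_near_cst; exists 1%N => // -[//|n] _ /=.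
  rewrite /S big_nat_recl//= big1 ?addr0// => k _.
  by rewrite mxE signed_primitive0.
move=> i j; pose G t := \sum_l A t i l * picard_limit t l j.
rewrite -/(primitive _ G).
have mA i' j' : measurable_fun setT (fun x => A x i' j') by case: (lA i' j').
have mG : measurable_fun setT G.
  by rewrite /G; apply: measurable_sum => l; apply: measurable_funM.
have bound y z : exists2 M : R, 0 < M & forall x, y <= x <= z -> `|alpha x| <= M.
  exact: continuous_bounded_segment.
have Gbound M x : `|alpha x| <= M -> `|G x| <= a x * expR M.
  by move=> aM; apply: row_le_a => [|l]; [exact: expR_ge0|exact: limit_bound].
have iaM y z M : mu.-integrable `[y, z] (EFin \o (fun x => a x * expR M)).
  apply: locally_integrable_itv; under eq_fun do rewrite mulrC.
  exact: locally_integrableZ.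
split.
  apply: itv_locally_integrable => // n; have [M M0 aM] := bound (- n%:R) n%:R.
  apply: (le_integrable _ _ _ (iaM _ _ M)) => //.
    by apply/measurable_EFinP; exact: measurable_funTS.
  move=> x /=; rewrite in_itv /= => xn; rewrite lee_fin.
  by rewrite [leRHS]ger0_norm ?mulr_ge0 ?expR_ge0// Gbound// aM.
move=> x y xy; have [M M0 aM] := bound x y.
have h1 : S i j n.+1 y - S i j n.+1 x @[n --> \oo] --> picard_limit y i j - picard_limit x i j.
  by apply: cvgB; [rewrite (cvg_shiftS (fun n => S i j n y))|rewrite (cvg_shiftS (fun n => S i j n x))]; exact: limit_cvg.
apply: (cvg_unique _ h1) => //.
(* The constant term [picard 0] drops out of the increment, and each [picard k.+1] integrates [A]
   times [picard k]. *)
have E n : S i j n.+1 y - S i j n.+1 x =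
    (\int[mu]_(t in `[x, y]) (\sum_l A t i l * S l j n t))%R.
  have pS : primitive (fun z => \sum_(0 <= k < n) picard k.+1 z i j)
                      (fun t => \sum_(0 <= k < n) Arow k i j t).
    by apply: primitive_sum => k; exact: picard_primitive.
  rewrite /S !big_nat_recl//= opprD addrACA subrr add0r pS.2//.
  apply: eq_Rintegral => t _; rewrite exchange_big /=.
  by apply: eq_bigr => l _; rewrite mulr_sumr.
rewrite (funext E).
apply: (@dominated_cvg_Rintegral _ _ _ _ (fun x => a x * expR M)) => //.
- move=> n; apply: measurable_funTS; apply: measurable_sum => l; apply: measurable_funM => //.
  by apply: measurable_continuous; exact: S_continuous.
- exact: measurable_funTS.
- apply: aeW => t _; apply: cvgn_sum => l.
  by apply: cvgM; [exact: cvg_cst|exact: limit_cvg].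
- move=> n t /=; rewrite in_itv /= => txy; apply: row_le_a; first exact: expR_ge0.
  by move=> l; apply: S_bound; exact: aM.
Qed.

End Picard.

(** * Complex-valued primitives *)

Section ComplexParts.
Context {R : realType}.
Implicit Types z w : R[i].

Lemma ReD z w : complex.Re (z + w) = complex.Re z + complex.Re w.
Proof. by case: z w => a b [c d]. Qed.

Lemma ImD z w : complex.Im (z + w) = complex.Im z + complex.Im w.
Proof. by case: z w => a b [c d]. Qed.

Lemma ReN z : complex.Re (- z) = - complex.Re z.
Proof. by case: z. Qed.

Lemma ImN z : complex.Im (- z) = - complex.Im z.
Proof. by case: z. Qed.

Lemma ReM z w : complex.Re (z * w) =
  complex.Re z * complex.Re w - complex.Im z * complex.Im w.
Proof. by case: z w => a b [c d]. Qed.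

Lemma ImM z w : complex.Im (z * w) =
  complex.Re z * complex.Im w + complex.Im z * complex.Re w.
Proof. by case: z w => a b [c d]. Qed.

Lemma Re_conj z : complex.Re (Num.conj z) = complex.Re z.
Proof. by case: z. Qed.

Lemma Im_conj z : complex.Im (Num.conj z) = - complex.Im z.
Proof. by case: z. Qed.

Lemma Re_sum (I : Type) (r : seq I) (F : I -> R[i]) :
  complex.Re (\sum_(i <- r) F i) = \sum_(i <- r) complex.Re (F i).
Proof.
by elim: r => [|i r ih]; rewrite ?big_nil// !big_cons ReD ih.
Qed.

Lemma Im_sum (I : Type) (r : seq I) (F : I -> R[i]) :
  complex.Im (\sum_(i <- r) F i) = \sum_(i <- r) complex.Im (F i).
Proof.
by elim: r => [|i r ih]; rewrite ?big_nil// !big_cons ImD ih.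
Qed.

Lemma complex_ext z w : complex.Re z = complex.Re w -> complex.Im z = complex.Im w -> z = w.
Proof. by case: z w => a b [c d] /= -> ->. Qed.

Lemma normc_ge_Im z : `|complex.Im z|%:C <= `|z|.
Proof.
rewrite normc_def lecR -sqrtr_sqr ler_sqrt ?addr_ge0 ?sqr_ge0//.
by rewrite lerDr sqr_ge0.
Qed.

Lemma normc_le_ReIm z : `|z| <= (`|complex.Re z| + `|complex.Im z|)%:C.
Proof.
rewrite normc_def lecR -[leRHS]ger0_norm ?addr_ge0// -sqrtr_sqr ler_sqrt ?sqr_ge0//.
rewrite sqrrD !real_normK ?num_real// -addrA lerD2l lerDr.
by rewrite mulrn_wge0// mulr_ge0.
Qed.

End ComplexParts.

(** * Complex absolutely continuous functions and their derivatives *)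

Section ComplexPrimitive.
Context {R : realType}.
Local Notation mu := (@lebesgue_measure R).
Implicit Types (F G : R -> R[i]) (f g : R -> R) (a b : R).

(** A list is read as a family indexed by its positions. Real and imaginary part are handled at
    once, as additive maps [p] bounded by the modulus. *)
Lemma abs_continuous_on_abs_cont F a b : abs_continuous_on a b F ->
  abs_cont a b (ReF F) /\ abs_cont a b (ImF F).
Proof.
move=> acF; suff H (p : R[i] -> R) : (forall z w, p (z - w) = p z - p w) ->
    (forall z, `|p z|%:C <= `|z|) -> abs_cont a b (fun x => p (F x)).
  split; apply: H => [z w|z].
  - by rewrite ReD ReN.
  - exact: normc_ge_Re.
  - by rewrite ImD ImN.
  - exact: normc_ge_Im.
move=> pB pn e e0; have [d d0 dP] := acF e e0; exists d => // s sab sd sl.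
pose S i := (tnth (in_tuple s) i).1; pose T i := (tnth (in_tuple s) i).2.
have Sin i : tnth (in_tuple s) i \in s by exact: mem_tnth.
have tri : trivIset setT (fun i => `]S i, T i[%classic).
  move=> i j _ _ [z []] /=; rewrite !in_itv /= => /andP[i1 i2] /andP[j1 j2].
  apply/eqP/negPn/negP => ij.
  have /orP[h|h] : pair_disj (tnth (in_tuple s) i) (tnth (in_tuple s) j) ||
           pair_disj (tnth (in_tuple s) j) (tnth (in_tuple s) i).
    have [lt_ij|lt_ji|/val_inj eij] := ltngtP i j.
    - by rewrite !(tnth_nth (0, 0)) /= (pairwiseP (0, 0) sd)// !inE ltn_ord.
    - by rewrite orbC !(tnth_nth (0, 0)) /= (pairwiseP (0, 0) sd)// !inE ltn_ord.
    - by rewrite eij eqxx in ij.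
  - by move: h => /orP[]; rewrite -/(S i) -/(S j) -/(T i) -/(T j) => h; lra.
  - by move: h => /orP[]; rewrite -/(S i) -/(S j) -/(T i) -/(T j) => h; lra.
have Sab i : a <= S i /\ S i <= T i /\ T i <= b.
  by have /and3P[h1 h2 h3] := allP sab _ (Sin i).
have := dP _ S T Sab tri; rewrite /pairs_length big_tnth in sl.
move=> /(_ sl); rewrite -ltcR; apply: le_lt_trans.
rewrite /pairs_variation big_tnth rmorph_sum /=.
by apply: ler_sum => i _; rewrite -pB.
Qed.

Lemma abs_cont_abs_continuous_on F a b : abs_cont a b (ReF F) ->
  abs_cont a b (ImF F) -> abs_continuous_on a b F.
Proof.
move=> acR acI e e0.
have [d d0 dP] := acR (e / 2) (divr_gt0 e0 (ltr0Sn _ 1)).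
have [d' d'0 d'P] := acI (e / 2) (divr_gt0 e0 (ltr0Sn _ 1)).
exists (Num.min d d'); first by rewrite lt_min d0.
move=> k s t sab tri; rewrite lt_min => /andP[sl sl'].
(* Degenerate intervals are dropped: an empty []s, s[] may sit inside another interval without
   violating [trivIset], but it violates [pair_disj]. It contributes nothing to either sum. *)
pose P (i : 'I_k) := s i < t i.
pose L := [seq (s i, t i) | i <- enum 'I_k & P i].
have sumL (h : 'I_k -> R) : (forall i, ~~ P i -> h i = 0) ->
    \sum_(i <- enum 'I_k | P i) h i = \sum_i h i.
  move=> h0; rewrite big_enum_cond /= [RHS](bigID P) /= [X in _ + X]big1 ?addr0//.
have stE i : ~~ P i -> s i = t i.
  by rewrite /P -leNgt => ts; apply/eqP; rewrite eq_le ts (sab i).2.1.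
have Lab : all (pair_in a b) L.
  by apply/allP => _ /mapP[i _ ->]; have [h1 [h2 h3]] := sab i; apply/and3P.
have Ld : pairwise pair_disj L.
  rewrite pairwise_map.
  have := filter_uniq P (enum_uniq 'I_k); rewrite uniq_pairwise.
  apply: (@sub_in_pairwise _ P); last exact: (filter_all P).
  move=> i j Pi Pj /= /eqP ij; rewrite /pair_disj /= !leNgt -negb_and; apply/negP => /andP[h1 h2].
  apply: ij; apply: tri => //.
  (* The midpoint of the overlap is a common point of the two open intervals. *)
  have [c [c1 c2 c3 c4]] : exists c, [/\ s i < c, c < t i, s j < c & c < t j].
    exists ((Num.max (s i) (s j) + Num.min (t i) (t j)) / 2).
    have h : Num.max (s i) (s j) < Num.min (t i) (t j).
      by rewrite gt_max !lt_min; apply/andP; split; apply/andP; split; [exact: Pi|exact: h2|exact: h1|exact: Pj].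
    have [m1 m2] := (midf_lt h).
    split.
    - by apply: le_lt_trans m1; rewrite le_max lexx.
    - by apply: lt_le_trans m2 _; rewrite ge_min lexx.
    - by apply: le_lt_trans m1; rewrite le_max lexx orbT.
    - by apply: lt_le_trans m2 _; rewrite ge_min lexx orbT.
  by exists c; split => /=; rewrite in_itv /=; apply/andP.
have LL : pairs_length L = \sum_i (t i - s i).
  rewrite /pairs_length big_map big_filter sumL// => i /stE ->; exact: subrr.
have LV f : pairs_variation f L = \sum_i `|f (t i) - f (s i)|.
  by rewrite /pairs_variation big_map big_filter sumL// => i /stE ->; rewrite subrr normr0.
have := dP L Lab Ld; have := d'P L Lab Ld; rewrite !LL !LV => /(_ sl') h' /(_ sl) h.
apply: (@le_lt_trans _ _ (\sum_i (`|ReF F (t i) - ReF F (s i)| + `|ImF F (t i) - ImF F (s i)|)%:C)).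
  apply: ler_sum => i _; apply: le_trans (normc_le_ReIm _) _.
  by rewrite lecR /ReF /ImF ReD ReN ImD ImN.
by rewrite -rmorph_sum ltcR big_split /= [e]splitr ltrD.
Qed.

(** Where they differ at a point they differ on a ball around it, which has positive measure. This
    makes the continuous representative of a class unique. *)
Lemma continuous_ae_eq f g : continuous f -> continuous g ->
  {ae mu, forall x, f x = g x} -> f =1 g.
Proof.
move=> cf cg [N [mN N0 fgN]] x; apply/eqP/negPn/negP => fgx.
have ch : continuous (fun y => f y - g y) by move=> y; apply: cvgB; [exact: cf|exact: cg].
have : \forall y \near x, f y - g y != 0.
  have := ch x; move=> /(_ [set z | z != 0]); apply.
  by apply: open_nbhs_nbhs; split; [exact: open_neq|rewrite /= subr_eq0].
move=> /nbhs_ballP[e /= e0 xe].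
have : (mu (ball x e) <= mu N)%E.
  apply: le_measure; [by apply: mem_set; exact: measurable_ball|exact: mem_set|].
  by move=> y /xe /= h; apply: fgN => /= yE; rewrite yE subrr eqxx in h.
rewrite N0 leNgt => /negP; apply.
by rewrite lebesgue_measure_ball ?ltW// lte_fin mulrn_wgt0.
Qed.

Definition cprimitive F G := primitive (ReF F) (ReF G) /\ primitive (ImF F) (ImF G).

Lemma cprimitive_AC_loc F G : cprimitive F G -> AC_loc F.
Proof.
move=> [h1 h2] a b _; apply: abs_cont_abs_continuous_on.
- exact: primitive_abs_cont h1.
- exact: primitive_abs_cont h2.
Qed.

Lemma AC_loc_cprimitive F : AC_loc F -> exists G, cprimitive F G.
Proof.
move=> acF; exists (fun x => rderiv (ReF F) x +i* rderiv (ImF F) x).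
by split; apply: abs_cont_primitive => a b ab; have [] := abs_continuous_on_abs_cont (acF a b ab).
Qed.

Lemma cprimitive_derive F G : cprimitive F G -> {ae mu, forall x, cderive F x = G x}.
Proof.
move=> [/primitive_derive h1 /primitive_derive h2]; apply: (ae_imp2 _ h1 h2) => x d1 d2.
apply: complex_ext => /=; rewrite derive1E; exact: derive_val.
Qed.

Lemma cprimitive_unique F G G' : cprimitive F G -> cprimitive F G' ->
  {ae mu, forall x, G x = G' x}.
Proof.
by move=> /cprimitive_derive h /cprimitive_derive; apply: ae_imp2 h => x <-.
Qed.

Lemma cprimitiveD F F' G G' : cprimitive F F' -> cprimitive G G' ->
  cprimitive (fun x => F x + G x) (fun x => F' x + G' x).
Proof.
move=> [h1 h2] [h3 h4]; split.
  rewrite /ReF; under eq_fun do rewrite ReD; under [X in primitive _ X]eq_fun do rewrite ReD.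
  exact: primitiveD.
rewrite /ImF; under eq_fun do rewrite ImD; under [X in primitive _ X]eq_fun do rewrite ImD.
exact: primitiveD.
Qed.

Lemma cprimitiveM F F' G G' : cprimitive F F' -> cprimitive G G' ->
  cprimitive (fun x => F x * G x) (fun x => F' x * G x + F x * G' x).
Proof.
move=> [h1 h2] [h3 h4]; split.
  have := primitiveB (primitiveM h1 h3) (primitiveM h2 h4).
  rewrite /ReF; congr primitive; apply/funext => x; rewrite ?ReD ?ReM //.
  by rewrite /ReF /ImF; ring.
have := primitiveD (primitiveM h1 h4) (primitiveM h2 h3).
rewrite /ImF; congr primitive; apply/funext => x; rewrite ?ImD ?ImM //.
by rewrite /ReF /ImF; ring.
Qed.

Lemma cprimitive_conj F F' : cprimitive F F' ->
  cprimitive (fun x => Num.conj (F x)) (fun x => Num.conj (F' x)).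
Proof.
move=> [h1 h2]; split.
  rewrite /ReF; under eq_fun do rewrite Re_conj; under [X in primitive _ X]eq_fun do rewrite Re_conj.
  exact: h1.
rewrite /ImF; under eq_fun do rewrite Im_conj; under [X in primitive _ X]eq_fun do rewrite Im_conj.
exact: primitiveN.
Qed.

Lemma cprimitive_cst (c : R[i]) : cprimitive (fun=> c) (fun=> 0).
Proof. by split; exact: primitive_cst. Qed.

Lemma cprimitiveZ c F F' : cprimitive F F' ->
  cprimitive (fun x => c * F x) (fun x => c * F' x).
Proof.
move=> h; have := cprimitiveM (cprimitive_cst c) h.
by under [X in cprimitive _ X -> _]eq_fun do rewrite mul0r add0r.
Qed.

Lemma cprimitive_sum (I : Type) (r : seq I) (F F' : I -> R -> R[i]) :
  (forall i, cprimitive (F i) (F' i)) ->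
  cprimitive (fun x => \sum_(i <- r) F i x) (fun x => \sum_(i <- r) F' i x).
Proof.
move=> h; split.
  rewrite /ReF; under eq_fun do rewrite Re_sum; under [X in primitive _ X]eq_fun do rewrite Re_sum.
  by apply: primitive_sum => i; have [] := h i.
rewrite /ImF; under eq_fun do rewrite Im_sum; under [X in primitive _ X]eq_fun do rewrite Im_sum.
by apply: primitive_sum => i; have [] := h i.
Qed.

Definition cmeasurable F := measurable_fun setT (ReF F) /\ measurable_fun setT (ImF F).

Lemma cprimitive_ae_eq F G F' G' : cprimitive F G -> cprimitive F' G' ->
  {ae mu, forall x, F x = F' x} -> F =1 F'.
Proof.
move=> [h1 h2] [h3 h4] h x; apply: complex_ext.
  apply: (continuous_ae_eq (primitive_continuous h1) (primitive_continuous h3)).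
  by apply: ae_imp h => y; rewrite /ReF => ->.
apply: (continuous_ae_eq (primitive_continuous h2) (primitive_continuous h4)).
by apply: ae_imp h => y; rewrite /ImF => ->.
Qed.

End ComplexPrimitive.

(** * Square integrable functions *)

Section SquareIntegrable.
Context {R : realType}.
Local Notation mu := (@lebesgue_measure R).
Implicit Types (f g : R -> R) (F G : R -> R[i]) (z w : R[i]).

Lemma Lfun2P f : f \in Lfun mu 2%:E <->
  measurable_fun setT f /\ mu.-integrable setT (EFin \o (fun x => f x ^+ 2)).
Proof.
split=> [h|[mf h]].
  split; last exact: Lfun2_integrable_sqr.
  by have /sub_Lfun_mfun/set_mem := h.
rewrite inE; apply/andP; split; apply: mem_set; first exact: mf.
rewrite /= /finite_norm unlock /Lnorm poweR_lty//.
have /integrableP[_] := h; apply: le_lt_trans; rewrite le_eqVlt; apply/orP; left; apply/eqP.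
apply: eq_integral => x _ /=; congr EFin.
by rewrite powR_mulrn// normrX.
Qed.

Definition sqnorm z : R := complex.Re z ^+ 2 + complex.Im z ^+ 2.

Lemma sqnorm_ge0 z : 0 <= sqnorm z.
Proof. by rewrite addr_ge0 ?sqr_ge0. Qed.

Lemma sqnorm0 : sqnorm 0 = 0.
Proof. by rewrite /sqnorm /= expr0n addr0. Qed.

Lemma sqnormD_le z w : sqnorm (z + w) <= 2 * sqnorm z + 2 * sqnorm w.
Proof.
rewrite /sqnorm ReD ImD; move: (complex.Re z) (complex.Im z) (complex.Re w) (complex.Im w) => a b c d.
by have := sqr_ge0 (a - c); have := sqr_ge0 (b - d); nra.
Qed.

Lemma sqnormN z : sqnorm (- z) = sqnorm z.
Proof. by rewrite /sqnorm ReN ImN !sqrrN. Qed.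

Lemma sqnorm_conj z : sqnorm (Num.conj z) = sqnorm z.
Proof. by rewrite /sqnorm Re_conj Im_conj sqrrN. Qed.

Lemma sqnormM z w : sqnorm (z * w) = sqnorm z * sqnorm w.
Proof. by rewrite /sqnorm ReM ImM; ring. Qed.

Lemma measurable_sqnorm F : cmeasurable F -> measurable_fun setT (fun x => sqnorm (F x)).
Proof. by move=> [m1 m2]; apply: measurable_funD; apply: measurable_funX. Qed.

Lemma L2CP F : L2C F <->
  cmeasurable F /\ mu.-integrable setT (EFin \o (fun x => sqnorm (F x))).
Proof.
split=> [[/Lfun2P[m1 i1] /Lfun2P[m2 i2]]|[[m1 m2] h]].
  split => //; rewrite [X in integrable _ _ X](_ : _ =
    (EFin \o (fun x => ReF F x ^+ 2)%R) \+ (EFin \o (fun x => ImF F x ^+ 2)%R))%E//.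
  exact: integrableD.
have msq f : measurable_fun setT f ->
    measurable_fun setT (EFin \o (fun x => f x ^+ 2)).
  by move=> mf; apply/measurable_EFinP; apply: measurable_funX.
split; apply/Lfun2P; split => //.
  apply: le_integrable h => //; first exact: msq.
  move=> x _ /=; rewrite lee_fin !ger0_norm ?sqr_ge0 ?sqnorm_ge0//.
  by rewrite lerDl sqr_ge0.
apply: le_integrable h => //; first exact: msq.
move=> x _ /=; rewrite lee_fin !ger0_norm ?sqr_ge0 ?sqnorm_ge0//.
by rewrite lerDr sqr_ge0.
Qed.

Lemma L2C_dominated F h : cmeasurable F -> mu.-integrable setT (EFin \o h) ->
  {ae mu, forall x, sqnorm (F x) <= h x} -> L2C F.
Proof.
move=> mF ih Fh; apply/L2CP; split => //.
have msF : measurable_fun setT (EFin \o (fun x => sqnorm (F x))).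
  by apply/measurable_EFinP; exact: measurable_sqnorm.
have /integrableP[mh hoo] := ih; apply/integrableP; split => //.
apply: le_lt_trans hoo; apply: ae_ge0_le_integral => //.
- exact: measurableT_comp.
- exact: measurableT_comp.
- apply: ae_imp Fh => x Fh _ /=; rewrite lee_fin ger0_norm ?sqnorm_ge0//.
  exact: le_trans (ler_norm _).
Qed.

Lemma cmeasurableD F G : cmeasurable F -> cmeasurable G -> cmeasurable (fun x => F x + G x).
Proof.
move=> [m1 m2] [m3 m4]; split.
  by rewrite /ReF; under eq_fun do rewrite ReD; exact: measurable_funD.
by rewrite /ImF; under eq_fun do rewrite ImD; exact: measurable_funD.
Qed.

Lemma cmeasurableN F : cmeasurable F -> cmeasurable (fun x => - F x).
Proof.
move=> [m1 m2]; split.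
  by rewrite /ReF; under eq_fun do rewrite ReN; exact: measurableT_comp.
by rewrite /ImF; under eq_fun do rewrite ImN; exact: measurableT_comp.
Qed.

Lemma cmeasurableM F G : cmeasurable F -> cmeasurable G -> cmeasurable (fun x => F x * G x).
Proof.
move=> [m1 m2] [m3 m4]; split.
  rewrite /ReF; under eq_fun do rewrite ReM.
  by apply: measurable_funB; apply: measurable_funM.
rewrite /ImF; under eq_fun do rewrite ImM.
by apply: measurable_funD; apply: measurable_funM.
Qed.

Lemma cmeasurable_conj F : cmeasurable F -> cmeasurable (fun x => Num.conj (F x)).
Proof.
move=> [m1 m2]; split.
  by rewrite /ReF; under eq_fun do rewrite Re_conj; exact: m1.
by rewrite /ImF; under eq_fun do rewrite Im_conj; exact: measurableT_comp.
Qed.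

Lemma cmeasurable_cst (c : R[i]) : cmeasurable (fun=> c).
Proof. by split; exact: measurable_cst. Qed.

Lemma cprimitive_measurable F G : cprimitive F G -> cmeasurable F /\ cmeasurable G.
Proof.
move=> [h1 h2]; split; split.
- exact: measurable_continuous (primitive_continuous h1).
- exact: measurable_continuous (primitive_continuous h2).
- by case: h1 => -[].
- by case: h2 => -[].
Qed.

Lemma L2C_measurable F : L2C F -> cmeasurable F.
Proof. by move=> /L2CP[]. Qed.

Lemma L2CD F G : L2C F -> L2C G -> L2C (fun x => F x + G x).
Proof.
move=> /L2CP[mF iF] /L2CP[mG iG].
apply: (@L2C_dominated _ (fun x => 2 * sqnorm (F x) + 2 * sqnorm (G x))).
- exact: cmeasurableD.
- by have := integrableD _ (integrableZl measurableT 2 iF) (integrableZl measurableT 2 iG); apply.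
- by apply: aeW => x; exact: sqnormD_le.
Qed.

Lemma L2C_bddM F G (M : R) : cmeasurable F -> (forall x, sqnorm (F x) <= M) -> L2C G ->
  L2C (fun x => F x * G x).
Proof.
move=> mF FM /L2CP[mG iG].
apply: (@L2C_dominated _ (fun x => M * sqnorm (G x))).
- exact: cmeasurableM.
- exact: (integrableZl measurableT M iG).
- by apply: aeW => x; rewrite sqnormM ler_wpM2r// sqnorm_ge0.
Qed.

Lemma L2CZ c F : L2C F -> L2C (fun x => c * F x).
Proof. by apply: (@L2C_bddM _ _ (sqnorm c)) => //; exact: cmeasurable_cst. Qed.

Lemma L2CN F : L2C F -> L2C (fun x => - F x).
Proof. by move=> /(L2CZ (-1)); under eq_fun do rewrite mulN1r. Qed.

Lemma L2C0 : L2C (fun=> 0 : R[i]).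
Proof.
apply: (@L2C_dominated _ (fun=> 0)); first exact: cmeasurable_cst.
  exact: integrable0.
by apply: aeW => x; rewrite sqnorm0.
Qed.

Lemma L2C_conj F : L2C F -> L2C (fun x => Num.conj (F x)).
Proof.
move=> /L2CP[mF iF]; apply: (L2C_dominated _ iF); first exact: cmeasurable_conj.
by apply: aeW => x; rewrite sqnorm_conj.
Qed.

Lemma L2C_sum (I : Type) (r : seq I) (F : I -> R -> R[i]) :
  (forall i, L2C (F i)) -> L2C (fun x => \sum_(i <- r) F i x).
Proof.
move=> h; elim: r => [|i r ih].
  by under eq_fun do rewrite big_nil; exact: L2C0.
by under eq_fun do rewrite big_cons; exact: L2CD.
Qed.

Definition cintegrable F := mu.-integrable setT (EFin \o ReF F) /\
  mu.-integrable setT (EFin \o ImF F).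

Lemma cintegrableM F G : L2C F -> L2C G -> cintegrable (fun x => F x * G x).
Proof.
move=> [f1 f2] [g1 g2]; split.
  rewrite [X in integrable _ _ X](_ : _ =
    (EFin \o (ReF F \* ReF G)%R) \- (EFin \o (ImF F \* ImF G)%R))%E.
    by apply: integrableB => //; apply/Lfun1_integrable; exact: Lfun2_mul_Lfun1.
  by apply/funext => x /=; rewrite /ReF ReM.
rewrite [X in integrable _ _ X](_ : _ =
  (EFin \o (ReF F \* ImF G)%R) \+ (EFin \o (ImF F \* ReF G)%R))%E.
  by apply: integrableD => //; apply/Lfun1_integrable; exact: Lfun2_mul_Lfun1.
by apply/funext => x /=; rewrite /ImF ImM.
Qed.

Lemma cintegrable_sum (I : Type) (r : seq I) (F : I -> R -> R[i]) :
  (forall i, cintegrable (F i)) -> cintegrable (fun x => \sum_(i <- r) F i x).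
Proof.
move=> h; elim: r => [|i r ih].
  by split; rewrite [X in integrable _ _ X](_ : _ = cst 0)%E; try exact: integrable0;
     apply/funext => x /=; rewrite /ReF /ImF big_nil.
have [h1 h2] := h i; have [i1 i2] := ih; split.
  rewrite [X in integrable _ _ X](_ : _ = (EFin \o ReF (F i)) \+ (EFin \o ReF (fun x => \sum_(i <- r) F i x)%R))%E.
    exact: integrableD.
  by apply/funext => x /=; rewrite /ReF big_cons ReD.
rewrite [X in integrable _ _ X](_ : _ = (EFin \o ImF (F i)) \+ (EFin \o ImF (fun x => \sum_(i <- r) F i x)%R))%E.
  exact: integrableD.
by apply/funext => x /=; rewrite /ImF big_cons ImD.
Qed.

Lemma cintegralB F G : cintegrable F -> cintegrable G ->
  cintegral (fun x => F x - G x) = cintegral F - cintegral G.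
Proof.
move=> [f1 f2] [g1 g2]; apply: complex_ext; rewrite ?ReD ?ReN ?ImD ?ImN /=.
  rewrite -RintegralB//; apply: eq_Rintegral => x _; by rewrite /ReF ReD ReN.
rewrite -RintegralB//; apply: eq_Rintegral => x _; by rewrite /ImF ImD ImN.
Qed.

Lemma cintegral_conj F : cintegrable F ->
  cintegral (fun x => Num.conj (F x)) = Num.conj (cintegral F).
Proof.
move=> [f1 f2]; apply: complex_ext; rewrite ?Re_conj ?Im_conj /=.
  by apply: eq_Rintegral => x _; rewrite /ReF Re_conj.
rewrite -mulN1r -RintegralZl//; apply: eq_Rintegral => x _; by rewrite /ImF Im_conj mulN1r.
Qed.

End SquareIntegrable.

(** * Inner product and convergence in L2 of vector functions *)

Section VectorL2.
Context {R : realType} {n : nat}.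
Local Notation mu := (@lebesgue_measure R).
Implicit Types (F G H K : vfun R n) (T : graph R n).

Definition vsqnorm F (x : R) : R := \sum_j sqnorm (F x j 0).

Lemma vsqnorm_ge0 F x : 0 <= vsqnorm F x.
Proof. by rewrite sumr_ge0// => j _; exact: sqnorm_ge0. Qed.

Lemma inner_entryE (u v : 'cV[R[i]]_n) :
  (u^t* *m v) 0 0 = \sum_j Num.conj (u j 0) * v j 0.
Proof. by rewrite mxE; apply: eq_bigr => j _; rewrite !mxE. Qed.

Lemma innerE F G : inner F G = cintegral (fun x => \sum_j Num.conj (F x j 0) * G x j 0).
Proof. by congr cintegral; apply/funext => x; rewrite inner_entryE. Qed.

Lemma Re_innerxx F : complex.Re (inner F F) = (\int[mu]_x vsqnorm F x)%R.
Proof.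
rewrite innerE /=; apply: eq_Rintegral => x _; rewrite /ReF Re_sum.
by apply: eq_bigr => j _; rewrite ReM Re_conj Im_conj /sqnorm; ring.
Qed.

Lemma L2norm_lt F (e : R) : 0 < e -> (L2norm F < e) = ((\int[mu]_x vsqnorm F x)%R < e ^+ 2).
Proof.
move=> e0; rewrite /L2norm Re_innerxx -[X in _ < X]gtr0_norm// -sqrtr_sqr.
by rewrite ltr_sqrt// exprn_gt0.
Qed.

Lemma L2_vsqnorm F : L2 F -> mu.-integrable setT (EFin \o vsqnorm F).
Proof.
move=> hF; rewrite [X in integrable _ _ X](_ : _ = fun x => (\sum_(j <- index_enum 'I_n) (sqnorm (F x j 0))%:E)%E).
  by apply: integrable_sum => // j _; have /L2CP[] := hF j.
by apply/funext => x; rewrite /= sumEFin.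
Qed.

Lemma L2D F G : L2 F -> L2 G -> L2 (fun x => F x + G x).
Proof.
move=> hF hG j; have := L2CD (hF j) (hG j); congr L2C.
by apply/funext => x; rewrite mxE.
Qed.

Lemma L2Z c F : L2 F -> L2 (fun x => c *: F x).
Proof.
move=> hF j; have := L2CZ c (hF j); congr L2C.
by apply/funext => x; rewrite mxE.
Qed.

Lemma L2N F : L2 F -> L2 (fun x => - F x).
Proof.
move=> hF j; have := L2CN (hF j); congr L2C.
by apply/funext => x; rewrite mxE.
Qed.

Lemma L2B F G : L2 F -> L2 G -> L2 (fun x => F x - G x).
Proof. by move=> hF hG; apply: L2D => //; exact: L2N. Qed.

Lemma L2_0 : L2 (0 : vfun R n).
Proof. by move=> j; have := @L2C0 R; congr L2C; apply/funext => x; rewrite mxE. Qed.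

Lemma inner_cintegrable F G : L2 F -> L2 G ->
  cintegrable (fun x => \sum_j Num.conj (F x j 0) * G x j 0).
Proof.
by move=> hF hG; apply: cintegrable_sum => j; apply: cintegrableM => //; exact: L2C_conj.
Qed.

Lemma innerC F G : L2 F -> L2 G -> inner G F = Num.conj (inner F G).
Proof.
move=> hF hG; rewrite !innerE -cintegral_conj; last exact: inner_cintegrable.
congr cintegral; apply/funext => x; rewrite rmorph_sum; apply: eq_bigr => j _.
by rewrite rmorphM /= conjCK mulrC.
Qed.

Lemma innerBr F G H : L2 F -> L2 G -> L2 H ->
  inner F (fun x => G x - H x) = inner F G - inner F H.
Proof.
move=> hF hG hH; rewrite !innerE -cintegralB; try exact: inner_cintegrable.
congr cintegral; apply/funext => x; rewrite -sumrB; apply: eq_bigr => j _.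
by rewrite !mxE mulrBr.
Qed.

(** Continuity of the inner product in its second argument, from Young's inequality
    [|a b| <= (t a^2 + t^-1 b^2) / 2] with a weight [t] adapted to [F], in place of
    Cauchy-Schwarz. *)
Lemma inner_small F (e : R) : L2 F -> 0 < e -> exists2 d : R, 0 < d &
  forall G, L2 G -> L2norm G < d ->
    `|complex.Re (inner F G)| < e /\ `|complex.Im (inner F G)| < e.
Proof.
move=> hF e0; pose N := (\int[mu]_x vsqnorm F x)%R.
have N0 : 0 <= N by apply: Rintegral_ge0 => x _; exact: vsqnorm_ge0.
(* Makes [t * N < e / 2]; the [+ 1] covers the case of a vanishing [F]. The other half of [e] is
   left to [G], whose squared norm is kept below [e / 2 * t]. *)
pose t := e / (2 * (N + 1)).
have t0 : 0 < t by rewrite divr_gt0// mulr_gt0// ltr_wpDl.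
have tN : t * N < e / 2.
  have N1 : 0 < N + 1 by rewrite ltr_wpDl.
  have -> : t * N = e / 2 * (N / (N + 1)) by rewrite /t; field; rewrite gt_eqF.
  by rewrite gtr_pMr ?divr_gt0// ltr_pdivrMr// mul1r ltrDl.
have et : 0 < e / 2 * t by apply: mulr_gt0 t0; rewrite divr_gt0.
have iF := L2_vsqnorm hF; exists (Num.sqrt (e / 2 * t)); first by rewrite sqrtr_gt0.
move=> G hG; rewrite L2norm_lt ?sqrtr_gt0// sqr_sqrtr ?ltW// => Gd.
have iG := L2_vsqnorm hG; have [i1 i2] := inner_cintegrable hF hG.
have ib : mu.-integrable setT (EFin \o (fun x => t * vsqnorm F x + t^-1 * vsqnorm G x)).
  by have := integrableD measurableT (integrableZl measurableT t iF) (integrableZl measurableT t^-1 iG).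
have bound (p : R[i] -> R) (f := fun x => p (\sum_j Num.conj (F x j 0) * G x j 0)) :
    mu.-integrable setT (EFin \o f) ->
    (forall x, `|f x| <= t * vsqnorm F x + t^-1 * vsqnorm G x) ->
    `|(\int[mu]_x f x)%R| < e.
  move=> i_f fb; apply: le_lt_trans (le_normr_Rintegral measurableT i_f) _.
  apply: (@le_lt_trans _ _ (\int[mu]_x (t * vsqnorm F x + t^-1 * vsqnorm G x))%R).
    apply: le_Rintegral => //; exact: integrable_norm.
  rewrite RintegralD//; [|exact: (integrableZl measurableT t iF)|exact: (integrableZl measurableT t^-1 iG)].
  rewrite !RintegralZl//= [e]splitr ltrD// mulrC ltr_pdivrMr//.
have term (a b : R) : `|a * b| <= (t * a ^+ 2 + t^-1 * b ^+ 2) / 2.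
  have h s : s ^+ 2 = 1 -> s * (a * b) <= (t * a ^+ 2 + t^-1 * b ^+ 2) / 2.
    move=> s1; rewrite -subr_ge0.
    have -> : (t * a ^+ 2 + t^-1 * b ^+ 2) / 2 - s * (a * b) = t^-1 * (t * a - s * b) ^+ 2 / 2.
      have -> : (t * a - s * b) ^+ 2 = t ^+ 2 * a ^+ 2 - 2 * t * s * a * b + s ^+ 2 * b ^+ 2 by ring.
      by rewrite s1; field; rewrite gt_eqF.
    by rewrite divr_ge0// mulr_ge0 ?sqr_ge0// invr_ge0 ltW.
  rewrite ler_norml lerNl -[- (a * b)]mulN1r -[X in _ && (X <= _)]mul1r.
  by rewrite !h ?expr1n// sqrrN expr1n.
have pt (p : R[i] -> R) : (forall r (u : 'I_n -> R[i]), p (\sum_(j <- r) u j) = \sum_(j <- r) p (u j)) ->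
    (forall z w, `|p (Num.conj z * w)| <= t * sqnorm z + t^-1 * sqnorm w) ->
    forall x, `|p (\sum_j Num.conj (F x j 0) * G x j 0)| <= t * vsqnorm F x + t^-1 * vsqnorm G x.
  move=> psum pb x; rewrite psum; apply: le_trans (ler_norm_sum _ _ _) _.
  by rewrite /vsqnorm !mulr_sumr -big_split; apply: ler_sum => j _; exact: pb.
have nn z w : 0 <= t * sqnorm z /\ 0 <= t^-1 * sqnorm w.
  by split; rewrite mulr_ge0 ?sqnorm_ge0// ?invr_ge0 ltW.
rewrite innerE; split => /=.
  apply: bound => //; apply: pt => [r u|z w]; first exact: Re_sum.
  rewrite ReM Re_conj Im_conj mulNr opprK; apply: le_trans (ler_normD _ _) _.
  apply: le_trans (lerD (term _ _) (term _ _)) _.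
  by move: (nn z w) => [+ +]; rewrite /sqnorm; lra.
apply: bound => //; apply: pt => [r u|z w]; first exact: Im_sum.
rewrite ImM Re_conj Im_conj; apply: le_trans (ler_normD _ _) _.
rewrite mulNr normrN.
apply: le_trans (lerD (term _ _) (term _ _)) _.
  by move: (nn z w) => [+ +]; rewrite /sqnorm; lra.
Qed.

(** Both sides are continuous in their second argument, so the relation defining the adjoint passes
    to limits of pairs of [T]. *)
Lemma adjoint_op_closure T G H F K : (forall F K, T (F, K) -> L2 F /\ L2 K) ->
  adjoint T (G, H) -> op_closure T (F, K) -> inner G K = inner H F.
Proof.
move=> TL2 [/= hG hH TGH] [/= hF hK TFK]; apply/eqP; rewrite -subr_eq0; apply/eqP.
have small (p : R[i] -> R) : (forall z w, p (z - w) = p z - p w) ->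
    (forall F e, L2 F -> 0 < e -> exists2 d : R, 0 < d &
      forall G, L2 G -> L2norm G < d -> `|p (inner F G)| < e) ->
    p (inner G K - inner H F) = 0.
  move=> pB pe; apply/eqP; rewrite -normr_le0; apply/ler_addgt0Pr => e e0; rewrite add0r.
  have e2 : 0 < e / 2 by rewrite divr_gt0.
  have [d1 d10 h1] := pe G _ hG e2; have [d2 d20 h2] := pe H _ hH e2.
  have [|[F' K'] [/= TF'K' dF dK]] := TFK (Num.min d1 d2); first by rewrite lt_min d10.
  have [hF' hK'] := TL2 _ _ TF'K'.
  rewrite lt_min in dF; rewrite lt_min in dK.
  have -> : inner G K - inner H F = inner G (fun x => K x - K' x) - inner H (fun x => F x - F' x).
    by rewrite !innerBr// (TGH _ _ TF'K'); ring.
  rewrite pB; apply: le_trans (ler_normB _ _) _; rewrite [e]splitr lerD//.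
    by apply/ltW/h1; [exact: L2B|case/andP: dK].
  by apply/ltW/h2; [exact: L2B|case/andP: dF].
apply: complex_ext; apply: small => [z w|F' e hF' e0].
- by rewrite ReD ReN.
- by have [d d0 h] := inner_small hF' e0; exists d => // G' hG' /(h _ hG')[].
- by rewrite ImD ImN.
- by have [d d0 h] := inner_small hF' e0; exists d => // G' hG' /(h _ hG')[].
Qed.

Lemma L2norm_dominated (F : vfun R n) (Fk : nat -> vfun R n) (h : R -> R) :
  L2 F -> (forall k j, cmeasurable (fun x => Fk k x j 0)) ->
  {ae mu, forall x, forall j, sqnorm (F x j 0 - Fk k x j 0) @[k --> \oo] --> 0} ->
  mu.-integrable setT (EFin \o h) ->
  (forall k x j, sqnorm (F x j 0 - Fk k x j 0) <= h x) ->
  forall e : R, 0 < e -> \forall k \near \oo, L2norm (fun x => F x - Fk k x) < e.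
Proof.
move=> hF mFk Fcvg ih Fh e e0.
have mF j := L2C_measurable (hF j).
have mD k j : measurable_fun setT (fun x => sqnorm (F x j 0 - Fk k x j 0)).
  by apply: measurable_sqnorm; apply: cmeasurableD => //; exact: cmeasurableN.
have : (\int[mu]_x (vsqnorm (fun x => F x - Fk k x) x))%R @[k --> \oo] --> (\int[mu]_x (cst 0 x))%R.
  apply: (@dominated_cvg_Rintegral _ _ _ _ (fun x => n%:R * h x)) => //.
  - move=> k; apply: measurable_sum => j.
    by under eq_fun do rewrite !mxE; exact: mD.
  - apply: ae_imp Fcvg => x Fx _; rewrite /cst.
    have -> : 0 = \sum_(j < n) (0 : R) by rewrite big1.
    by apply: cvgn_sum => j; under eq_fun do rewrite !mxE; exact: Fx.
  - exact: (integrableZl measurableT n%:R ih).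
  - move=> k x _; rewrite ger0_norm ?vsqnorm_ge0// /vsqnorm.
    rewrite -[n in n%:R]card_ord mulr_natl -sumr_const.
    by apply: ler_sum => j _; rewrite !mxE.
rewrite Rintegral_cst// mul0r => /cvgrPdist_lt /(_ (e ^+ 2)).
rewrite exprn_gt0// => /(_ isT); apply: filterS => k.
rewrite sub0r normrN L2norm_lt//; apply: le_lt_trans; exact: ler_norm.
Qed.

End VectorL2.

(** * Cut-offs, density and the du Bois-Reymond lemma *)

Section RealTestFunctions.
Context {R : realType}.
Local Notation mu := (@lebesgue_measure R).
Implicit Types (c f g h u v w : R -> R) (K : R).

Lemma lipschitz_primitive f K : 0 <= K -> (forall x y, `|f x - f y| <= K * `|x - y|) ->
  primitive f (rderiv f) /\ forall x, `|rderiv f x| <= K.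
Proof.
move=> K0 fK; split; last by move=> x; apply: rderiv_lipschitz => y; exact: fK.
apply: abs_cont_primitive => a b _ e e0; exists (e / (K + 1)).
  by rewrite divr_gt0// ltr_wpDl.
move=> s sab _; rewrite ltr_pdivlMr ?ltr_wpDl//; apply: le_lt_trans.
rewrite /pairs_variation /pairs_length mulr_suml big_seq [leRHS]big_seq.
apply: ler_sum => p /(allP sab)/and3P[_ p12 _].
apply: le_trans (fK _ _) _; rewrite ger0_norm ?subr_ge0// mulrC.
by rewrite ler_wpM2l ?subr_ge0// lerDl.
Qed.

Lemma locally_integrable_cst K : locally_integrable setT (fun=> K).
Proof.
have := @locally_integrable_indic R setT setT openT measurableT.
move=> /(locally_integrableZ K); congr locally_integrable.
by apply/funext => x; rewrite indicT mulr1.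
Qed.

Lemma bounded_support_Lfun2 g K (N : R) : measurable_fun setT g ->
  (forall x, `|g x| <= K) -> (forall x, N < `|x| -> g x = 0) -> g \in Lfun mu 2%:E.
Proof.
move=> mg gK gN; apply/Lfun2P; split => //.
have iK : mu.-integrable setT (EFin \o ((cst (K ^+ 2)) \_ `[- N, N])).
  rewrite -restrict_EFin -integrable_mkcond//.
  exact: locally_integrable_itv (locally_integrable_cst _).
apply: le_integrable iK => //.
  by apply/measurable_EFinP; exact: measurable_funX.
move=> x _ /=; rewrite lee_fin patchE; case: ifPn => [|xN].
  move=> _; rewrite !normrX lerXn2r ?nnegrE//.
  exact: le_trans (gK x) (ler_norm K).
rewrite gN ?expr0n ?normr0// ltNge; apply/negP => h.
by move/negP: xN; apply; apply: mem_set; rewrite /= in_itv /= -ler_norml.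
Qed.

(** A trapezoid that falls from 1 to 0 with slope 1 on [k <= |x| <= k + 1]; being Lipschitz, it is a
    primitive of its [rderiv]. *)
Definition cutoff (k : nat) (x : R) : R := Num.max 0 (Num.min (k.+1%:R - `|x|) 1).

Lemma cutoff_lip k x y : `|cutoff k x - cutoff k y| <= 1 * `|x - y|.
Proof.
rewrite mul1r /cutoff; set p := _ - `|x|; set q := _ - `|y|.
have pq : `|p - q| <= `|x - y|.
  have -> : p - q = `|y| - `|x| by rewrite /p /q; ring.
  by apply: le_trans (ler_dist_dist _ _) _; rewrite distrC.
apply: le_trans pq; have [xy|/ltW xy] := leP p q.
  by rewrite distrC ger0_norm ?subr_ge0 ?clamp_le// distrC ger0_norm ?subr_ge0// clamp_lip.
by rewrite ger0_norm ?subr_ge0 ?clamp_le// ger0_norm ?subr_ge0// clamp_lip.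
Qed.

Lemma cutoff_itv k x : 0 <= cutoff k x <= 1.
Proof. by have := @clamp_itv R 0 1 (k.+1%:R - `|x|) ler01; rewrite in_itv. Qed.

Lemma cutoff_out k x : k.+1%:R <= `|x| -> cutoff k x = 0.
Proof.
move=> kx; rewrite /cutoff max_l// ge_min subr_le0 kx //.
Qed.

Lemma cutoff_in k x : `|x| <= k%:R -> cutoff k x = 1.
Proof.
move=> kx; rewrite /cutoff min_r ?max_r//.
by rewrite -natr1 lerBrDr addrC lerD2r.
Qed.

Lemma rderiv_cutoff_in k x : `|x| < k%:R -> rderiv (cutoff k) x = 0.
Proof.
move=> kx; apply: (@rderiv_near_cst _ _ _ 1).
near=> y; apply: cutoff_in; apply/ltW; near: y.
have := @norm_continuous R R x; move=> /cvgr_lt; exact.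
Unshelve. all: by end_near. Qed.

Lemma cutoff_near1 x : \forall k \near \oo, cutoff k x = 1 /\ rderiv (cutoff k) x = 0.
Proof.
exists (Num.truncn `|x|).+1 => // k /= xk.
have h : `|x| < k%:R by apply: lt_le_trans (truncnS_gt _) _; rewrite ler_nat.
by split; [apply: cutoff_in; exact: ltW|exact: rderiv_cutoff_in].
Qed.

Lemma signed_primitive_lip g K : locally_integrable setT g -> (forall x, `|g x| <= K) ->
  forall x y, `|signed_primitive g x - signed_primitive g y| <= K * `|x - y|.
Proof.
move=> lg gK x y; wlog xy : x y / x <= y.
  by move=> H; have [/H//|/ltW/H] := leP x y; rewrite distrC (distrC x y).
rewrite distrC (distrC x y) (signed_primitiveP lg).2//.
have ig := locally_integrable_itv x y lg.
apply: le_trans (le_normr_Rintegral _ ig) _ => //.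
have E : (\int[mu]_(t in `[x, y]) cst K t)%R = K * `|y - x|.
  have mE : mu `[x, y]%classic = (y - x)%:E.
    rewrite lebesgue_measure_itv/= lte_fin; case: ltgtP xy => //= -> _.
    by rewrite subrr.
  rewrite Rintegral_cst// ger0_norm ?subr_ge0//.
  by rewrite -[y - x in RHS]/(fine (y - x)%:E) -mE.
rewrite -E; apply: le_Rintegral => //.
- exact: integrable_norm.
- exact: locally_integrable_itv (locally_integrable_cst _).
Qed.

End RealTestFunctions.

(** * Density of compactly supported Lipschitz functions *)

Section LipschitzDensity.
Context {R : realType}.
Local Notation mu := (@lebesgue_measure R).
Implicit Types (c f g h u v w : R -> R) (K N : R).

Lemma Rintegral_support (D : set R) f : (forall x, ~ D x -> f x = 0) ->
  (\int[mu]_x f x = \int[mu]_(x in D) f x)%R.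
Proof.
move=> f0; rewrite [RHS]Rintegral_mkcond; apply: eq_Rintegral => x _.
rewrite patchE; case: ifPn => // xD; rewrite f0// => Dx.
by move/negP: xD; apply; exact: mem_set.
Qed.

Lemma Lfun2_measurable f : f \in Lfun mu 2%:E -> measurable_fun setT f.
Proof. by move=> /Lfun2P[]. Qed.

Lemma integrable_sqrB u v : u \in Lfun mu 2%:E -> v \in Lfun mu 2%:E ->
  mu.-integrable setT (EFin \o (fun x => (u x - v x) ^+ 2)).
Proof.
move=> /Lfun2P[mu' iu] /Lfun2P[mv iv].
have i2 : mu.-integrable setT (EFin \o (fun x => 2 * u x ^+ 2 + 2 * v x ^+ 2)).
  by have := integrableD measurableT (integrableZl measurableT 2 iu) (integrableZl measurableT 2 iv).
apply: le_integrable i2 => //.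
  by apply/measurable_EFinP; apply: measurable_funX; apply: measurable_funB.
move=> x _ /=; have h1 := sqr_ge0 (u x); have h2 := sqr_ge0 (v x).
rewrite lee_fin (ger0_norm (sqr_ge0 _)) ger0_norm; last lra.
by have := sqr_ge0 (u x + v x); nra.
Qed.

Lemma Lfun2_locally_integrable f : f \in Lfun mu 2%:E -> locally_integrable setT f.
Proof.
move=> /Lfun2P[mf f2]; apply: itv_locally_integrable => // n.
have i1 : mu.-integrable `[- n%:R, n%:R] (EFin \o (fun x => f x ^+ 2 + 1)).
  have h : mu.-integrable `[- n%:R, n%:R] (EFin \o (fun x => f x ^+ 2)).
    by apply: integrableS f2.
  by have := integrableD _ h (locally_integrable_itv (- n%:R) n%:R (locally_integrable_cst 1)); apply.
apply: le_integrable i1 => //; first by apply/measurable_EFinP; exact: measurable_funTS.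
move=> x _ /=; rewrite lee_fin [leRHS]ger0_norm ?addr_ge0 ?sqr_ge0//.
have := sqr_ge0 (`|f x| - 1); rewrite sqrrB real_normK ?num_real// mulr1 expr1n.
by have := normr_ge0 (f x); lra.
Qed.

Lemma truncation_dense f (e : R) : f \in Lfun mu 2%:E -> 0 < e ->
  exists g (n : nat), [/\ measurable_fun setT g, forall x, `|g x| <= n%:R,
    forall x, n%:R < `|x| -> g x = 0 & (\int[mu]_x (f x - g x) ^+ 2)%R < e].
Proof.
move=> /Lfun2P[mf f2] e0.
pose A (n : nat) := [set x : R | `|x| <= n%:R /\ `|f x| <= n%:R].
have mA n : measurable (A n).
  have -> : A n = `[- n%:R, n%:R]%classic `&` (setT `&` f @^-1` `[- n%:R, n%:R]%classic).
    apply/seteqP; split => [x [h1 h2]|x [h1 [_ h2]]].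
      by split; [|split => //]; rewrite /= in_itv /= -ler_norml.
    by move: h1 h2; rewrite /= !in_itv /= -!ler_norml.
  by apply: measurableI => //; exact: mf.
pose g n := f \_ (A n).
have mg n : measurable_fun setT (g n).
  by apply/(measurable_restrictT _ (mA n)); exact: measurable_funTS.
have gE n x : (g n x = f x /\ `|x| <= n%:R /\ `|f x| <= n%:R) \/ (g n x = 0 /\ ~ A n x).
  rewrite /g patchE; case: ifPn => [/set_mem[]|/negP xA]; [by left|right; split => //].
  by move=> Ax; apply: xA; exact: mem_set.
have : (\int[mu]_x (f x - g n x) ^+ 2)%R @[n --> \oo] --> (\int[mu]_x (cst 0 x : R))%R.
  apply: (@dominated_cvg_Rintegral _ _ _ _ (fun x => f x ^+ 2)) => //.
  - by move=> n; apply: measurable_funX; apply: measurable_funB.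
  - apply: aeW => x _; apply: cvg_near_cst.
    exists (Num.truncn (Num.max `|x| `|f x|)).+1 => // n /= xn.
    have : Num.max `|x| `|f x| <= n%:R.
      by apply/ltW/(lt_le_trans (truncnS_gt _)); rewrite ler_nat.
    rewrite ge_max => /andP[xn1 xn2].
    by have [[-> _]|[_ []]] := gE n x; rewrite ?subrr ?expr0n.
  - move=> n x _; rewrite ger0_norm ?sqr_ge0//.
    by have [[-> _]|[-> _]] := gE n x; rewrite ?subrr ?subr0// expr0n /= sqr_ge0.
rewrite Rintegral_cst// mul0r => /cvgrPdist_lt /(_ e e0) [n _ /(_ n (leqnn _))].
rewrite sub0r normrN => ne; exists (g n), n; split => //.
- by move=> x; have [[-> [_ ->]]|[-> _]] := gE n x; rewrite ?normr0.
- move=> x nx; have [[_ [h _]]|[-> _]//] := gE n x.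
  by have := lt_le_trans nx h; rewrite ltxx.
- exact: le_lt_trans (ler_norm _) ne.
Qed.

(** [c k] is the mean of [g] over [[x, x + 1/(k+1)]]. It converges to [g] almost everywhere by
    Lebesgue differentiation, obeys the same bound as [g], and is Lipschitz as a difference of two
    Lipschitz functions. Averaging enlarges the support by at most 1, whence [n.+1]. *)
Lemma average_dense g (n : nat) (e : R) : measurable_fun setT g ->
  (forall x, `|g x| <= n%:R) -> (forall x, n%:R < `|x| -> g x = 0) -> 0 < e ->
  exists c K, [/\ 0 <= K, forall x y, `|c x - c y| <= K * `|x - y|,
    forall x, n.+1%:R < `|x| -> c x = 0, measurable_fun setT c &
    (\int[mu]_x (g x - c x) ^+ 2)%R < e].
Proof.
move=> mg gn gn0 e0.
have lg : locally_integrable setT g.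
  exact: Lfun2_locally_integrable (bounded_support_Lfun2 mg gn gn0).
pose P := signed_primitive g; have pP : primitive P g := signed_primitiveP lg.
have Plip := signed_primitive_lip lg gn.
have cP := primitive_continuous pP.
pose c k (x : R) := k.+1%:R * (P (x + k.+1%:R^-1) - P x).
have cn k x : `|c k x| <= n%:R.
  rewrite /c normrM normr_nat mulrC -ler_pdivlMr//.
  by have := Plip (k.+1%:R^-1 + x) x; rewrite addrK normfV normr_nat [_ + x]addrC.
have cmeas k : measurable_fun setT (c k).
  apply: measurable_continuous => x; apply: cvgM; first exact: cvg_cst.
  apply: cvgB; last exact: cP.
  have hx : y + k.+1%:R^-1 @[y --> x] --> x + k.+1%:R^-1.
    by apply: cvgD; [exact: cvg_id|exact: cvg_cst].
  exact: (cvg_comp _ _ hx (cP _)).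
have k1 k : (k.+1%:R^-1 : R) <= 1 by rewrite invf_le1// ler1n.
have c0 k x : n.+1%:R < `|x| -> c k x = 0.
  move=> nx; rewrite /c pP.2 ?lerDl//.
  have -> : (\int[mu]_(t in `[x, (x + k.+1%:R^-1)%R]) g t = \int[mu]_(t in `[x, (x + k.+1%:R^-1)%R]) cst 0 t)%R.
    apply: eq_Rintegral => t /set_mem /=; rewrite in_itv /= => /andP[t1 t2].
    apply: gn0; have k1k := k1 k; have n0 : 0 <= n%:R :> R by [].
    rewrite -natr1 in nx.
    have [x0|x0] := leP 0 x.
      rewrite (ger0_norm x0) in nx; rewrite (ger0_norm (le_trans x0 t1)).
      by apply: lt_le_trans t1; apply: lt_trans nx; rewrite ltrDl.
    rewrite (ltr0_norm x0) in nx; have t0 : t < - n%:R.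
      apply: le_lt_trans t2 _; move: k1k nx; set q := _^-1; lra.
    by rewrite ltr0_norm ?(lt_le_trans t0) ?oppr_le0// ltrNr.
  by rewrite Rintegral_cst// mul0r mulr0.
have gc k x : `|g x - c k x| <= (2 * n%:R).
  by apply: le_trans (ler_normB _ _) _; have := gn x; have := cn k x; lra.
have : (\int[mu]_x (g x - c k x) ^+ 2)%R @[k --> \oo] --> (\int[mu]_x (cst 0 x : R))%R.
  (* Its square is the dominating function: [|g - c k|] is at most [2 * n%:R] and vanishes outside
     [[- n.+1%:R, n.+1%:R]]. *)
  pose b : R -> R := (cst (2 * n%:R : R)) \_ `[- n.+1%:R, n.+1%:R]%classic.
  have mb : measurable_fun setT b.
    by apply/(measurable_restrictT _ (measurable_itv _)); exact: measurable_funTS.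
  have /Lfun2P[_ ib] : b \in Lfun mu 2%:E.
    apply: (bounded_support_Lfun2 (K := 2 * n%:R) (N := n.+1%:R) mb).
      move=> x; rewrite /b patchE; case: ifP => _; rewrite ?normr0 ?mulr_ge0//.
      by rewrite ger0_norm// mulr_ge0.
    move=> x nx; rewrite /b patchE; case: ifPn => // /set_mem /=; rewrite in_itv /= -ler_norml.
    by rewrite leNgt nx.
  apply: (@dominated_cvg_Rintegral _ _ _ _ (fun x => b x ^+ 2)) => //.
  - by move=> k; apply: measurable_funX; apply: measurable_funB.
  - apply: ae_imp (primitive_derive pP) => x /is_derive_cvg_quotient h _.
    have -> : cst 0 x = (g x - g x) ^+ 2 :> R by rewrite subrr expr0n.
    rewrite expr2; under eq_fun do rewrite expr2.
    by apply: cvgM; apply: cvgB => //; exact: cvg_cst.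
  - move=> k x _; rewrite ger0_norm ?sqr_ge0//.
    have [xn|xn] := leP `|x| n.+1%:R; last first.
      by rewrite c0// gn0 ?subrr ?expr0n ?sqr_ge0//; apply: lt_trans xn; rewrite ltr_nat.
    rewrite /b patchE mem_set /=; last by rewrite in_itv /= -ler_norml.
    rewrite -[leLHS]ger0_norm ?sqr_ge0// normrX lerXn2r ?nnegrE ?mulr_ge0//.
rewrite Rintegral_cst// mul0r => /cvgrPdist_lt /(_ e e0) [k _ /(_ k (leqnn _))].
rewrite sub0r normrN => ke; exists (c k), (k.+1%:R * (2 * n%:R)); split => //.
- move=> x y; rewrite /c -mulrBr normrM normr_nat -mulrA ler_wpM2l//.
  have -> : P (x + k.+1%:R^-1) - P x - (P (y + k.+1%:R^-1) - P y) =
    (P (x + k.+1%:R^-1) - P (y + k.+1%:R^-1)) - (P x - P y) by ring.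
  apply: le_trans (ler_normB _ _) _.
  have h1 := Plip (x + k.+1%:R^-1) (y + k.+1%:R^-1); have h2 := Plip x y.
  have E : x + k.+1%:R^-1 - (y + k.+1%:R^-1) = x - y by ring.
  by rewrite E in h1; rewrite -mulrA mulr_natl mulr2n lerD.
- exact: c0.
- exact: le_lt_trans (ler_norm _) ke.
Qed.

Lemma lipschitz_dense f (e : R) : f \in Lfun mu 2%:E -> 0 < e ->
  exists c c', [/\ primitive c c', c \in Lfun mu 2%:E, c' \in Lfun mu 2%:E,
    exists N : nat, forall x, N%:R < `|x| -> c x = 0 & (\int[mu]_x (f x - c x) ^+ 2)%R < e].
Proof.
(* The quarter is used up by [(f - c)^2 <= 2 (f - g)^2 + 2 (g - c)^2]. *)
move=> f2 e0; have e4 : 0 < e / 4 by rewrite divr_gt0.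
have [g [n [mg gn gn0 fg]]] := truncation_dense f2 e4.
have [c [K [K0 cK c0 mc gc]]] := average_dense mg gn gn0 e4.
have [pc c'K] := lipschitz_primitive K0 cK.
have c'0 x : n.+1%:R < `|x| -> rderiv c x = 0.
  move=> nx; apply: (@rderiv_near_cst _ _ _ 0); near=> y; apply: c0; near: y.
  by have := @norm_continuous R R x; move=> /cvgr_gt; apply.
have g2 := bounded_support_Lfun2 mg gn gn0.
have c2 : c \in Lfun mu 2%:E.
  have [M M0 cM] := continuous_bounded_segment (- n.+1%:R) n.+1%:R (primitive_continuous pc).
  apply: (bounded_support_Lfun2 (K := M) (N := n.+1%:R)) => // x.
  have [xn|xn] := leP `|x| n.+1%:R; first by rewrite cM// -ler_norml.
  by rewrite c0// normr0 ltW.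
exists c, (rderiv c); split => //.
- by apply: bounded_support_Lfun2 c'K c'0; case: pc => -[].
- by exists n.+1.
have i2 := integrable_sqrB.
apply: (@le_lt_trans _ _ (\int[mu]_x (2 * (f x - g x) ^+ 2 + 2 * (g x - c x) ^+ 2))%R).
  apply: le_Rintegral => //; first exact: i2.
    by have := integrableD measurableT (integrableZl measurableT 2 (i2 _ _ f2 g2)) (integrableZl measurableT 2 (i2 _ _ g2 c2)).
  move=> x _; have := sqr_ge0 ((f x - g x) - (g x - c x)); nra.
rewrite RintegralD//; [|exact: (integrableZl measurableT 2 (i2 _ _ f2 g2))|exact: (integrableZl measurableT 2 (i2 _ _ g2 c2))].
rewrite !RintegralZl//; try exact: i2.
lra.
Unshelve. all: by end_near. Qed.

End LipschitzDensity.

(** * The du Bois-Reymond lemma in L2 *)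

Section DuBoisReymond.
Context {R : realType}.
Local Notation mu := (@lebesgue_measure R).
Implicit Types (c f g h u v w : R -> R) (K N : R).

(** Passes from segments, where primitives give the value of integrals, to the whole line by
    dominated convergence. *)
Lemma Rintegral_exhaust h : mu.-integrable setT (EFin \o h) ->
  (exists N : nat, forall n : nat, (N <= n)%N -> (\int[mu]_(x in `[- n%:R, n%:R]) h x = 0)%R) ->
  (\int[mu]_x h x = 0)%R.
Proof.
move=> ih [N hN].
have mh : measurable_fun setT h by case/integrableP : ih => /measurable_EFinP.
pose D (n : nat) : set R := `[- n%:R, n%:R]%classic.
have : (\int[mu]_x (h \_ (D n)) x)%R @[n --> \oo] --> (\int[mu]_x h x)%R.
  apply: (@dominated_cvg_Rintegral _ _ _ _ (fun x => `|h x|)) => //.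
  - by move=> n; apply/(measurable_restrictT _ (measurable_itv _)); exact: measurable_funTS.
  - apply: aeW => x _; apply: cvg_near_cst.
    exists (Num.truncn `|x|).+1 => // n /= xn.
    rewrite patchE mem_set// /D /= in_itv /= -ler_norml.
    by apply/ltW/(lt_le_trans (truncnS_gt _)); rewrite ler_nat.
  - exact: integrable_norm.
  - by move=> n x _; rewrite patchE; case: ifP => _; rewrite ?normr0.
move=> hc; apply: (cvg_unique _ hc) => //.
apply: cvg_near_cst; exists N => // n /= Nn.
by rewrite -Rintegral_mkcond hN.
Qed.

(** With [H] a primitive of [- h], the claim is that [v = w - H] is constant. Test functions here
    need only a square integrable derivative, so on a segment [v] minus its mean can itself serve as
    the derivative of a test function; the identity then makes the integral of its square vanish. *)
Lemma du_Bois_Reymond w h : w \in Lfun mu 2%:E -> h \in Lfun mu 2%:E ->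
  (forall c c', primitive c c' -> c \in Lfun mu 2%:E -> c' \in Lfun mu 2%:E ->
    (exists N : nat, forall x, N%:R < `|x| -> c x = 0) ->
    (\int[mu]_x (w x * c' x) = \int[mu]_x (h x * c x))%R) ->
  exists2 u, primitive u (fun x => - h x) & {ae mu, forall x, w x = u x}.
Proof.
move=> w2 h2 test.
have lh := Lfun2_locally_integrable h2; have lw := Lfun2_locally_integrable w2.
have pH := primitiveN (signed_primitiveP lh).
set H := fun x => - signed_primitive h x in pH *.
have cH := primitive_continuous pH.
pose v x := w x - H x.
have mv : measurable_fun setT v.
  by apply: measurable_funB; [exact: Lfun2_measurable|exact: measurable_continuous].
have lH : locally_integrable setT H.
  have := locally_integrableM_continuous cH (locally_integrable_cst (1 : R)).
  by under [X in locally_integrable _ X -> _]eq_fun do rewrite mulr1.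
have lv : locally_integrable setT v by exact: locally_integrableB.
(* Constancy is shown on each [[- n.+1%:R, n.+1%:R]] separately. *)
suff key (n : nat) : exists k : R, {ae mu, forall x, `|x| <= n.+1%:R -> v x = k}.
  have [k kP] := choice key.
  have k0 n : k n = k 0%N.
    apply/eqP/negPn/negP => kn.
    (* All the segments contain [[-1, 1]], also for [n = 0] thanks to the successor; as it has
       positive measure, the constants coincide. *)
    pose I : set R := `[-1, 1]%classic.
    have [A [mA A0 hA]] : {ae mu, forall x, ~ I x}.
      apply: (ae_imp2 _ (kP n) (kP 0%N)) => x h1 h0; rewrite /I /= in_itv /= -ler_norml => x1.
      by move/eqP: kn; rewrite -h1 ?h0//; apply: le_trans x1 _; rewrite ler1n.
    have : (mu I <= mu A)%E.
      apply: le_measure; [by apply: mem_set; exact: measurable_itv|exact: mem_set|].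
      by move=> x xD; apply: hA => /=; exact.
    rewrite A0 lebesgue_measure_itv/= lte_fin ifT; last lra.
    by rewrite -EFinD lee_fin; lra.
  exists (fun x => H x + k 0%N).
    have := primitiveD pH (primitive_cst (k 0%N)).
    by under [X in primitive _ X -> _]eq_fun do rewrite addr0.
  apply: ae_imp (ae_foralln kP) => x hx.
  rewrite -(k0 (Num.truncn `|x|)) -(hx (Num.truncn `|x|)) ?subrKC//.
  exact/ltW/truncnS_gt.
pose N : R := n.+1%:R; pose D : set R := `[- N, N]%classic.
have N0 : 0 < N by rewrite ltr0n.
have mD : measurable (D : set (measurableTypeR R)) by exact: measurable_itv.
(* The mean of [v] over [D]: the integral of [v - k] over [D] is then 0. *)
pose k := (2 * N)^-1 * (\int[mu]_(x in D) v x)%R.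
exists k.
pose r : R -> R := (fun x => v x - k) \_ D.
have rE x : D x -> r x = v x - k by move=> Dx; rewrite /r patchE mem_set.
have rE0 x : ~ D x -> r x = 0.
  by move=> Dx; rewrite /r patchE; case: ifPn => // /set_mem.
have iv : mu.-integrable D (EFin \o v) by exact: locally_integrable_itv.
have ivk : mu.-integrable D (EFin \o (fun x => v x - k)).
  exact: locally_integrable_itv (locally_integrableB lv (locally_integrable_cst k)).
have mr : measurable_fun setT r.
  apply/(measurable_restrictT _ mD); apply: measurable_funTS.
  by apply: measurable_funB.
have muD : mu D = (2 * N)%:E.
  by rewrite lebesgue_measure_itv/= lte_fin ifT -?EFinD ?opprK; [congr EFin; lra|lra].
have vk0 : (\int[mu]_(x in D) (v x - k) = 0)%R.
  rewrite RintegralB//; last exact: locally_integrable_itv (locally_integrable_cst k).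
  rewrite Rintegral_cst//.
  have -> : fine (mu D) = 2 * N by rewrite muD.
  by rewrite /k mulrAC mulVf ?mul1r ?subrr// gt_eqF// mulr_gt0.
have r2 : r \in Lfun mu 2%:E.
  have [M M0 HM] := continuous_bounded_segment (- N) N cH.
  apply/Lfun2P; split => //.
  have /Lfun2P[_ iw] := w2.
  have i2 : mu.-integrable D (EFin \o (fun x => 2 * w x ^+ 2 + 2 * (M + `|k|) ^+ 2)).
    have iw' : mu.-integrable D (EFin \o (fun x => w x ^+ 2)) by apply: integrableS iw.
    have := integrableD mD (integrableZl mD 2 iw') (locally_integrable_itv (- N) N (locally_integrable_cst (2 * (M + `|k|) ^+ 2))).
    by [].
  rewrite (_ : (fun x => r x ^+ 2) = (fun x => (v x - k) ^+ 2) \_ D); last first.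
    apply/funext => x; rewrite /r !patchE; case: ifP => // _; by rewrite expr0n.
  rewrite -restrict_EFin -integrable_mkcond//.
  apply: le_integrable i2 => //.
    apply/measurable_EFinP; apply: measurable_funTS; apply: measurable_funX.
    by apply: measurable_funB.
  move=> x; rewrite /D /= in_itv /= => xN; rewrite lee_fin (ger0_norm (sqr_ge0 _)).
  have hx : (H x + k) ^+ 2 <= (M + `|k|) ^+ 2.
    rewrite -[leLHS]ger0_norm ?sqr_ge0// normrX; apply: lerXn2r; rewrite ?nnegrE//.
      by rewrite addr_ge0// ltW.
    by apply: le_trans (ler_normD _ _) _; rewrite lerD2r HM.
  have hw := sqr_ge0 (w x); have hM := sqr_ge0 (M + `|k|).
  rewrite ger0_norm; last lra.
  rewrite /v; have := sqr_ge0 (w x + (H x + k)); nra.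
have lr := Lfun2_locally_integrable r2.
(* This primitive vanishes at [- N] by construction and at [N] because [r] has integral 0, so it is
   supported in [D]. *)
pose c x := signed_primitive r x - signed_primitive r (- N).
have pc : primitive c r.
  have := primitiveB (signed_primitiveP lr) (primitive_cst (signed_primitive r (- N))).
  by under [X in primitive _ X -> _]eq_fun do rewrite subr0.
have cmN : c (- N) = 0 by rewrite /c subrr.
have intr x y : x <= y -> (forall t, x < t < y -> r t = 0) -> c y = c x.
  move=> xy h0; apply/eqP; rewrite -subr_eq0 pc.2// Rintegral_itv_oo//.
  apply/eqP; rewrite -[RHS](_ : (\int[mu]_(t in `]x, y[) cst 0 t)%R = _).
    by apply: eq_Rintegral => t /set_mem /=; rewrite in_itv /= => /h0.
  by rewrite Rintegral_cst// mul0r.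
have cN : c N = 0.
  have NN : - N <= N by lra.
  have := pc.2 _ _ NN; rewrite cmN subr0 => ->.
  by rewrite -[RHS]vk0; apply: eq_Rintegral => t /set_mem; exact: rE.
have c0 x : N < `|x| -> c x = 0.
  move=> Nx; have [x0|x0] := leP 0 x.
    rewrite (ger0_norm x0) in Nx; rewrite -cN; apply: intr; first exact: ltW.
    by move=> t /andP[Nt _]; apply: rE0; rewrite /D /= in_itv /= leNgt => /andP[_]; rewrite leNgt Nt.
  rewrite (ltr0_norm x0) in Nx; rewrite -cmN; apply/esym; apply: intr; first lra.
  by move=> t /andP[_ tN]; apply: rE0; rewrite /D /= in_itv /= leNgt tN.
have c2 : c \in Lfun mu 2%:E.
  have [M M0 cM] := continuous_bounded_segment (- N) N (primitive_continuous pc).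
  apply: (bounded_support_Lfun2 (K := M) (N := N)) => //.
    exact: measurable_continuous (primitive_continuous pc).
  move=> x; have [xn|xn] := leP `|x| N; first by rewrite cM// -ler_norml.
  by rewrite c0// normr0 ltW.
have notD x : ~ D x -> N < `|x|.
  by move=> Dx; rewrite ltNge; apply/negP => xN; apply: Dx; rewrite /D /= in_itv /= -ler_norml.
have E1 := test c r pc c2 r2 (ex_intro _ n.+1 c0).
rewrite (Rintegral_support (D := D)) in E1; last by move=> x /rE0 ->; rewrite mulr0.
rewrite (Rintegral_support (D := D)) in E1; last by move=> x /notD/c0 ->; rewrite mulr0.
have pHc := primitiveM pH pc.
have NN : - N <= N by lra.
have E2 := pHc.2 _ _ NN; rewrite cN cmN !mulr0 subrr in E2.
have iHr : mu.-integrable D (EFin \o (fun x => H x * r x)).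
  exact: locally_integrable_itv (locally_integrableM_continuous cH lr).
have ihc : mu.-integrable D (EFin \o (fun x => h x * c x)).
  have := locally_integrableM_continuous (primitive_continuous pc) lh.
  under [X in locally_integrable _ X -> _]eq_fun do rewrite mulrC.
  by move=> l; exact: locally_integrable_itv l.
have iwr : mu.-integrable D (EFin \o (fun x => w x * r x)).
  have := Lfun2_mul_Lfun1 w2 r2; move=> /Lfun1_integrable i_; exact: integrableS i_.
(* The test identity [E1] equates the integrals of [w r] and [h c]; [E2], integration by parts for
   [H c] with vanishing boundary terms, equates those of [H r] and [h c]. *)
have E3 : (\int[mu]_(x in D) (v x * r x) = 0)%R.
  transitivity ((\int[mu]_(x in D) (w x * r x))%R - (\int[mu]_(x in D) (H x * r x))%R).
    by rewrite -RintegralB//; apply: eq_Rintegral => x _; rewrite /v mulrBl.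
  rewrite E1 [X in _ = X]E2 -RintegralB//.
  transitivity (- (\int[mu]_(x in D) (- h x * c x + H x * r x))%R); last by rewrite -E2 oppr0.
  rewrite -mulN1r -RintegralZl//; last exact: locally_integrable_itv pHc.1.
  by apply: eq_Rintegral => x _; ring.
have ivr : mu.-integrable D (EFin \o (fun x => v x * r x)).
  have := integrableB mD iwr iHr; rewrite (_ : (_ \- _)%E = (EFin \o (fun x => v x * r x)))//.
  by apply/funext => x /=; rewrite /v mulrBl.
have E4 : (\int[mu]_(x in D) (v x - k) ^+ 2 = 0)%R.
  transitivity ((\int[mu]_(x in D) (v x * r x))%R - k * (\int[mu]_(x in D) (v x - k))%R); last first.
    by rewrite E3 vk0 mulr0 subrr.
  rewrite -RintegralZl// -RintegralB//; last exact: (integrableZl mD k ivk).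
  apply: eq_Rintegral => x /set_mem /rE ->; ring.
have i4 : mu.-integrable D (EFin \o (fun x => (v x - k) ^+ 2)).
  have := integrableB mD ivr (integrableZl mD k ivk).
  apply: eq_integrable => // x /set_mem Dx /=.
  by rewrite rE// -EFinD; congr EFin; ring.
have : (\int[mu]_(x in D) `|((v x - k) ^+ 2)%:E|)%E = 0%E.
  transitivity (\int[mu]_(x in D) ((v x - k) ^+ 2)%:E)%E.
    by apply: eq_integral => x _ /=; rewrite ger0_norm ?sqr_ge0.
  by rewrite -[LHS]fineK; [congr EFin; exact: E4|exact: integrable_fin_num].
move=> /ae_eq_integral_abs -/(_ mD).
have m4 : measurable_fun D (EFin \o (fun x => (v x - k) ^+ 2)) by case/integrableP: i4.
move=> /(_ m4); apply: ae_imp => x hx xN.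
have Dx : D x by rewrite /D /= in_itv /= -ler_norml.
have /eqP := hx Dx; rewrite eqe sqrf_eq0 subr_eq0 => /eqP; exact.
Qed.

End DuBoisReymond.

(** * The operator d/dx *)

Section DerivativeOperator.
Context {R : realType} {n : nat}.
Local Notation mu := (@lebesgue_measure R).
Implicit Types (F G H K U V : vfun R n).

Definition vprimitive U V := forall j, cprimitive (fun x => U x j 0) (fun x => V x j 0).

Definition ddx_max : graph R n := [set FG | [/\ L2 FG.1, L2 FG.2 & exists U U',
  [/\ vprimitive U U', FG.1 = U %[ae mu] & FG.2 = U' %[ae mu]]]].

Definition ddx_min : graph R n := [set FG | [/\ L2 FG.1, L2 FG.2 & exists U U',
  [/\ vprimitive U U', FG.1 = U %[ae mu], FG.2 = U' %[ae mu] &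
      compact (closure [set x | U x != 0])]]].

Lemma ae_eqP (F G : vfun R n) : F = G %[ae mu] <-> {ae mu, forall x, F x = G x}.
Proof. by split; apply: ae_imp => x h; [exact: h|move=> _]. Qed.

Lemma ae_forall_ord (m : nat) (P : 'I_m -> R -> Prop) :
  (forall j, {ae mu, forall x, P j x}) -> {ae mu, forall x, forall j, P j x}.
Proof.
move=> h; have : {ae mu, forall x, forall k : nat, forall km : (k < m)%N, P (Ordinal km) x}.
  apply: ae_foralln => k; have [km|km] := pselect (k < m)%N.
    by apply: ae_imp (h (Ordinal km)) => x Px km'; rewrite (bool_irrelevance km' km).
  by apply: aeW => x km'; case: km.
apply: ae_imp => x hx [k km]; exact: hx.
Qed.

Lemma cV_ext (u v : 'cV[R[i]]_n) : (forall j, u j 0 = v j 0) -> u = v.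
Proof. by move=> uv; apply/matrixP => j k; rewrite ord1. Qed.

Lemma compact_supportP U : compact (closure [set x | U x != 0]) <->
  exists N : nat, forall x, N%:R < `|x| -> U x = 0.
Proof.
split=> [cU|[N hN]].
  have [M [_ UM]] := compact_bounded cU.
  exists (Num.truncn (`|M| + 1)).+1 => x xM; apply/eqP/negPn/negP => Ux.
  have : `|x| <= `|M| + 1.
    by apply: UM; [rewrite (le_lt_trans (ler_norm M))// ltrDl|exact: subset_closure].
  by rewrite leNgt; apply/negP/negPn; exact: lt_trans (truncnS_gt _) xM.
apply: (@subclosed_compact _ _ (`[- N%:R, N%:R]%classic : set R)).
- exact: closed_closure.
- exact: segment_compact.
- have cl : closed (`[- N%:R, N%:R]%classic : set R) by exact: itv_closed.
  rewrite ((closure_id _).1 cl); apply: closureS => x /= Ux; rewrite in_itv /= -ler_norml leNgt.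
  by apply/negP => /hN Ux0; rewrite Ux0 eqxx in Ux.
Qed.

Lemma vprimitive_lin (c : R[i]) U U' V V' : vprimitive U U' -> vprimitive V V' ->
  vprimitive (fun x => c *: U x + V x) (fun x => c *: U' x + V' x).
Proof.
move=> h h' j; have := cprimitiveD (cprimitiveZ c (h j)) (h' j).
by congr cprimitive; apply/funext => x; rewrite !mxE.
Qed.

Lemma vprimitive0 : vprimitive (fun=> 0) (fun=> 0).
Proof.
move=> j; have := cprimitive_cst (0 : R[i]).
by congr cprimitive; apply/funext => x; rewrite mxE.
Qed.

(** Continuous representatives that agree almost everywhere are equal, and then so are their
    derivatives up to a null set. This is what makes [ddx_max] single valued. *)
Lemma vprimitive_ae_unique U U' V V' : vprimitive U U' -> vprimitive V V' ->
  {ae mu, forall x, U x = V x} -> {ae mu, forall x, U' x = V' x}.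
Proof.
move=> hU hV UV.
have E j : (fun x => U x j 0) = (fun x => V x j 0).
  by apply/funext; apply: (cprimitive_ae_eq (hU j) (hV j)); apply: ae_imp UV => x ->.
have : {ae mu, forall x, forall j, U' x j 0 = V' x j 0}.
  by apply: ae_forall_ord => j; apply: cprimitive_unique (hU j) _; rewrite E; exact: hV.
by apply: ae_imp => x h; exact: cV_ext.
Qed.

Lemma ddx_min_max : ddx_min `<=` ddx_max.
Proof.
by move=> [F G] [/= hF hG [U [U' [pU FU GU _]]]]; split => //; exists U, U'.
Qed.

Lemma linear_ddx_max : linear_operator ddx_max.
Proof.
split.
- by move=> F G [].
- move=> F F' G G' [/= hF hG [U [U' [pU /ae_eqP FU /ae_eqP GU]]]] hF' hG' /ae_eqP FF' /ae_eqP GG'.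
  split => //; exists U, U'; split => //; apply/ae_eqP.
    by apply: (ae_imp2 _ FU FF') => x /= <- <-.
  by apply: (ae_imp2 _ GU GG') => x /= <- <-.
- split => /=; try exact: L2_0.
  by exists (fun=> 0), (fun=> 0); split; [exact: vprimitive0|apply: aeW|apply: aeW].
- move=> c F F' G G' [/= hF hG [U [U' [pU /ae_eqP FU /ae_eqP GU]]]].
  move=> [/= hF' hG' [V [V' [pV /ae_eqP FV /ae_eqP GV]]]]; split => /=.
  + by apply: L2D => //; exact: L2Z.
  + by apply: L2D => //; exact: L2Z.
  + exists (fun x => c *: U x + V x), (fun x => c *: U' x + V' x); split.
    * exact: vprimitive_lin.
    * by apply/ae_eqP; apply: (ae_imp2 _ FU FV) => x /= -> ->.
    * by apply/ae_eqP; apply: (ae_imp2 _ GU GV) => x /= -> ->.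
- move=> F G K [/= _ _ [U [U' [pU /ae_eqP FU /ae_eqP GU]]]] [/= _ _ [V [V' [pV /ae_eqP FV /ae_eqP GV]]]].
  have UV : {ae mu, forall x, U x = V x} by apply: (ae_imp2 _ FU FV) => x <- <-.
  have h := vprimitive_ae_unique pU pV UV.
  apply/ae_eqP; apply: (ae_imp2 (P1 := fun x => G x = U' x) (P2 := fun x => U' x = K x)) => //.
    by move=> x -> ->.
  by apply: (ae_imp2 _ h GV) => x -> ->.
Qed.

Lemma linear_ddx_min : linear_operator ddx_min.
Proof.
have [h1 h2 h3 h4 h5] := linear_ddx_max; split.
- by move=> F G [].
- move=> F F' G G' [/= hF hG [U [U' [pU /ae_eqP FU /ae_eqP GU cU]]]] hF' hG' /ae_eqP FF' /ae_eqP GG'.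
  split => //; exists U, U'; split => //; apply/ae_eqP.
    by apply: (ae_imp2 _ FU FF') => x /= <- <-.
  by apply: (ae_imp2 _ GU GG') => x /= <- <-.
- split => /=; try exact: L2_0.
  exists (fun=> 0), (fun=> 0); split; [exact: vprimitive0|exact: aeW|exact: aeW|].
  by apply/compact_supportP; exists 0%N.
- move=> c F F' G G' [/= hF hG [U [U' [pU /ae_eqP FU /ae_eqP GU /compact_supportP[N hN]]]]].
  move=> [/= hF' hG' [V [V' [pV /ae_eqP FV /ae_eqP GV /compact_supportP[N' hN']]]]]; split => /=.
  + by apply: L2D => //; exact: L2Z.
  + by apply: L2D => //; exact: L2Z.
  + exists (fun x => c *: U x + V x), (fun x => c *: U' x + V' x); split.
    * exact: vprimitive_lin.
    * by apply/ae_eqP; apply: (ae_imp2 _ FU FV) => x /= -> ->.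
    * by apply/ae_eqP; apply: (ae_imp2 _ GU GV) => x /= -> ->.
    * apply/compact_supportP; exists (N + N')%N => x; rewrite natrD => xN.
      have N0 : 0 <= N%:R :> R by []. have N0' : 0 <= N'%:R :> R by [].
      by rewrite hN ?hN' ?scaler0 ?addr0//; lra.
- by move=> F G K /ddx_min_max FG /ddx_min_max FK; exact: h5 FG FK.
Qed.

Lemma Rintegral_sum (I : Type) (r : seq I) (f : I -> R -> R) :
  (forall i, mu.-integrable setT (EFin \o f i)) ->
  (\int[mu]_x (\sum_(i <- r) f i x) = \sum_(i <- r) \int[mu]_x f i x)%R /\
  mu.-integrable setT (EFin \o (fun x => \sum_(i <- r) f i x)).
Proof.
move=> h; elim: r => [|i r [ih1 ih2]].
  split; last by rewrite (_ : EFin \o _ = cst 0%E); [exact: integrable0|apply/funext => x /=; rewrite big_nil].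
  by under eq_Rintegral do rewrite big_nil; rewrite big_nil Rintegral_cst// mul0r.
split.
  by under eq_Rintegral do rewrite big_cons; rewrite RintegralD// ih1 big_cons.
rewrite (_ : EFin \o _ = (EFin \o f i) \+ (EFin \o (fun x => \sum_(i <- r) f i x)%R))%E; first exact: integrableD.
by apply/funext => x /=; rewrite big_cons EFinD.
Qed.

Lemma ddx_min_dense : densely_defined ddx_min.
Proof.
move=> F hF e e0.
(* There are [2 * n] real components, each with squared error below this bound, for a total at most
   [e ^+ 2 * n / (n + 1)]; the successor keeps it strictly below [e ^+ 2] and covers [n = 0]. *)
have d0 : 0 < e ^+ 2 / (2 * n.+1%:R) by rewrite divr_gt0// ?exprn_gt0// mulr_gt0.
pose P (f : R -> R) (cc : (R -> R) * (R -> R)) := [/\ primitive cc.1 cc.2, cc.1 \in Lfun mu 2%:E, cc.2 \in Lfun mu 2%:E,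
    exists N : nat, forall x, N%:R < `|x| -> cc.1 x = 0 & (\int[mu]_x (f x - cc.1 x) ^+ 2)%R < e ^+ 2 / (2 * n.+1%:R)].
have hP f : f \in Lfun mu 2%:E -> exists cc, P f cc.
  by move=> hf; have [c [c' hc]] := lipschitz_dense hf d0; exists (c, c').
have /choice[cr crP] : forall j : 'I_n, exists cc, P (ReF (fun x => F x j 0)) cc.
  by move=> j; apply: hP; have [] := hF j.
have /choice[ci ciP] : forall j : 'I_n, exists cc, P (ImF (fun x => F x j 0)) cc.
  by move=> j; apply: hP; have [] := hF j.
pose C : vfun R n := fun x => \col_j ((cr j).1 x +i* (ci j).1 x).
pose C' : vfun R n := fun x => \col_j ((cr j).2 x +i* (ci j).2 x).
have CE j : (fun x => C x j 0) = (fun x => (cr j).1 x +i* (ci j).1 x) by apply/funext => x; rewrite mxE.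
have CE' j : (fun x => C' x j 0) = (fun x => (cr j).2 x +i* (ci j).2 x) by apply/funext => x; rewrite mxE.
have hC : L2 C by move=> j; rewrite CE; split; [have [] := crP j|have [] := ciP j].
exists C.
  exists C'; split => //=.
    by move=> j; rewrite CE'; split; [have [] := crP j|have [] := ciP j].
  exists C, C'; split.
  - by move=> j; rewrite CE CE'; split; [have [] := crP j|have [] := ciP j].
  - exact: aeW.
  - exact: aeW.
  - apply/compact_supportP.
    have /choice[Nr NrP] : forall j, exists N : nat, forall x, N%:R < `|x| -> (cr j).1 x = 0.
      by move=> j; have [] := crP j.
    have /choice[Ni NiP] : forall j, exists N : nat, forall x, N%:R < `|x| -> (ci j).1 x = 0.
      by move=> j; have [] := ciP j.
    exists (\max_j (Nr j + Ni j))%N => x hx; apply: cV_ext => j; rewrite !mxE.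
    have hj : (Nr j + Ni j)%:R < `|x| by apply: le_lt_trans hx; rewrite ler_nat; exact: leq_bigmax.
    rewrite natrD in hj; have N0 : 0 <= (Nr j)%:R :> R by [].
    have N0' : 0 <= (Ni j)%:R :> R by [].
    by rewrite NrP ?NiP//; lra.
rewrite L2norm_lt//.
pose f j x := (ReF (fun x => F x j 0) x - (cr j).1 x) ^+ 2 + (ImF (fun x => F x j 0) x - (ci j).1 x) ^+ 2.
have i1 j : mu.-integrable setT (EFin \o (fun x => (ReF (fun x => F x j 0) x - (cr j).1 x) ^+ 2)).
  by apply: integrable_sqrB; [have [] := hF j|have [] := crP j].
have i2 j : mu.-integrable setT (EFin \o (fun x => (ImF (fun x => F x j 0) x - (ci j).1 x) ^+ 2)).
  by apply: integrable_sqrB; [have [] := hF j|have [] := ciP j].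
have i_f j : mu.-integrable setT (EFin \o f j).
  have := integrableD measurableT (i1 j) (i2 j).
  by [].
have -> : (\int[mu]_x vsqnorm (fun x => F x - C x) x = \int[mu]_x (\sum_(j < n) f j x))%R.
  apply: eq_Rintegral => x _; rewrite /vsqnorm; apply: eq_bigr => j _.
  by rewrite /f /sqnorm !mxE ReD ImD ReN ImN.
rewrite (Rintegral_sum _ i_f).1.
apply: (@le_lt_trans _ _ (\sum_(j < n) (e ^+ 2 / n.+1%:R))).
  apply: ler_sum => j _; rewrite RintegralD//.
  have [_ _ _ _ hr] := crP j; have [_ _ _ _ hi] := ciP j.
  apply/ltW; apply: lt_le_trans (ltrD hr hi) _.
  by rewrite invfM !mulrA -mulrDl -splitr.
rewrite sumr_const card_ord -[_ *+ n]mulr_natr -mulrA gtr_pMr ?exprn_gt0//.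
by rewrite mulrC ltr_pdivrMr// mul1r ltr_nat.
Qed.

End DerivativeOperator.

(** * Approximation by cut-offs in the graph norm of d/dx *)

Section DerivativeClosure.
Context {R : realType} {n : nat}.
Local Notation mu := (@lebesgue_measure R).
Implicit Types (F G H K U V : vfun R n).

Lemma cprimitive_real (c c' : R -> R) : primitive c c' ->
  cprimitive (fun x => (c x)%:C) (fun x => (c' x)%:C).
Proof. by move=> h; split => //; exact: primitive_cst. Qed.

Lemma cmeasurable_real (c : R -> R) : measurable_fun setT c -> cmeasurable (fun x => (c x)%:C).
Proof. by move=> h; split => //; exact: measurable_cst. Qed.

Lemma sqnorm_real (r : R) : sqnorm r%:C = r ^+ 2.
Proof. by rewrite /sqnorm /= expr0n addr0. Qed.

Lemma sqnorm_le_vsqnorm F x j : sqnorm (F x j 0) <= vsqnorm F x.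
Proof.
rewrite /vsqnorm (bigD1 j)//= lerDl sumr_ge0// => k _; exact: sqnorm_ge0.
Qed.

(* The cut-offs have slope at most 1: as the expression is of first order, the
   commutator term [rderiv (cutoff k) x *: U x] is dominated by [U] and supported
   in [k <= |x| <= k + 1], so that it vanishes in L^2. *)
Lemma ddx_max_closure_min : @ddx_max R n `<=` op_closure (@ddx_min R n).
Proof.
move=> [F G] [/= hF hG [U [U' [pU /ae_eqP FU /ae_eqP GU]]]]; split => // e e0.
have chi k := lipschitz_primitive ler01 (@cutoff_lip R k).
have c01 k := @cutoff_itv R k.
have mc k : cmeasurable (fun x => (cutoff k x)%:C : R[i]).
  by apply: cmeasurable_real; apply: measurable_continuous; exact: primitive_continuous (chi k).1.
have mc' k : cmeasurable (fun x => (rderiv (cutoff k) x)%:C : R[i]).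
  by apply: cmeasurable_real; case: (chi k) => [[[]]].
have sqc k (x : R) : sqnorm (cutoff k x)%:C <= 1.
  by rewrite sqnorm_real; have /andP[h1 h2] := c01 k x; rewrite exprn_ile1.
have sqc' k (x : R) : sqnorm (rderiv (cutoff k) x)%:C <= 1.
  have := (chi k).2 x; rewrite sqnorm_real -[_ ^+ 2]ger0_norm ?sqr_ge0// normrX => h.
  by rewrite exprn_ile1.
pose Fk k : vfun R n := fun x => (cutoff k x)%:C *: F x.
pose Gk k : vfun R n := fun x => (cutoff k x)%:C *: G x + (rderiv (cutoff k) x)%:C *: F x.
have FkE k j : (fun x => Fk k x j 0) = (fun x => (cutoff k x)%:C * F x j 0).
  by apply/funext => x; rewrite mxE.
have GkE k j : (fun x => Gk k x j 0) =
    (fun x => (cutoff k x)%:C * G x j 0 + (rderiv (cutoff k) x)%:C * F x j 0).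
  by apply/funext => x; rewrite !mxE.
have hFk k : L2 (Fk k) by move=> j; rewrite FkE; apply: (L2C_bddM (M := 1)).
have hGk k : L2 (Gk k).
  by move=> j; rewrite GkE; apply: L2CD; apply: (L2C_bddM (M := 1)).
have TFk k : ddx_min (Fk k, Gk k).
  split => //=; exists (fun x => (cutoff k x)%:C *: U x),
    (fun x => (cutoff k x)%:C *: U' x + (rderiv (cutoff k) x)%:C *: U x); split.
  - move=> j; have := cprimitiveM (cprimitive_real (chi k).1) (pU j).
    by congr cprimitive; apply/funext => x; rewrite !mxE// addrC.
  - by apply/ae_eqP; apply: ae_imp FU => x; rewrite /= /Fk => ->.
  - by apply/ae_eqP; apply: (ae_imp2 _ FU GU) => x; rewrite /= /Gk => -> ->.
  - apply/compact_supportP; exists k.+1 => x kx.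
    by rewrite cutoff_out ?scale0r// ltW.
have near1 := @cutoff_near1 R.
have h1 : \forall k \near \oo, L2norm (fun x => F x - Fk k x) < e.
  apply: (L2norm_dominated (h := vsqnorm F)) => //.
  - by move=> k j; rewrite FkE; apply: cmeasurableM => //; exact: L2C_measurable.
  - apply: aeW => x j; apply: cvg_near_cst; apply: filterS (near1 x) => k [ck _].
    by rewrite mxE ck mul1r subrr sqnorm0.
  - exact: L2_vsqnorm.
  - move=> k x j; rewrite mxE -[X in X - _]mul1r -mulrBl sqnormM.
    apply: le_trans (sqnorm_le_vsqnorm F x j); rewrite ler_piMl ?sqnorm_ge0//.
    have -> : (1 - (cutoff k x)%:C : R[i]) = (1 - cutoff k x)%:C by rewrite rmorphB.
    by rewrite sqnorm_real; have /andP[? ?] := c01 k x; rewrite exprn_ile1 ?subr_ge0// lerBlDr lerDl.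
have h2 : \forall k \near \oo, L2norm (fun x => G x - Gk k x) < e.
  apply: (L2norm_dominated (h := fun x => 2 * vsqnorm G x + 2 * vsqnorm F x)) => //.
  - move=> k j; rewrite GkE; apply: cmeasurableD; apply: cmeasurableM => //; exact: L2C_measurable.
  - apply: aeW => x j; apply: cvg_near_cst; apply: filterS (near1 x) => k [ck dk].
    by rewrite !mxE ck dk mul1r mul0r addr0 subrr sqnorm0.
  - have := integrableD measurableT (integrableZl measurableT 2 (L2_vsqnorm hG)) (integrableZl measurableT 2 (L2_vsqnorm hF)).
    by [].
  - move=> k x j; rewrite !mxE opprD addrA -[X in X - _ - _]mul1r -mulrBl.
    apply: le_trans (sqnormD_le _ _) _; rewrite sqnormN !sqnormM.
    apply: lerD; rewrite ler_pM2l//.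
      apply: le_trans (sqnorm_le_vsqnorm G x j); rewrite ler_piMl ?sqnorm_ge0//.
      have -> : (1 - (cutoff k x)%:C : R[i]) = (1 - cutoff k x)%:C by rewrite rmorphB.
      by rewrite sqnorm_real; have /andP[? ?] := c01 k x; rewrite exprn_ile1 ?subr_ge0// lerBlDr lerDl.
    apply: le_trans (sqnorm_le_vsqnorm F x j); rewrite ler_piMl ?sqnorm_ge0//.
have [k [hk1 hk2]] : exists k, L2norm (fun x => F x - Fk k x) < e /\ L2norm (fun x => G x - Gk k x) < e.
  by apply: (@filter_ex _ \oo); apply: filterS2 h1 h2 => k.
exists (Fk k, Gk k); split; [exact: TFk|exact: hk1|exact: hk2].
Qed.

End DerivativeClosure.

(** * Adjoint and closure of d/dx *)

Section DerivativeAdjoint.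
Context {R : realType} {n : nat}.
Local Notation mu := (@lebesgue_measure R).
Implicit Types (F G H K U V : vfun R n).

Lemma cintegrableB (f g : R -> R[i]) : cintegrable f -> cintegrable g ->
  cintegrable (fun x => f x - g x).
Proof.
move=> [f1 f2] [g1 g2]; split.
  rewrite (_ : EFin \o _ = (EFin \o ReF f) \- (EFin \o ReF g))%E; first exact: integrableB.
  by apply/funext => x /=; rewrite /ReF ReD ReN EFinB.
rewrite (_ : EFin \o _ = (EFin \o ImF f) \- (EFin \o ImF g))%E; first exact: integrableB.
by apply/funext => x /=; rewrite /ImF ImD ImN EFinB.
Qed.

(** Over a segment containing the support of [P] the integral is the difference of two boundary
    values, both 0. The integrand [I] is a version of the derivative, as inner products see only
    classes. *)
Lemma cintegral_derivative (P P' I : R -> R[i]) : cprimitive P P' -> cintegrable I ->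
  {ae mu, forall x, I x = P' x} ->
  (exists N : nat, forall x, N%:R < `|x| -> P x = 0) -> cintegral I = 0.
Proof.
move=> [pR pI] [iR iI] IP [N hN].
have key (p p' i : R -> R) : primitive p p' -> mu.-integrable setT (EFin \o i) ->
    {ae mu, forall x, i x = p' x} -> (forall x, N%:R < `|x| -> p x = 0) -> (\int[mu]_x i x = 0)%R.
  move=> pp ii ip p0; apply: (Rintegral_exhaust ii); exists N.+1 => k Nk.
  have Nk' : N%:R < k%:R :> R by rewrite ltr_nat.
  rewrite (@ae_eq_Rintegral _ _ _ p')//.
  - rewrite -pp.2; last by rewrite ge0_cp// ?oppr_le0.
    by rewrite !p0 ?subrr// ?normrN normr_nat.
  - by apply: measurable_funTS; case/integrableP : ii => /measurable_EFinP.
  - by apply: measurable_funTS; case: pp => -[].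
  - by apply: ae_imp ip => x.
apply: complex_ext => /=.
  apply: (key _ _ _ pR iR); first by apply: ae_imp IP => x; rewrite /ReF => ->.
  by move=> x /hN; rewrite /ReF => ->.
apply: (key _ _ _ pI iI); first by apply: ae_imp IP => x; rewrite /ImF => ->.
by move=> x /hN; rewrite /ImF => ->.
Qed.

Lemma innerNr F G : L2 F -> L2 G -> inner F (fun x => - G x) = - inner F G.
Proof.
move=> hF hG; have h0 : inner F (fun x => G x - G x) = 0 by rewrite innerBr// subrr.
have := innerBr hF (L2B hG hG) hG; rewrite h0 sub0r => <-.
by congr inner; apply/funext => x; rewrite subrr sub0r.
Qed.

(** Integration by parts: the pointwise inner product of the representatives is a primitive, and its
    compact support comes from the second factor alone. *)
Lemma adjoint_ddx_min_sub G H : ddx_max (G, fun x => - H x) -> adjoint ddx_min (G, H).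
Proof.
move=> [/= hG hNH [U [U' [pU /ae_eqP GU /ae_eqP HU]]]].
have hH : L2 H by have := L2N hNH; congr L2; apply/funext => x; rewrite opprK.
split => //= F K [/= hF hK [V [V' [pV /ae_eqP FV /ae_eqP KV /compact_supportP[N hN]]]]].
apply/eqP; rewrite -subr_eq0 !innerE -cintegralB; try exact: inner_cintegrable.
apply/eqP; have pP : cprimitive (fun x => \sum_j Num.conj (U x j 0) * V x j 0)
    (fun x => \sum_j (Num.conj (U' x j 0) * V x j 0 + Num.conj (U x j 0) * V' x j 0)).
  by apply: cprimitive_sum => j; exact: cprimitiveM (cprimitive_conj (pU j)) (pV j).
apply: (cintegral_derivative pP).
- by apply: cintegrableB; exact: inner_cintegrable.
- apply: (ae_imp2 (P1 := fun x => G x = U x /\ - H x = U' x) (P2 := fun x => F x = V x /\ K x = V' x)).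
  + move=> x [-> <-] [-> ->]; rewrite -sumrB; apply: eq_bigr => j _.
    by rewrite !mxE rmorphN mulNr addrC.
  + by apply: (ae_imp2 _ GU HU).
  + by apply: (ae_imp2 _ FV KV).
- by exists N => x /hN ->; rewrite big1// => j _; rewrite mxE mulr0.
Qed.

Lemma adjoint_ddx_min_sup G H : adjoint ddx_min (G, H) -> ddx_max (G, fun x => - H x).
Proof.
move=> [/= hG hH test].
(* [A 1] is the real part and [A 'i] the imaginary part. Pairing with the vector whose only nonzero
   coordinate is [a * c], with [c] real, isolates one real function, to which [du_Bois_Reymond]
   applies. *)
pose A (a z : R[i]) := complex.Re (Num.conj z * a).
have tst (a : R[i]) j (c c' : R -> R) : primitive c c' -> c \in Lfun mu 2%:E -> c' \in Lfun mu 2%:E ->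
    (exists N : nat, forall x, N%:R < `|x| -> c x = 0) ->
    (\int[mu]_x (A a (G x j 0) * c' x) = \int[mu]_x (A a (H x j 0) * c x))%R.
  move=> pc c2 c2' [N cN].
  pose T (g : R -> R) : vfun R n := fun x => \col_k (if k == j then a * (g x)%:C else 0).
  have TL2 g : g \in Lfun mu 2%:E -> L2 (T g).
    move=> g2 k; rewrite (_ : (fun x => T g x k 0) = (if k == j then (fun x => a * (g x)%:C) else (fun=> 0))).
      case: ifP => _; last exact: L2C0.
      by apply: L2CZ; split => //=; have := @L2C0 R; case.
    by apply/funext => x; rewrite mxE; case: ifP.
  have Tc : ddx_min (T c, T c').
    split => /=; try exact: TL2.
    exists (T c), (T c'); split; [|exact: aeW|exact: aeW|].
      move=> k; rewrite (_ : (fun x => T c x k 0) = (if k == j then (fun x => a * (c x)%:C) else (fun=> 0))).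
        rewrite (_ : (fun x => T c' x k 0) = (if k == j then (fun x => a * (c' x)%:C) else (fun=> 0))).
          case: ifP => _; last exact: cprimitive_cst.
          by apply: cprimitiveZ; exact: cprimitive_real.
        by apply/funext => x; rewrite mxE; case: ifP.
      by apply/funext => x; rewrite mxE; case: ifP.
    apply/compact_supportP; exists N => x /cN cx; apply: cV_ext => k; rewrite !mxE.
    by case: ifP => // _; rewrite cx mulr0.
  have E (W : vfun R n) (g : R -> R) : complex.Re (inner W (T g)) = (\int[mu]_x (A a (W x j 0) * g x))%R.
    rewrite innerE /=; apply: eq_Rintegral => x _; rewrite /ReF (bigD1 j)//= big1 ?addr0.
      by rewrite mxE eqxx /A mulrA ReM /= mulr0 subr0.
    by move=> k kj; rewrite mxE (negbTE kj) mulr0.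
  by rewrite -!E (test _ _ Tc).
have A1 z : A 1 z = complex.Re z by rewrite /A mulr1 Re_conj.
have Ai z : A 'i%C z = complex.Im z by rewrite /A ReM Re_conj Im_conj /= mulr0 mulr1 sub0r opprK.
have exR j : exists u, primitive u (fun x => - ReF (fun x => H x j 0) x) /\
    {ae mu, forall x, ReF (fun x => G x j 0) x = u x}.
  have [gR _] := hG j; have [hR _] := hH j.
  have [|u] := du_Bois_Reymond gR hR; last by exists u.
  move=> c c' pc c2 c2' cN; have := tst 1 j c c' pc c2 c2' cN.
  by under eq_Rintegral do rewrite A1; under [X in _ = X -> _]eq_Rintegral do rewrite A1.
have exI j : exists u, primitive u (fun x => - ImF (fun x => H x j 0) x) /\
    {ae mu, forall x, ImF (fun x => G x j 0) x = u x}.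
  have [_ gI] := hG j; have [_ hI] := hH j.
  have [|u] := du_Bois_Reymond gI hI; last by exists u.
  move=> c c' pc c2 c2' cN; have := tst 'i%C j c c' pc c2 c2' cN.
  by under eq_Rintegral do rewrite Ai; under [X in _ = X -> _]eq_Rintegral do rewrite Ai.
have [uR uRP] := choice exR; have [uI uIP] := choice exI.
split => //=; first exact: L2N.
exists (fun x => \col_j (uR j x +i* uI j x)), (fun x => - H x); split; last exact: aeW.
- move=> j; split.
    have := (uRP j).1; congr primitive; apply/funext => x; rewrite /ReF mxE//.
    by rewrite ReN.
  have := (uIP j).1; congr primitive; apply/funext => x; rewrite /ImF mxE//.
  by rewrite ImN.
- apply/ae_eqP; have : {ae mu, forall x, forall j, G x j 0 = uR j x +i* uI j x}.
    apply: ae_forall_ord => j; apply: (ae_imp2 _ (uRP j).2 (uIP j).2) => x hR hI.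
    by apply: complex_ext.
  by apply: ae_imp => x h; apply: cV_ext => j; rewrite mxE.
Qed.

Lemma adjoint_ddx_minP G H : adjoint ddx_min (G, H) <-> ddx_max (G, fun x => - H x).
Proof. by split; [exact: adjoint_ddx_min_sup|exact: adjoint_ddx_min_sub]. Qed.

(** Enlarging the operator shrinks the adjoint; conversely an adjoint relation tested on [ddx_min]
    extends to its closure, which contains [ddx_max]. *)
Lemma adjoint_ddx_maxP G H : adjoint ddx_max (G, H) <-> ddx_max (G, fun x => - H x).
Proof.
split=> [[/= hG hH h]|/adjoint_ddx_minP h].
  by apply/adjoint_ddx_minP; split => // F K /ddx_min_max; exact: h.
have [/= hG hH _] := h; split => //= F K FK.
apply: (adjoint_op_closure _ h (ddx_max_closure_min FK)).
by move=> F' K' [].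
Qed.

(** The inclusion into [ddx_max] goes through adjoints. Each [(F', K)] of the minimal operator gives
    [(F', - K)] in its adjoint, and this relation persists against any [(F, G)] of the closure;
    exchanging the arguments, [(F, - G)] lies in the adjoint, which by [adjoint_ddx_minP] puts
    [(F, G)] in [ddx_max]. *)
Lemma op_closure_ddx_min : op_closure (@ddx_min R n) = ddx_max.
Proof.
apply/seteqP; split; last exact: ddx_max_closure_min.
move=> [F G] FG; have [/= hF hG _] := FG.
suff : ddx_max (F, fun x => - - G x).
  by congr ddx_max; congr pair; apply/funext => x; rewrite opprK.
apply/adjoint_ddx_minP; split => //=; first exact: L2N.
move=> F' K FK; have [/= hF' hK _] := FK.
have adj : adjoint ddx_min (F', fun x => - K x).
  apply/adjoint_ddx_minP; have := ddx_min_max FK.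
  by congr ddx_max; congr pair; apply/funext => x; rewrite opprK.
have h := adjoint_op_closure (fun F K (h : ddx_min (F, K)) => let: And3 a b _ := h in conj a b) adj FG.
have hNK := L2N hK; have hNG := L2N hG.
rewrite (innerC hF' hNG) innerNr// [inner F' G]h (innerC hF hNK) innerNr//.
by rewrite rmorphN !rmorphN /= conjCK opprK.
Qed.

End DerivativeAdjoint.

(** * The fundamental matrix of the Dirac system *)

Section MatrixPrimitive.
Context {R : realType}.
Local Notation mu := (@lebesgue_measure R).

Definition mprimitive p q (M M' : R -> 'M[R[i]]_(p, q)) :=
  forall j k, cprimitive (fun x => M x j k) (fun x => M' x j k).

Lemma mprimitiveM p q r (M M' : R -> 'M[R[i]]_(p, q)) (N N' : R -> 'M[R[i]]_(q, r)) :
  mprimitive M M' -> mprimitive N N' ->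
  mprimitive (fun x => M x *m N x) (fun x => M' x *m N x + M x *m N' x).
Proof.
move=> hM hN j k.
have := cprimitive_sum (index_enum 'I_q) (fun l => cprimitiveM (hM j l) (hN l k)).
by congr cprimitive; apply/funext => x; rewrite !mxE// -big_split.
Qed.

Lemma mprimitive_cst p q (A : 'M[R[i]]_(p, q)) : mprimitive (fun=> A) (fun=> 0).
Proof.
move=> j k; have := cprimitive_cst (A j k).
by congr cprimitive; apply/funext => x; rewrite mxE.
Qed.

Lemma mprimitive_tr p q (M M' : R -> 'M[R[i]]_(p, q)) :
  mprimitive M M' -> mprimitive (fun x => (M x)^T) (fun x => (M' x)^T).
Proof.
by move=> hM j k; have := hM k j; congr cprimitive; apply/funext => x; rewrite mxE.
Qed.

Lemma mprimitive_conj p q (M M' : R -> 'M[R[i]]_(p, q)) : mprimitive M M' ->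
  mprimitive (fun x => map_mx Num.conj (M x)) (fun x => map_mx Num.conj (M' x)).
Proof.
move=> hM j k; have := cprimitive_conj (hM j k).
by congr cprimitive; apply/funext => x; rewrite mxE.
Qed.

Lemma mprimitive_eq_cst p q (M M' : R -> 'M[R[i]]_(p, q)) x : mprimitive M M' ->
  {ae mu, forall y, M' y = 0} -> M x = M 0.
Proof.
have key (f g : R -> R) : primitive f g -> {ae mu, forall y, g y = 0} -> f x = f 0.
  move=> fg g0; have f0 : primitive f (fun=> 0).
    by apply: primitive_ae g0 fg; exact: measurable_cst.
  have [x0|/ltW x0] := leP x 0; apply/eqP; rewrite -subr_eq0.
    by rewrite -oppr_eq0 opprB f0.2// Rintegral_cst// mul0r.
  by rewrite f0.2// Rintegral_cst// mul0r.
move=> hM M0; apply/matrixP => j k; have [hR hI] := hM j k.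
apply: complex_ext.
  by apply: (key _ _ hR); apply: ae_imp M0 => y; rewrite /ReF => ->; rewrite mxE.
by apply: (key _ _ hI); apply: ae_imp M0 => y; rewrite /ImF => ->; rewrite mxE.
Qed.

(** Realification: [B + iC] acts on pairs of real vectors as the block matrix with rows [B, - C] and
    [C, B]. The first [n] columns of the real fundamental matrix are the real and imaginary parts of
    the complex one. *)
Lemma linear_ode_exists_complex n (A : R -> 'M[R[i]]_n) :
  (forall j k, L1locC (fun x => A x j k)) ->
  exists Y, Y 0 = 1%:M /\ mprimitive Y (fun x => A x *m Y x).
Proof.
move=> lA.
pose AR x : 'M[R]_(n + n) := block_mx
  (map_mx (@complex.Re R) (A x)) (- map_mx (@complex.Im R) (A x))
  (map_mx (@complex.Im R) (A x)) (map_mx (@complex.Re R) (A x)).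
have lAR j k : locally_integrable setT (fun x => AR x j k).
  case: (split_ordP j) => j' ->; case: (split_ordP k) => k' ->.
  - by have := (lA j' k').1; congr locally_integrable; apply/funext => x; rewrite block_mxEul mxE.
  - have := locally_integrableZ (-1) (lA j' k').2; congr locally_integrable.
    by apply/funext => x; rewrite block_mxEur !mxE mulN1r.
  - by have := (lA j' k').2; congr locally_integrable; apply/funext => x; rewrite block_mxEdl mxE.
  - by have := (lA j' k').1; congr locally_integrable; apply/funext => x; rewrite block_mxEdr mxE.
have [Y [Y0 pY]] := linear_ode_exists lAR.
exists (fun x => \matrix_(j, k) (Y x (lshift n j) (lshift n k) +i* Y x (rshift n j) (lshift n k))).
split=> [|j k].
  apply/matrixP => j k; rewrite !mxE Y0 !mxE eq_lshift eq_rlshift /=.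
  by case: eqP.
split.
  have := pY (lshift n j) (lshift n k); congr primitive; apply/funext => x; rewrite /ReF !mxE//.
  rewrite big_split_ord /= Re_sum -big_split; apply: eq_bigr => l _.
  by rewrite /AR block_mxEul block_mxEur !mxE ReM mulNr.
have := pY (rshift n j) (lshift n k); congr primitive; apply/funext => x; rewrite /ImF !mxE//.
rewrite big_split_ord /= Im_sum -big_split; apply: eq_bigr => l _.
by rewrite /AR block_mxEdl block_mxEdr !mxE ImM addrC.
Qed.

End MatrixPrimitive.

(** * Unitary and symplectic invariance of the fundamental matrix *)

Section DiracFundamental.
Context {R : realType} {m : nat}.
Local Notation mu := (@lebesgue_measure R).
Implicit Type q : 'M[R[i]]_m.

Definition sigma3 : 'M[R[i]]_(m + m) := block_mx 1%:M 0 0 (- 1%:M).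

(* sigma1 *m sigma3 *)
Definition sigma13 : 'M[R[i]]_(m + m) := block_mx 0 (- 1%:M) 1%:M 0.

Definition potential q : 'M[R[i]]_(m + m) := block_mx 0 (- q) (- q^t*) 0.

(* M(Q) F = 'i *: sigma3 *m (F' - dirac_coef Q *m F) *)
Definition dirac_coef q : 'M[R[i]]_(m + m) := block_mx 0 q (- q^t*) 0.

Ltac block_simpl := rewrite ?(mulmx_block, mul0mx, mulmx0, mul1mx, mulmx1,
  addr0, add0r, mulNmx, mulmxN, opprK, oppr0).

Lemma sigma3_sqr : sigma3 *m sigma3 = 1%:M.
Proof. by rewrite /sigma3; block_simpl; rewrite -scalar_mx_block. Qed.

Lemma sigma1_sqr : sigma1 *m sigma1 = 1%:M :> 'M[R[i]]_(m + m).
Proof. by rewrite /sigma1; block_simpl; rewrite -scalar_mx_block. Qed.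

Lemma sigma13_sqr : sigma13 *m sigma13 = - 1%:M.
Proof. by rewrite /sigma13; block_simpl; rewrite (@scalar_mx_block _ m m 1) opp_block_mx oppr0. Qed.

Lemma sigma3M_sigma1 : sigma3 *m sigma1 = - sigma13.
Proof. by rewrite /sigma3 /sigma1 /sigma13; block_simpl; rewrite opp_block_mx !opprK oppr0. Qed.

Lemma sigma13M_sigma3 : sigma13 *m sigma3 = sigma1.
Proof. by rewrite /sigma3 /sigma1 /sigma13; block_simpl. Qed.

Lemma sigma3_adj : sigma3^t* = sigma3.
Proof.
rewrite /sigma3 tr_block_mx map_block_mx !trmx0 !map_mx0 linearN /= trmx1.
by rewrite map_mxN !map_mx1.
Qed.

Lemma sigma13_conj : map_mx Num.conj sigma13 = sigma13.
Proof. by rewrite /sigma13 map_block_mx !map_mx0 map_mxN map_mx1. Qed.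

Lemma sigma3M_dirac_coef q : sigma3 *m dirac_coef q = - potential q.
Proof. by rewrite /sigma3 /dirac_coef /potential; block_simpl; rewrite opp_block_mx !opprK oppr0. Qed.

Lemma dirac_coef_adj q : (dirac_coef q)^t* = - dirac_coef q.
Proof.
rewrite /dirac_coef tr_block_mx map_block_mx opp_block_mx !trmx0 !map_mx0 oppr0 opprK.
by rewrite linearN /= map_mxN trmxCK.
Qed.

(** The diagonal blocks of the sum are [q^* - conj q] and [q - q^T]. The identity places
    [dirac_coef q] in the Lie algebra of the complex symplectic group of the form [sigma13]. *)
Lemma dirac_coef_sym q : q = q^T ->
  (dirac_coef q)^T *m sigma13 + sigma13 *m dirac_coef q = 0.
Proof.
move=> qs; rewrite /dirac_coef /sigma13 tr_block_mx; block_simpl; rewrite add_block_mx !addr0.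
rewrite -qs addNr linearN /= map_trmx -qs addNr !trmx0 oppr0.
by apply/matrixP => j k; case: (split_ordP j) => j' ->; case: (split_ordP k) => k' ->;
  rewrite ?(block_mxEul, block_mxEur, block_mxEdl, block_mxEdr) !mxE.
Qed.

(** Both products have derivative 0 almost everywhere and keep their value at 0, where [Phi] is the
    identity. So [Phi] takes its values in the compact symplectic group, the intersection of U(2m)
    and Sp(2m, C). *)
Lemma dirac_fundamental (Q : R -> 'M[R[i]]_m) :
  (forall j k, L1locC (fun x => Q x j k)) -> {ae mu, forall x, Q x = (Q x)^T} ->
  exists Phi, [/\ mprimitive Phi (fun x => dirac_coef (Q x) *m Phi x),
    forall x, (Phi x)^t* *m Phi x = 1%:M &
    forall x, (Phi x)^T *m sigma13 *m Phi x = sigma13].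
Proof.
move=> lQ sQ.
have lN (f : R -> R) : locally_integrable setT f -> locally_integrable setT (fun x => - f x).
  by move=> /(locally_integrableZ (-1)); congr locally_integrable; apply/funext => x; rewrite mulN1r.
have lA j k : L1locC (fun x => dirac_coef (Q x) j k).
  have l0 : L1locC (fun=> 0 : R[i]).
    by have := cprimitive_cst (0 : R[i]); move=> [[h1 _] [h2 _]]; split.
  case: (split_ordP j) => j' ->; case: (split_ordP k) => k' ->.
  - by rewrite (_ : (fun x => _) = (fun=> 0))//; apply/funext => x; rewrite block_mxEul mxE.
  - by have := lQ j' k'; congr L1locC; apply/funext => x; rewrite block_mxEur.
  - rewrite (_ : (fun x => _) = (fun x => - Num.conj (Q x k' j'))).
      have [h1 h2] := lQ k' j'; split.
        have := lN _ h1; congr locally_integrable; apply/funext => x.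
        by rewrite /ReF ReN Re_conj.
      by have := h2; congr locally_integrable; apply/funext => x; rewrite /ImF ImN Im_conj opprK.
    by apply/funext => x; rewrite block_mxEdl !mxE.
  - by rewrite (_ : (fun x => _) = (fun=> 0))//; apply/funext => x; rewrite block_mxEdr mxE.
have [Y [Y0 pY]] := linear_ode_exists_complex lA.
exists Y; split=> // x.
  rewrite (mprimitive_eq_cst x (mprimitiveM (mprimitive_conj (mprimitive_tr pY)) pY)).
    by rewrite Y0 trmx1 map_mx1 mulmx1.
  apply: aeW => y; rewrite trmx_mul map_mxM dirac_coef_adj mulmxN mulNmx mulmxA.
  by rewrite addNr.
rewrite (mprimitive_eq_cst x (mprimitiveM (mprimitiveM (mprimitive_tr pY) (mprimitive_cst sigma13)) pY)).
  by rewrite Y0 trmx1 mulmx1 mul1mx.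
apply: ae_imp sQ => y /dirac_coef_sym h.
rewrite mulmx0 addr0 trmx_mul -!mulmxA -mulmxDr [sigma13 *m (_ *m _)]mulmxA [_^T *m (_ *m _)]mulmxA.
by rewrite -mulmxDl h mul0mx mulmx0.
Qed.

End DiracFundamental.

(** * Reduction of the Dirac operator to d/dx *)

Section UnitaryTransfer.
Context {R : realType} {n : nat}.
Local Notation mu := (@lebesgue_measure R).
Implicit Types (F G H K : vfun R n) (W V : R -> 'M[R[i]]_n) (T : graph R n).

Definition unitary_field W :=
  (forall j k, cmeasurable (fun x => W x j k)) /\ forall x, (W x)^t* *m W x = 1%:M.

Definition field_app W F : vfun R n := fun x => W x *m F x.

Definition field_adj W := fun x => (W x)^t*.

(* V^* T W, whose domain consists of the F such that W F is in the domain of T *)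
Definition transfer W V T : graph R n :=
  [set FG | T (field_app W FG.1, field_app V FG.2)].

Lemma unitary_field_adj W : unitary_field W -> unitary_field (field_adj W).
Proof.
move=> [mW uW]; split=> [j k|x]; last by rewrite /field_adj trmxCK; apply: mulmx1C.
have := cmeasurable_conj (mW k j); congr cmeasurable; apply/funext => x.
by rewrite !mxE.
Qed.

Lemma field_adjK W : field_adj (field_adj W) = W.
Proof. by apply/funext => x; rewrite /field_adj trmxCK. Qed.

Lemma field_appK W : unitary_field W -> cancel (field_app W) (field_app (field_adj W)).
Proof. by move=> [_ uW] F; apply/funext => x; rewrite /field_app mulmxA uW mul1mx. Qed.

Lemma field_appVK W : unitary_field W -> cancel (field_app (field_adj W)) (field_app W).
Proof. by move=> /unitary_field_adj/field_appK; rewrite field_adjK. Qed.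

Lemma field_appB W F G : field_app W (fun x => F x - G x) =
  (fun x => field_app W F x - field_app W G x).
Proof. by apply/funext => x; rewrite /field_app mulmxBr. Qed.

Lemma L2_field_app W F : unitary_field W -> L2 F -> L2 (field_app W F).
Proof.
move=> [mW uW] hF j; rewrite (_ : (fun x => _) = (fun x => \sum_l W x j l * F x l 0)).
  apply: L2C_sum => l; apply: (@L2C_bddM _ _ _ 1) => // x.
  (* The columns of a unitary matrix have norm 1, so every entry has squared modulus at most 1. *)
  have /matrixP/(_ l l) := uW x; rewrite !mxE eqxx => /(congr1 (@complex.Re R)) /=.
  rewrite Re_sum (bigD1 j)//= => <-; rewrite !mxE ReM Re_conj Im_conj /sqnorm.
  rewrite mulNr opprK -!expr2 lerDl sumr_ge0// => k _.
  by rewrite !mxE ReM Re_conj Im_conj mulNr opprK -!expr2 addr_ge0// sqr_ge0.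
by apply/funext => x; rewrite mxE.
Qed.

Lemma L2_field_appE W F : unitary_field W -> L2 (field_app W F) <-> L2 F.
Proof.
move=> uW; split; last exact: L2_field_app.
by move=> /(L2_field_app (unitary_field_adj uW)); rewrite field_appK.
Qed.

Lemma inner_field_app W F G : unitary_field W ->
  inner (field_app W F) (field_app W G) = inner F G.
Proof.
move=> [_ uW]; rewrite /inner; congr cintegral; apply/funext => x.
by rewrite /field_app trmx_mul map_mxM -mulmxA [X in _ *m X]mulmxA uW mul1mx.
Qed.

Lemma inner_field_adj W F G : unitary_field W ->
  inner (field_app W F) G = inner F (field_app (field_adj W) G).
Proof. by move=> uW; rewrite -(inner_field_app F (field_app _ G) uW) field_appVK. Qed.

Lemma L2norm_field_app W F : unitary_field W -> L2norm (field_app W F) = L2norm F.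
Proof. by move=> uW; rewrite /L2norm inner_field_app. Qed.

Lemma field_app_ae W F G : F = G %[ae mu] -> field_app W F = field_app W G %[ae mu].
Proof. by move=> /ae_eqP FG; apply/ae_eqP; apply: ae_imp FG => x; rewrite /field_app => ->. Qed.

Lemma field_app_lin W (c : R[i]) F G : field_app W (fun x => c *: F x + G x) =
  (fun x => c *: field_app W F x + field_app W G x).
Proof. by apply/funext => x; rewrite /field_app mulmxDr -scalemxAr. Qed.

Lemma field_app0 W : field_app W 0 = 0.
Proof. by apply/funext => x; rewrite /field_app mulmx0. Qed.

Lemma linear_transfer W V T : unitary_field W -> unitary_field V ->
  linear_operator T -> linear_operator (transfer W V T).
Proof.
move=> uW uV [h1 h2 h3 h4 h5]; split.
- by move=> F G /h1 /= [] /(L2_field_appE _ uW) ? /(L2_field_appE _ uV).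
- move=> F F' G G' /h2 h hF hG FF' GG'; apply: h => //=.
  + exact: L2_field_app.
  + exact: L2_field_app.
  + exact: field_app_ae.
  + exact: field_app_ae.
- by rewrite /transfer /= !field_app0.
- by move=> c F F' G G' t t'; rewrite /transfer /= !field_app_lin; exact: h4.
- move=> F G K t t'; have /(@field_app_ae (field_adj V)) := h5 _ _ _ t t'.
  by rewrite !field_appK.
Qed.

Lemma transferV W V T F G : unitary_field W -> unitary_field V -> T (F, G) ->
  transfer W V T (field_app (field_adj W) F, field_app (field_adj V) G).
Proof. by move=> uW uV; rewrite /transfer /= !field_appVK. Qed.

Lemma dense_transfer W V T : unitary_field W -> unitary_field V ->
  densely_defined T -> densely_defined (transfer W V T).
Proof.
move=> uW uV dT F hF e e0.
have [F' [G' TF'] FF'] := dT _ (L2_field_app uW hF) _ e0.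
exists (field_app (field_adj W) F').
  by exists (field_app (field_adj V) G'); exact: transferV.
by rewrite -(L2norm_field_app _ uW) field_appB field_appVK.
Qed.

Lemma op_closure_transfer W V T : unitary_field W -> unitary_field V ->
  op_closure (transfer W V T) = transfer W V (op_closure T).
Proof.
move=> uW uV; apply/seteqP; split=> -[F G] [/= hF hG h].
  split=> /=; [exact: L2_field_app|exact: L2_field_app|move=> e e0].
  have [[F' G'] /= [t FF' GG']] := h _ e0.
  exists (field_app W F', field_app V G') => /=.
  by rewrite -!field_appB !L2norm_field_app.
split=> /=; [exact/(L2_field_appE _ uW)|exact/(L2_field_appE _ uV)|move=> e e0].
have [[F' G'] /= [t FF' GG']] := h _ e0.
exists (field_app (field_adj W) F', field_app (field_adj V) G') => /=; split.
- exact: transferV.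
- by rewrite -(L2norm_field_app _ uW) field_appB field_appVK.
- by rewrite -(L2norm_field_app _ uV) field_appB field_appVK.
Qed.

(** The two fields trade places, as in (V^* T W)^* = W^* T^* V; domains match because a unitary
    field acts bijectively on L2. *)
Lemma adjoint_transfer W V T : unitary_field W -> unitary_field V ->
  adjoint (transfer W V T) = transfer V W (adjoint T).
Proof.
move=> uW uV; apply/seteqP; split=> -[G H] [/= hG hH h].
  split=> /=; [exact: L2_field_app|exact: L2_field_app|move=> F K FK].
  rewrite (inner_field_adj _ _ uV) (inner_field_adj _ _ uW).
  exact: h (transferV uW uV FK).
split=> /=; [exact/(L2_field_appE _ uV)|exact/(L2_field_appE _ uW)|move=> F K /h].
by rewrite /= !inner_field_app.
Qed.

End UnitaryTransfer.

(** * The Dirac operator and its conjugation in the unitary picture *)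

Section DiracTransfer.
Context {R : realType} {m : nat}.
Local Notation mu := (@lebesgue_measure R).
Context (Q : R -> 'M[R[i]]_m) (Phi : R -> 'M[R[i]]_(m + m)).
Context (Phi_primitive : mprimitive Phi (fun x => dirac_coef (Q x) *m Phi x))
  (Phi_unitary : forall x, (Phi x)^t* *m Phi x = 1%:M)
  (Phi_symmetry : forall x, (Phi x)^T *m sigma13 *m Phi x = sigma13).
Implicit Types (F G U V : vfun R (m + m)).

(* M(Q) (Phi c) = Phi_rhs c' *)
Definition Phi_rhs x : 'M[R[i]]_(m + m) := 'i *: (sigma3 *m Phi x).

(** With these adjoints, [transfer W W'] turns [T] into [Phi_rhs] T Phi^*, matching M(Q) = [Phi_rhs]
    (d/dx) Phi^*. *)
Let W := field_adj Phi.
Let W' := field_adj Phi_rhs.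

Lemma conj_i : Num.conj 'i = - 'i :> R[i].
Proof. by apply: complex_ext; rewrite /= ?oppr0. Qed.

Lemma i_sqr : 'i * 'i = -1 :> R[i].
Proof. by apply: complex_ext; rewrite /=; ring. Qed.

Lemma map_conjK p q (M : 'M[R[i]]_(p, q)) : map_mx Num.conj (map_mx Num.conj M) = M.
Proof. by apply/matrixP => j k; rewrite !mxE conjCK. Qed.

Lemma unitary_Phi : unitary_field Phi.
Proof. by split=> // j k; exact: (cprimitive_measurable (Phi_primitive j k)).1. Qed.

Lemma Phi_rhs_adj x : (Phi_rhs x)^t* = - 'i *: ((Phi x)^t* *m sigma3).
Proof.
rewrite /Phi_rhs linearZ /= trmx_mul map_mxZ map_mxM sigma3_adj [X in X *: _]conj_i.
by [].

Qed.

Lemma unitary_Phi_rhs : unitary_field Phi_rhs.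
Proof.
split=> [j k|x].
  have := cprimitiveZ 'i%C (mprimitiveM (mprimitive_cst sigma3) Phi_primitive j k).
  move=> /cprimitive_measurable[+ _]; congr cmeasurable; apply/funext => x.
  by rewrite !mxE.
rewrite Phi_rhs_adj -scalemxAl -scalemxAr scalerA mulNr i_sqr opprK scale1r.
by rewrite -mulmxA [sigma3 *m (_ *m _)]mulmxA sigma3_sqr mul1mx.
Qed.

Let uW : unitary_field W. Proof. exact: unitary_field_adj unitary_Phi. Qed.
Let uW' : unitary_field W'. Proof. exact: unitary_field_adj unitary_Phi_rhs. Qed.

Lemma vprimitive_field_app M M' U U' : mprimitive M M' -> vprimitive U U' ->
  vprimitive (field_app M U) (fun x => M' x *m U x + M x *m U' x).
Proof.
move=> hM hU j; apply: (mprimitiveM hM (N := U) (N' := U')) => l k.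
by have := hU l; rewrite ord1.
Qed.

Lemma AC_locV_vprimitive U : AC_locV U -> exists U', vprimitive U U'.
Proof.
move=> acU; have /choice[u hu] := fun j => AC_loc_cprimitive (acU j).
exists (fun x => \col_j u j x) => j; have := hu j; congr cprimitive.
by apply/funext => x; rewrite mxE.
Qed.

Lemma vprimitive_MQ U U' : vprimitive U U' -> {ae mu, forall x,
  MQ Q U x = 'i *: (sigma3 *m U' x + potential (Q x) *m U x)}.
Proof.
move=> hU; have : {ae mu, forall x, forall j, cderive (fun y => U y j 0) x = U' x j 0}.
  by apply: ae_forall_ord => j; exact: cprimitive_derive.
apply: ae_imp => x h; rewrite /MQ; congr (_ *: (_ *m _ + _)).
by apply: cV_ext => j; rewrite mxE.
Qed.

(** As A = [dirac_coef Q] is skew-Hermitian, the derivative of Phi^* U is Phi^* applied to U' - A U.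
    The adjoint of [Phi_rhs] sends M(Q) U to the same vector, since [sigma3] squares to 1 and
    carries A to minus the potential. *)
Lemma MQ_transfer U : AC_locV U -> exists V',
  vprimitive (field_app W U) V' /\ {ae mu, forall x, field_app W' (MQ Q U) x = V' x}.
Proof.
move=> /AC_locV_vprimitive[U' hU]; eexists; split.
  exact: vprimitive_field_app (mprimitive_conj (mprimitive_tr Phi_primitive)) hU.
apply: ae_imp (vprimitive_MQ hU) => x MQE.
rewrite /field_app MQE /W' /field_adj Phi_rhs_adj -scalemxAl -scalemxAr scalerA mulNr i_sqr opprK scale1r.
rewrite trmx_mul map_mxM dirac_coef_adj -!mulmxA -mulmxDr; congr (_ *m _).
rewrite mulmxDr !mulmxA sigma3_sqr mul1mx addrC; congr (_ *m _ + _).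
by rewrite -[potential _]opprK -sigma3M_dirac_coef mulmxN mulmxA sigma3_sqr mul1mx.
Qed.

Lemma transfer_MQ V V' : vprimitive V V' -> AC_locV (field_app Phi V) /\
  {ae mu, forall x, MQ Q (field_app Phi V) x = field_app Phi_rhs V' x}.
Proof.
move=> hV; have hU := vprimitive_field_app Phi_primitive hV; split.
  by move=> j; exact: cprimitive_AC_loc (hU j).
apply: ae_imp (vprimitive_MQ hU) => x ->; rewrite /field_app /Phi_rhs -scalemxAl; congr (_ *: _).
rewrite mulmxDr !mulmxA sigma3M_dirac_coef !mulNmx addrAC addNr add0r.
by [].
Qed.

Lemma Dmax_transfer : Dmax Q = transfer W W' ddx_max.
Proof.
apply/seteqP; split=> -[F G] /= [/= hF hG].
  move=> [U [/MQ_transfer[V' [hV VE]] FU /ae_eqP GU]].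
  split=> /=; [exact: L2_field_app|exact: L2_field_app|].
  exists (field_app W U), V'; split => //; first exact: field_app_ae.
  by apply/ae_eqP; apply: (ae_imp2 _ GU VE) => x; rewrite /field_app => ->.
move=> [V [V' [hV FV GV]]]; have [acU UE] := transfer_MQ hV.
split=> /=; [exact/(L2_field_appE _ uW)|exact/(L2_field_appE _ uW')|].
exists (field_app Phi V); split => //.
  by have := field_app_ae Phi FV; rewrite field_appVK//; exact: unitary_Phi.
have := field_app_ae Phi_rhs GV; rewrite field_appVK; last exact: unitary_Phi_rhs.
by move=> /ae_eqP GE; apply/ae_eqP; apply: (ae_imp2 _ GE UE) => x -> ->.
Qed.

Lemma field_app_support M U : unitary_field M ->
  [set x | field_app M U x != 0] = [set x | U x != 0].
Proof.
move=> uM; apply/seteqP; split=> x /=; apply: contraNN => /eqP h; apply/eqP.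
  by rewrite /field_app h mulmx0.
by rewrite -(field_appK uM U) /field_app -/(field_app M U x) h mulmx0.
Qed.

Lemma Dmin_transfer : Dmin Q = transfer W W' ddx_min.
Proof.
apply/seteqP; split=> -[F G] /= [/= hF hG].
  move=> [U [/MQ_transfer[V' [hV VE]] FU /ae_eqP GU cU]].
  split=> /=; [exact: L2_field_app|exact: L2_field_app|].
  exists (field_app W U), V'; split => //; first exact: field_app_ae.
    by apply/ae_eqP; apply: (ae_imp2 _ GU VE) => x; rewrite /field_app => ->.
  by rewrite field_app_support.
move=> [V [V' [hV FV GV cV]]]; have [acU UE] := transfer_MQ hV.
split=> /=; [exact/(L2_field_appE _ uW)|exact/(L2_field_appE _ uW')|].
exists (field_app Phi V); split => //.
- by have := field_app_ae Phi FV; rewrite field_appVK//; exact: unitary_Phi.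
- have := field_app_ae Phi_rhs GV; rewrite field_appVK; last exact: unitary_Phi_rhs.
  by move=> /ae_eqP GE; apply/ae_eqP; apply: (ae_imp2 _ GE UE) => x -> ->.
- by rewrite field_app_support//; exact: unitary_Phi.
Qed.

(** What [Jconj] becomes between the two unitary pictures ([transfer_Jconj], [transfer_JconjN]). Its
    coefficients are constant, so it commutes with d/dx; it squares to -1, whereas [Jconj] squares
    to 1. *)
Definition symplectic_conj F : vfun R (m + m) :=
  fun x => 'i *: (sigma13 *m map_mx Num.conj (F x)).

Lemma symplectic_conjK F : symplectic_conj (symplectic_conj F) = (fun x => - F x).
Proof.
apply/funext => x; rewrite /symplectic_conj map_mxZ map_mxM sigma13_conj [X in _ *m (X *: _)]conj_i map_conjK.
rewrite -scalemxAr scalerA mulrN i_sqr opprK scale1r mulmxA sigma13_sqr.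
by rewrite mulNmx mul1mx.
Qed.

Lemma L2_symplectic_conj F : L2 F -> L2 (symplectic_conj F).
Proof.
move=> hF j; rewrite (_ : (fun x => _) =
    (fun x => 'i * \sum_l sigma13 j l * Num.conj (F x l 0))).
  by apply: L2CZ; apply: L2C_sum => l; apply: L2CZ; exact: L2C_conj.
apply/funext => x; rewrite !mxE; congr (_ * _); apply: eq_bigr => l _.
by congr (_ * _); rewrite mxE.
Qed.

Lemma ddx_max_symplectic_conj F G : ddx_max (F, G) ->
  ddx_max (symplectic_conj F, symplectic_conj G).
Proof.
move=> [/= hF hG [U [U' [hU /ae_eqP FU /ae_eqP GU]]]].
split=> /=; [exact: L2_symplectic_conj|exact: L2_symplectic_conj|].
exists (symplectic_conj U), (symplectic_conj U'); split.
- move=> j; have := cprimitiveZ 'i%C (cprimitive_sum (index_enum _)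
    (fun l => cprimitiveZ (sigma13 j l) (cprimitive_conj (hU l)))).
  by congr cprimitive; apply/funext => x; rewrite !mxE//; congr (_ * _);
    apply: eq_bigr => l _; congr (_ * _); rewrite mxE.
- by apply/ae_eqP; apply: ae_imp FU => x; rewrite /symplectic_conj => ->.
- by apply/ae_eqP; apply: ae_imp GU => x; rewrite /symplectic_conj => ->.
Qed.

(** For the converse, a second application produces the negatives of [F] and [G], and linearity
    removes the sign. *)
Lemma ddx_max_symplectic_conjE F G :
  ddx_max (symplectic_conj F, symplectic_conj G) <-> ddx_max (F, G).
Proof.
split; last exact: ddx_max_symplectic_conj.
move=> /ddx_max_symplectic_conj; rewrite !symplectic_conjK => h.
have [_ _ h3 h4 _] := @linear_ddx_max R (m + m).
have := h4 (-1) _ _ _ _ h h3; congr ddx_max; congr pair; apply/funext => x;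
  by rewrite /= scaleN1r opprK addr0.
Qed.

(** Conjugate the symplectic identity and cancel the conjugate of [Phi], whose inverse is its
    transpose by unitarity. This is how the symmetry of [Q] reaches the conjugation. *)
Lemma Phi_adj_sigma13 x : (Phi x)^t* *m sigma13 = sigma13 *m (Phi x)^T.
Proof.
have /(congr1 (map_mx Num.conj)) := Phi_symmetry x.
rewrite !map_mxM sigma13_conj => h.
have h' : map_mx Num.conj (Phi x) *m (Phi x)^T = 1%:M.
  have /(congr1 (map_mx Num.conj)) := mulmx1C (Phi_unitary x).
  by rewrite map_mxM map_mx1 map_conjK.
by rewrite -[LHS]mulmx1 -h' mulmxA h.
Qed.

Lemma transfer_Jconj F : field_app W' (Jconj F) = symplectic_conj (field_app W F).
Proof.
apply/funext => x; rewrite /field_app /W' /W /field_adj /symplectic_conj /Jconj Phi_rhs_adj.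
rewrite -scalemxAl -mulmxA [sigma3 *m _]mulmxA sigma3M_sigma1 mulNmx mulmxN scalerN scaleNr opprK.
rewrite map_mxM map_conjK.
by rewrite mulmxA Phi_adj_sigma13 -mulmxA.
Qed.

(** The minus sign is the one that the adjoint of d/dx introduces in [adjoint_ddx_minP]; the two
    meet in [Dmax_op_conj]. *)
Lemma transfer_JconjN G : (fun x => - field_app W (Jconj G) x) = symplectic_conj (field_app W' G).
Proof.
apply/funext => x; rewrite /field_app /W' /W /field_adj /symplectic_conj /Jconj Phi_rhs_adj.
rewrite -scalemxAl map_mxZ !map_mxM rmorphN /= conj_i opprK map_conjK.
rewrite -scalemxAr scalerA i_sqr scaleN1r -(@sigma13M_sigma3 R m).
have -> : map_mx Num.conj sigma3 = sigma3 :> 'M[R[i]]_(m + m).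
  by rewrite /sigma3 map_block_mx !map_mx0 map_mxN map_mx1.
by rewrite -!mulmxA [X in - X = _]mulmxA Phi_adj_sigma13 -mulmxA.
Qed.

Lemma JconjK F : Jconj (Jconj F) = F.
Proof.
apply/funext => x; rewrite /Jconj map_mxM map_conjK.
rewrite mulmxA (_ : map_mx _ sigma1 = sigma1) ?sigma1_sqr ?mul1mx//.
by rewrite /sigma1 map_block_mx !map_mx0 map_mx1.
Qed.

Lemma op_conj_JconjE (S : graph R (m + m)) F G :
  op_conj Jconj S (F, G) <-> S (Jconj F, Jconj G).
Proof.
split=> [[K /= h ->]|h]; first by rewrite JconjK.
by exists (Jconj G); rewrite ?JconjK.
Qed.

(** An operator and its closure have the same adjoint; the fact is carried over from d/dx. *)
Lemma adjoint_DmaxE : adjoint (Dmax Q) = adjoint (Dmin Q).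
Proof.
rewrite Dmax_transfer Dmin_transfer !adjoint_transfer//; congr transfer.
by apply/seteqP; split=> -[F G]; [move=> /adjoint_ddx_maxP/adjoint_ddx_minP|move=> /adjoint_ddx_minP/adjoint_ddx_maxP].
Qed.

Lemma op_closure_DminE : op_closure (Dmin Q) = Dmax Q.
Proof. by rewrite Dmin_transfer op_closure_transfer// op_closure_ddx_min Dmax_transfer. Qed.

(** Taking the adjoint exchanges [W] and [W']. [Jconj] exchanges them back at the price of a
    [symplectic_conj] on both components, under which [ddx_max] is invariant. *)
Lemma Dmax_op_conj : Dmax Q = op_conj Jconj (adjoint (Dmin Q)).
Proof.
rewrite Dmax_transfer Dmin_transfer adjoint_transfer//.
have E F G : op_conj Jconj (transfer W' W (adjoint ddx_min)) (F, G) <->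
    transfer W W' ddx_max (F, G).
  rewrite op_conj_JconjE /transfer /= adjoint_ddx_minP transfer_JconjN transfer_Jconj.
  exact: ddx_max_symplectic_conjE.
by apply/seteqP; split=> -[F G]; case: (E F G).
Qed.

Lemma linear_Dmax : linear_operator (Dmax Q).
Proof. by rewrite Dmax_transfer; apply: linear_transfer => //; exact: linear_ddx_max. Qed.

Lemma linear_Dmin : linear_operator (Dmin Q).
Proof. by rewrite Dmin_transfer; apply: linear_transfer => //; exact: linear_ddx_min. Qed.

Lemma dense_Dmin : densely_defined (Dmin Q).
Proof. by rewrite Dmin_transfer; apply: dense_transfer => //; exact: ddx_min_dense. Qed.

Lemma J_selfadjoint_Dmax : J_selfadjoint (Dmax Q).
Proof.
split; [exact: linear_Dmax| |by rewrite adjoint_DmaxE Dmax_op_conj].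
move=> F hF e e0; have [F' [G FG] h] := dense_Dmin hF e0.
exists F' => //; exists G; have [h1 h2 [U [h3 h4 h5 _]]] := FG.
by split => //; exists U.
Qed.

End DiracTransfer.

Theorem theorem4 (R : realType) (m : nat) (Q : R -> 'M[R[i]]_m)
  (Q_L1loc : forall j k, L1locC (fun x => Q x j k))
  (Q_sym : {ae (@lebesgue_measure R), forall x, Q x = (Q x)^T}) :
  [/\ essentially_J_selfadjoint (Dmin Q),
      op_closure (Dmin Q) = op_conj Jconj (adjoint (Dmin Q)),
      op_closure (Dmin Q) = Dmax Q &
      J_selfadjoint (Dmax Q)].
Proof.
have [Phi [h1 h2 h3]] := dirac_fundamental Q_L1loc Q_sym.
have clE := op_closure_DminE h1 h2.
have J := J_selfadjoint_Dmax h1 h2 h3.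
split; [|by rewrite clE; exact: Dmax_op_conj h1 h2 h3|exact: clE|exact: J].
split; [exact: linear_Dmin h1 h2|exact: dense_Dmin h1 h2| |by rewrite clE].
by rewrite /closable clE; have [] := linear_Dmax h1 h2.
Qed.
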